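(* Let $S\subseteq\mathbb{N}$ be a set of positive integers such that $|S\cap[1,n]|=o(n/\log n)$ as $n\to\infty$. Let $K\subset\mathbb{C}$ be a number field and let $f(z)=\sum_{n\ge 0}a_nz^n\in K[[z]]$ be such that for every field embedding $\sigma:K\to\mathbb{C}$ the series $\sigma(f):=\sum_{n\ge0}\sigma(a_n)z^n$ converges in the open unit disk. Suppose that for every $\beta>1$ we have $$\operatorname{lcm}\{\operatorname{den}(a_k):\ k\le n,\ k\notin S\}<\beta^n$$ for every sufficiently large integer $n$. Then either $f(z)$ admits the unit circle as a natural boundary, or there exists a power series $\sum_{n\ge0} b_nz^n\in K[[z]]$ which is the Maclaurin series of a rational function all of whose poles are roots of unity, such that $a_n=b_n$ for every $n\in\mathbb{N}\setminus S$.
   Context: $\mathbb{N}$ denotes the set of positive integers. For an algebraic number $\alpha$, $\operatorname{den}(\alpha)$ is the smallest positive integer $d$ such that $d\alpha$ is an algebraic integer. The number field $K$ is regarded as a subfield of $\mathbb{C}$, so $f$ defines an analytic function on the open unit disk; ''admits the unit circle as a natural boundary'' means $f$ cannot be analytically continued to a neighborhood of any point of the unit circle. *)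

(* Defs.v *)
From HB Require Import structures.
From mathcomp Require Import all_boot all_order all_algebra all_field.
From mathcomp Require Import all_classical all_reals all_analysis.

Set Implicit Arguments.
Unset Strict Implicit.
Unset Printing Implicit Defensive.

Import Order.TTheory GRing.Theory Num.Theory.
Import numFieldTopology.Exports numFieldNormedType.Exports.

Local Open Scope classical_set_scope.
Local Open Scope ring_scope.

Definition algebraic_integer (K : fieldExtType rat) (x : K) : Prop :=
  integralOver (intr : int -> K) x.

Lemma den_exists (K : fieldExtType rat) (x : K) :
  exists d : nat, (0 < d)%N && `[< algebraic_integer (d%:R * x) >].
Proof.
have /polyOver1P[p Dp] := minPolyOver 1%AS x.
have p_monic : p \is monic.
  by rewrite -(map_monic (in_alg K)) /= -Dp monic_minPoly.
have px0 : root (map_poly (in_alg K) p) x by rewrite /= -Dp root_minPoly.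
have [q [e nz_e Dq]] := rat_poly_scale p.
pose d := `|e|%N; have d_gt0 : (0 < d)%N by rewrite absz_gt0.
exists d; rewrite d_gt0; apply/asboolP.
pose n := (size p).-1.
have sz_p : size p = n.+1.
  by rewrite prednK // lt0n size_poly_eq0 monic_neq0.
have p_int i : p`_i * d%:R \is a Num.int.
  rewrite Dq coefZ coef_map /= mulrAC rpredM ?intr_int // /d.
  have [-> | ->] : `|e|%N%:R = e%:~R :> rat \/ `|e|%N%:R = - e%:~R :> rat.
    rewrite -[_%:R]/(`|e|%N%:Z%:~R) abszE.
    by case: (ger0P e) => _; [left | right; rewrite rmorphN].
  - by rewrite mulVf ?intr_eq0.
  - by rewrite mulrN mulVf ?intr_eq0 // rpredN.
pose c i : rat := p`_i * d%:R ^+ (n - i).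
have c_int i : (i <= n)%N -> c i \is a Num.int.
  rewrite /c leq_eqVlt => /predU1P[-> | lt_in].
    have -> : p`_n = 1 by apply/eqP; rewrite -[_ == _]/(p \is monic).
    by rewrite subnn mulr1.
  by rewrite -(subnSK lt_in) exprS mulrA rpredM ?p_int // rpredX ?rpred_nat.
pose r := \poly_(i < n.+1) Num.floor (c i).
have cE i : (i <= n)%N -> (Num.floor (c i))%:~R = c i.
  by move=> le_in; rewrite floorK ?c_int.
have rn : Num.floor (c n) = 1.
  apply/(@intr_inj rat); rewrite cE // /c subnn mulr1.
  by apply/eqP; rewrite -[_ == _]/(p \is monic).
exists r; first by rewrite monicE lead_coef_poly // rn.
have -> : map_poly intr r = \poly_(i < n.+1) (in_alg K (c i)).
  apply/polyP=> i; rewrite coef_map !coef_poly; case: ltnP => //= le_in.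
  by rewrite -[in RHS]cE // -[RHS]/(in_alg K _) rmorph_int.
rewrite rootE horner_poly.
move: px0; rewrite rootE horner_coef size_map_poly sz_p => /eqP px0.
rewrite (eq_bigr (fun i : 'I_n.+1 => d%:R ^+ n * ((map_poly (in_alg K) p)`_i * x ^+ i))).
  by rewrite -mulr_sumr px0 mulr0.
move=> i _; rewrite coef_map /c rmorphM rmorphXn rmorph_nat exprMn.
have -> : d%:R ^+ n = d%:R ^+ (n - i) * d%:R ^+ i :> K.
  by rewrite -exprD subnK // -ltnS.
by rewrite -!mulrA mulrCA; congr (_ * _); rewrite mulrCA.
Qed.

Definition den (K : fieldExtType rat) (x : K) : nat := ex_minn (den_exists x).

(* Stated over an abstract numClosedFieldType C, with the topology that the
   library derives from its norm. To be used with C := R[i], on which the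
   library declares no topology instance. *)
Section PowerSeries.
Variable C : numClosedFieldType.
Implicit Types (a b c : nat -> C) (g : C -> C) (z zeta : C).

(* The library's [pseries] is restricted to a realType. *)
Definition cpseries a z : nat -> C := series (fun n => a n * z ^+ n).

Definition cpsum a z : C := limn (cpseries a z).

Definition converges_on_unit_disc a : Prop :=
  forall z, `|z| < 1 -> cvgn (cpseries a z).

Definition power_series_at c (z0 : C) g : Prop :=
  \forall z \near z0, cpseries c (z - z0) @ \oo --> g z.

Definition analytic_on (U : set C) g : Prop :=
  forall z0, U z0 -> exists c, power_series_at c z0 g.

Definition continues_at a zeta : Prop :=
  exists (U : set C) g,
    [/\ open_nbhs zeta U, analytic_on U g &
        forall z, U z -> `|z| < 1 -> g z = cpsum a z].

Definition natural_boundary a : Prop :=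
  forall zeta, `|zeta| = 1 -> ~ continues_at a zeta.

(* The poles of P / Q are the roots of Q because P and Q are coprime. Since 0
   is not a root of unity, the condition on the roots forces Q.[0] != 0. *)
Definition rational_with_root_of_unity_poles b : Prop :=
  exists P Q : {poly C},
    [/\ coprimep P Q,
        forall x, root Q x -> exists2 m, (0 < m)%N & m.-unity_root x &
        power_series_at b 0 (fun z => P.[z] / Q.[z])].

End PowerSeries.

(* Main.v *)
Require Import Defs.
From HB Require Import structures.
From mathcomp Require Import all_boot all_order all_algebra all_fingroup all_field.
From mathcomp Require Import all_classical all_reals all_analysis.
From mathcomp.real_closed Require Import complex.
From mathcomp Require Import zify ring lra.
Import Order.TTheory GRing.Theory Num.Theory.
Import VectorInternalTheory.
Import numFieldTopology.Exports numFieldNormedType.Exports.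
Local Open Scope ring_scope.

Set Implicit Arguments.
Unset Strict Implicit.
Unset Printing Implicit Defensive.

(** Suppose that [f] continues analytically across a point [zeta] of the unit
    circle, say [zeta = 1]; write [c] for the coefficient sequence in [C].

    Integrating [f] over a circle of radius [r < 1] with a dent pushed out
    beyond the unit circle near [1] shows that the functional
    [p |-> sum_j p_j c_j] on polynomials is bounded by the supremum of [|p(1/z)|]
    on the dented circle. Some monic [P] of degree [d] satisfies
    [|P(1/z)| <= theta < 1] there, so the functional is exponentially small on [P^m].

    Kill the coefficients with index in [S] by multiplying [a_k] with the
    product of the [k - s] for [s] in [S], [M <= s < E]; sparsity of [S] makes
    this factor [exp(o(E))]. A minor of order [n], comparable to [E], of the
    Hankel matrix of these coefficients is, up to a denominator [exp(o(n^2))],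
    an algebraic integer with conjugates [exp(o(n^2))]. Column operations with
    the monic polynomials [P^(j / d) w^(j mod d)] bound its distinguished
    conjugate by [theta^(const n^2)]: multiplying [c_j] by [j - s] is a first
    order differential operator on polynomials, which costs one power of [P].
    The product of the conjugates is then less than [1] and the minor vanishes.

    The resulting linear relations on windows glue to a linearly recurrent [b]
    that agrees with [a] off [S]; the factors [k - s] are divided out by a Bezout
    identity between the products for two disjoint ranges of [s]. As [S] has
    density [0], [b] agrees with [a] on many long intervals. By pigeonhole, [b]
    has a recurrence with coefficients in [{-1, 0, 1}], hence bounded
    denominators, and the subexponential growth of all conjugates of [a] puts the
    roots of its minimal recurrence in the closed unit disc. Discarding the
    multiplicities leaves a sequence of algebraic integers, up to a denominator,
    with bounded conjugates: it is eventually periodic, and the roots are roots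
    of unity. *)

(** * Moduli and subexponential sequences *)

(** Nothing is known about the denominators of [a] on [S], and overwriting these coefficients would
    destroy the continuation of [f]. Multiplying [a_k] by the product of the [k - s] amounts to
    applying the operators [z d/dz - s], which preserve the continuation. The bound [o(n / log n)]
    makes [E ^ |S cap [0, E)|] equal to [exp(o(E))].

    That some [theta < 1] exists reflects a capacity: for [r] near 1, the image under [1/z] of a
    circle dented outwards has capacity less than 1. [P] and [theta] must not depend on [r], because
    the minors also involve powers of [1/r], which have to be [exp(o(n^2))]: [r] moves towards 1
    while [P] stays fixed.

    Only the distinguished embedding gains from the continuation; convergence in the unit disc is
    all that is used at the others. The threshold for [E] is uniform in [M <= E / 2], so that it
    serves both ranges of the Bezout identity. *)

Section Modulus.
Variable R : realType.
Implicit Types (z w : R[i]) (x y : R).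

(** The norm of [R[i]] is valued in [R[i]]; as an element of [R] the modulus can enter [expR], [ln]
    and linear arithmetic. *)
Definition nm z : R := complex.Re `|z|.

Lemma nmE z : `|z| = (nm z)%:C%C.
Proof. by rewrite /nm RRe_real // normr_real. Qed.

Lemma nm_le z x : (`|z| <= x%:C%C) = (nm z <= x).
Proof. by rewrite nmE lecR. Qed.

Lemma nm_lt z x : (`|z| < x%:C%C) = (nm z < x).
Proof. by rewrite nmE ltcR. Qed.

Lemma nm_ge0 z : 0 <= nm z.
Proof. by rewrite -lecR -nmE normr_ge0. Qed.

Lemma nm_real x : nm x%:C%C = `|x|.
Proof. by apply: complexI; rewrite -nmE normc_def /= expr0n addr0 sqrtr_sqr. Qed.

Lemma nm0 : nm 0 = 0. Proof. by rewrite /nm normr0. Qed.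

Lemma nm1 : nm 1 = 1. Proof. by rewrite /nm normr1. Qed.

Lemma nm_eq0 z : (nm z == 0) = (z == 0).
Proof. by rewrite -(inj_eq (@complexI R)) -nmE normr_eq0. Qed.

Lemma nmM z w : nm (z * w) = nm z * nm w.
Proof. by apply: complexI; rewrite rmorphM /= -!nmE normrM. Qed.

Lemma nmN z : nm (- z) = nm z.
Proof. by rewrite /nm normrN. Qed.

Lemma nmX z n : nm (z ^+ n) = nm z ^+ n.
Proof. by elim: n => [|n IHn]; rewrite ?expr0 ?nm1 // !exprS nmM IHn. Qed.

Lemma nmV z : nm z^-1 = (nm z)^-1.
Proof. by apply: complexI; rewrite fmorphV /= -!nmE normfV. Qed.

Lemma nm_nat n : nm n%:R = n%:R.
Proof. by apply: complexI; rewrite rmorph_nat -nmE normr_nat. Qed.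

Lemma nmD z w : nm (z + w) <= nm z + nm w.
Proof. by rewrite -lecR rmorphD /= -!nmE ler_normD. Qed.

Lemma nmB z w : nm (z - w) <= nm z + nm w.
Proof. by rewrite -(nmN w) nmD. Qed.

Lemma nm_dist z w : nm (z - w) = nm (w - z).
Proof. by rewrite -nmN opprB. Qed.

Lemma nm_sum I (r : seq I) (P : pred I) (F : I -> R[i]) :
  nm (\sum_(i <- r | P i) F i) <= \sum_(i <- r | P i) nm (F i).
Proof.
apply: (big_ind2 (fun z x => nm z <= x)) => [|z x w y zx wy|//]; first by rewrite nm0.
by rewrite (le_trans (nmD _ _)) ?lerD.
Qed.

Lemma nm_prod I (r : seq I) (P : pred I) (F : I -> R[i]) :
  nm (\prod_(i <- r | P i) F i) = \prod_(i <- r | P i) nm (F i).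
Proof. by apply: big_morph; [apply: nmM | apply: nm1]. Qed.

End Modulus.

Section Subexponential.
Variable R : realType.
Implicit Types (u v : nat -> R) (e : R).

Definition subexp u := forall e, 0 < e ->
  exists n0, forall n, (n0 <= n)%N -> u n <= expR (e * n%:R).

Lemma subexp_le u v : (exists n0, forall n, (n0 <= n)%N -> u n <= v n) -> subexp v -> subexp u.
Proof.
move=> [m uv] sv e e0; have [n0 vn] := sv e e0; exists (maxn m n0) => n.
by rewrite geq_max => /andP[/uv uvn /vn]; apply: le_trans.
Qed.

Lemma subexpM u v : (forall n, 0 <= u n) -> (forall n, 0 <= v n) ->
  subexp u -> subexp v -> subexp (fun n => u n * v n).
Proof.
move=> u0 v0 su sv e e0; have e20 : 0 < e / 2 by rewrite divr_gt0.
have [m um] := su _ e20; have [n0 vn] := sv _ e20; exists (maxn m n0) => n.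
rewrite geq_max => /andP[/um un /vn vn'].
have -> : e * n%:R = e / 2 * n%:R + e / 2 * n%:R by field.
by rewrite expRD ler_pM.
Qed.

Lemma expR_ge_lin (x : R) : 0 <= x -> x <= expR x.
Proof. by move=> x0; apply: le_trans (expR_ge1Dx x); rewrite lerDr. Qed.

Lemma subexp_cst (c : R) : subexp (fun=> c).
Proof.
move=> e e0; exists (Num.bound (c / e)) => n len.
have [c0 | c0] := ltP c 0; first by rewrite (le_trans (ltW c0)) ?expR_ge0.
apply: le_trans (expR_ge_lin _); last by rewrite mulr_ge0 // ltW.
rewrite -ler_pdivrMl // mulrC (le_trans (ltW (archi_boundP _))) ?divr_ge0 ?ler_nat //.
exact: ltW.
Qed.

Lemma subexp_id : subexp (fun n => n%:R).
Proof.
(* [exp x >= (x / 2)^2], and [(e n / 2)^2 >= n] once [n >= 4 / e^2]. *)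
move=> e e0; exists (Num.bound (4 / e ^+ 2)) => n len.
have e2 : 0 < e ^+ 2 by rewrite exprn_gt0.
have nb : 4 / e ^+ 2 <= n%:R.
  apply: le_trans (ltW (archi_boundP _)) _; rewrite ?ler_nat //.
  by rewrite divr_ge0 // ltW.
set x := e * n%:R; have x0 : 0 <= x by rewrite mulr_ge0 // ltW.
have -> : expR x = expR (x / 2) ^+ 2 by rewrite expr2 -expRD; congr expR; field.
apply: (@le_trans _ _ ((x / 2) ^+ 2)); last first.
  by rewrite lerXn2r ?nnegrE ?expR_ge0 ?expR_ge_lin //; lra.
have -> : (x / 2) ^+ 2 = n%:R * (n%:R * e ^+ 2 / 4) :> R by rewrite /x; field.
by rewrite ler_peMr ?ler0n // ler_pdivlMr // mul1r -ler_pdivrMr.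
Qed.

Lemma subexpX u k : (forall n, 0 <= u n) -> subexp u -> subexp (fun n => u n ^+ k).
Proof.
move=> u0 su; elim: k => [|k IHk]; first exact: subexp_cst.
apply: (@subexp_le _ (fun n => u n * u n ^+ k)); last by apply: subexpM => // n; rewrite exprn_ge0.
by exists 0%N => n _; rewrite exprS.
Qed.

Lemma subexp_affine u c d : (0 < c)%N -> subexp u -> subexp (fun n => u (c * n + d)%N).
Proof.
move=> c0 su e e0; have cd0 : 0 < (c + d)%N%:R :> R by rewrite ltr0n addn_gt0 c0.
(* For [n >= 1] one has [c n + d <= (c + d) n], hence the rate [e / (c + d)] and the threshold
   [m.+1]. *)
have [m um] := su (e / (c + d)%N%:R) (divr_gt0 e0 cd0).
exists m.+1 => n ltmn; apply: le_trans (um _ _) _.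
  by rewrite (leq_trans (ltnW ltmn)) // (leq_trans _ (leq_addr _ _)) // leq_pmull.
rewrite ler_expR mulrAC ler_pdivrMr // -mulrA (ler_wpM2l (ltW e0)) // -natrM ler_nat.
by nia.
Qed.

End Subexponential.

(** * Linear recurrences *)

Section ShiftAction.
Variable K : comNzRingType.
Implicit Types (P Q : {poly K}) (u v : nat -> K).

(** [X] acts as the shift, so sequences form a [K[X]]-module ([act_mul]), and [act Q u = 0] is the
    linear recurrence with characteristic polynomial [Q]. *)
Definition act Q u : nat -> K := fun k => \sum_(j < size Q) Q`_j * u (k + j)%N.

Lemma actE n Q u k : (size Q <= n)%N ->
  act Q u k = \sum_(j < n) Q`_j * u (k + j)%N.
Proof.
move=> le_n; rewrite /act (big_ord_widen n (fun j => Q`_j * u (k + j)%N)) //.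
rewrite big_mkcond /=; apply: eq_bigr => j _; case: ltnP => // le_j.
by rewrite nth_default // mul0r.
Qed.

Lemma eq_act Q u v k :
  (forall j, (j < size Q)%N -> u (k + j)%N = v (k + j)%N) -> act Q u k = act Q v k.
Proof. by move=> uv; apply: eq_bigr => j _; rewrite uv. Qed.

Lemma act0 Q k : act Q (fun=> 0) k = 0.
Proof. by rewrite /act big1 // => j _; rewrite mulr0. Qed.

Lemma act0l u k : act 0 u k = 0.
Proof. by rewrite /act size_poly0 big_ord0. Qed.

Lemma actD P Q u k : act (P + Q) u k = act P u k + act Q u k.
Proof.
pose n := maxn (size P) (size Q).
rewrite (@actE n (P + Q)) ?size_polyD // (@actE n P) ?leq_maxl // (@actE n Q) ?leq_maxr //.
by rewrite -big_split /=; apply: eq_bigr => j _; rewrite coefD mulrDl.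
Qed.

Lemma actZ c Q u k : act (c *: Q) u k = c * act Q u k.
Proof.
rewrite (@actE (size Q)) ?size_scale_leq // mulr_sumr.
by apply: eq_bigr => j _; rewrite coefZ mulrA.
Qed.

Lemma actN Q u k : act (- Q) u k = - act Q u k.
Proof. by rewrite -scaleN1r actZ mulN1r. Qed.

Lemma actB P Q u k : act (P - Q) u k = act P u k - act Q u k.
Proof. by rewrite actD actN. Qed.

Lemma act_sum I (r : seq I) (P : pred I) (F : I -> {poly K}) u k :
  act (\sum_(i <- r | P i) F i) u k = \sum_(i <- r | P i) act (F i) u k.
Proof.
by apply: (big_ind2 (fun p x => act p u k = x)) => [|p x q y <- <-|//];
  rewrite ?act0l ?actD.
Qed.

Lemma actXn n u k : act 'X^n u k = u (k + n)%N.
Proof.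
rewrite (@actE n.+1) ?size_polyXn // big_ord_recr /= coefXn eqxx mul1r.
by rewrite big1 ?add0r // => j _; rewrite coefXn (ltn_eqF (ltn_ord j)) mul0r.
Qed.

Lemma actC c u k : act c%:P u k = c * u k.
Proof. by rewrite (@actE 1) ?size_polyC_leq1 // big_ord1 coefC addn0. Qed.

Lemma act_addr Q u v k : act Q (fun l => u l + v l) k = act Q u k + act Q v k.
Proof. by rewrite /act -big_split; apply: eq_bigr => j _; rewrite mulrDr. Qed.

Lemma act_scaler Q c u k : act Q (fun l => c * u l) k = c * act Q u k.
Proof. by rewrite /act mulr_sumr; apply: eq_bigr => j _; rewrite mulrCA. Qed.

Lemma act_subr Q u v k : act Q (fun l => u l - v l) k = act Q u k - act Q v k.
Proof.
rewrite /act -sumrB; apply: eq_bigr => j _.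
by rewrite mulrBr.
Qed.

Lemma act_mul P Q u k : act (P * Q) u k = act P (act Q u) k.
Proof.
rewrite -{1}[P]coefK poly_def mulr_suml act_sum; apply: eq_bigr => i _.
rewrite -scalerAl actZ; congr (_ * _).
elim: {i}(i : nat) k => [|i IHi] k; first by rewrite expr0 mul1r addn0.
have XT (T : {poly K}) w l : act ('X * T) w l = act T w l.+1.
  rewrite -commr_polyX (@actE (size T).+1); last first.
    by apply: leq_trans (size_polyMleq _ _) _; rewrite size_polyX addn2.
  rewrite big_ord_recl coefMX eqxx mul0r add0r.
  by apply: eq_bigr => j _; rewrite coefMX /= addnS addSn.
by rewrite exprS -mulrA XT addnS -addSn -IHi.
Qed.

Lemma actX_comm P Q u k : act P (act Q u) k = act Q (act P u) k.
Proof. by rewrite -!act_mul mulrC. Qed.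

End ShiftAction.

Section Recurrence.
Variable K : fieldType.
Implicit Types (P Q : {poly K}) (u v : nat -> K).

Lemma act_vanish Q u M : (forall k, (M <= k)%N -> u k = 0) ->
  forall k, (M <= k)%N -> act Q u k = 0.
Proof.
move=> u0 k le_k; rewrite -(act0 Q k); apply: eq_act => j _.
by rewrite u0 // (leq_trans le_k) ?leq_addr.
Qed.

Lemma act_mul_vanishr P Q u M : (forall k, (M <= k)%N -> act Q u k = 0) ->
  forall k, (M <= k)%N -> act (P * Q) u k = 0.
Proof. by move=> Qu k; rewrite act_mul; apply: act_vanish. Qed.

Lemma act_mul_vanishl P Q u M : (forall k, (M <= k)%N -> act P u k = 0) ->
  forall k, (M <= k)%N -> act (P * Q) u k = 0.
Proof. by move=> Pu k; rewrite mulrC; apply: act_mul_vanishr. Qed.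

(** The relation at index [k - deg Q] determines [v k] from the preceding values, the leading
    coefficient being invertible; relations starting in [[M, N)] therefore reach up to
    [N + deg Q]. *)
Lemma rec_unique_window Q v M N : Q != 0 ->
  (forall k, (M <= k < N)%N -> act Q v k = 0) ->
  (forall k, (M <= k < M + (size Q).-1)%N -> v k = 0) ->
  forall k, (M <= k < N + (size Q).-1)%N -> v k = 0.
Proof.
move=> nzQ Qv v0; have szQ : (0 < size Q)%N by rewrite size_poly_gt0.
set d := (size Q).-1 in v0 *; elim/ltn_ind => k IHk /andP[leMk ltk].
have [ltMd | lek] := ltnP k (M + d); first by rewrite v0 ?leMk.
have : act Q v (k - d)%N = 0 by apply: Qv; lia.
rewrite (@actE _ d.+1); last by rewrite /d prednK.
rewrite big_ord_recr /= subnK; last lia.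
rewrite big1 ?add0r => [|j _]; last first.
  by rewrite IHk ?mulr0 //; have := ltn_ord j; lia.
move=> /eqP; rewrite mulf_eq0 => /orP[|/eqP //].
by rewrite -[Q`_d]/(lead_coef Q) lead_coef_eq0 (negPf nzQ).
Qed.

Lemma rec_unique Q v M : Q != 0 ->
  (forall k, (M <= k)%N -> act Q v k = 0) ->
  (forall k, (M <= k < M + (size Q).-1)%N -> v k = 0) ->
  forall k, (M <= k)%N -> v k = 0.
Proof.
move=> nzQ Qv v0 k leMk; apply: (@rec_unique_window Q v M k.+1 nzQ) => //; last lia.
by move=> l /andP[/Qv].
Qed.

Lemma rec_extend Q u M : Q != 0 -> exists2 w,
  forall k, (M <= k)%N -> act Q w k = 0 &
  forall N, (forall k, (M <= k < N)%N -> act Q u k = 0) ->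
  forall k, (M <= k < N + (size Q).-1)%N -> w k = u k.
Proof.
move=> nzQ; have szQ : (0 < size Q)%N by rewrite size_poly_gt0.
pose w k := act ('X^(k - M) %% Q) u M.
have Qw k : (M <= k)%N -> act Q w k = 0.
  move=> leMk; have <- : act (('X^(k - M) * Q) %% Q) u M = 0.
    by rewrite modp_mull act0l.
  have -> : 'X^(k - M) * Q = \sum_(j < size Q) Q`_j *: 'X^(k - M + j).
    rewrite -{1}[Q]coefK poly_def mulr_sumr; apply: eq_bigr => j _.
    by rewrite -scalerAr exprD.
  rewrite (big_morph _ (fun p q => modpD Q p q) (mod0p Q)) act_sum.
  apply: eq_bigr => j _; rewrite modpZl actZ /w.
  by rewrite -addnBAC.
exists w => // N Qu k kMN; apply/eqP; rewrite -subr_eq0; apply/eqP.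
apply: (@rec_unique_window Q (fun l => w l - u l) M N) kMN => // l lN.
  by rewrite act_subr Qu // Qw ?subrr //; case/andP: lN.
rewrite /w modp_small ?size_polyXn; last by rewrite -(prednK szQ) ltnS; lia.
by rewrite actXn subnKC ?subrr //; lia.
Qed.

(** Leibniz rule: the commutator of multiplication by the index with the action of [Q] is the action
    of [X Q']. *)
Lemma act_mulX Q u c k : act Q (fun l => (l%:R - c) * u l) k =
  (k%:R - c) * act Q u k + act ('X * Q^`()) u k.
Proof.
rewrite (@actE _ (size Q) ('X * _)); last first.
  have [-> | nzQ] := eqVneq Q 0; first by rewrite deriv0 mulr0.
  apply: leq_trans (size_polyMleq _ _) _; rewrite size_polyX.
  exact: lt_size_deriv.
rewrite mulr_sumr -big_split /=; apply: eq_bigr => j _.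
rewrite -commr_polyX coefMX natrD; case: (nat_of_ord j) => [|i] /=; first by ring.
by rewrite coef_deriv -mulr_natr; ring.
Qed.

(** One factor [Q] leaves [X Q' u] by the Leibniz rule, and the second factor kills it. This
    doubling of the order accounts for [P ^+ 2] in the comparison of consecutive windows. *)
Lemma act_sqr_mulX Q u c M : (forall k, (M <= k)%N -> act Q u k = 0) ->
  forall k, (M <= k)%N -> act (Q ^+ 2) (fun l => (l%:R - c) * u l) k = 0.
Proof.
move=> Qu k leMk; rewrite expr2 act_mul.
have -> : act Q (act Q (fun l => (l%:R - c) * u l)) k = act Q (act ('X * Q^`()) u) k.
  apply: eq_act => j _; rewrite act_mulX Qu ?mulr0 ?add0r //.
  by rewrite (leq_trans leMk) ?leq_addr.
by rewrite actX_comm; apply: act_vanish leMk.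
Qed.

Definition linrec M u := exists2 Q, Q != 0 & forall k, (M <= k)%N -> act Q u k = 0.

Lemma linrec_add M u v : linrec M u -> linrec M v -> linrec M (fun k => u k + v k).
Proof.
move=> [P nzP Pu] [Q nzQ Qv]; exists (P * Q); first by rewrite mulf_neq0.
move=> k leMk; rewrite act_addr.
by rewrite (@act_mul_vanishl _ _ _ M) ?(@act_mul_vanishr _ _ _ M) ?addr0.
Qed.

Lemma linrec_poly M u (G : {poly K}) : linrec M u -> linrec M (fun k => G.[k%:R] * u k).
Proof.
move=> lr_u; elim/poly_ind: G => [|G c IHG].
  exists 1; first exact: oner_neq0.
  by move=> k _; rewrite -[1]/(1%:P) actC horner0 mul0r mulr0.
suff H : linrec M (fun k => (k%:R - 0) * (G.[k%:R] * u k) + c * u k).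
  have [Q nzQ Qv] := H; exists Q => // k /Qv <-; apply: eq_act => j _.
  by rewrite hornerMXaddC; ring.
apply: linrec_add.
  have [Q nzQ Qv] := IHG; exists (Q ^+ 2); first by rewrite expf_neq0.
  exact: act_sqr_mulX.
by have [Q nzQ Qv] := lr_u; exists Q => // k /Qv; rewrite act_scaler => ->; rewrite mulr0.
Qed.

Lemma linrec_widen M N u : (M <= N)%N -> linrec M u -> linrec N u.
Proof. by move=> leMN [Q nzQ Qu]; exists Q => // k /(leq_trans leMN) /Qu. Qed.

End Recurrence.

(** * From window relations to a recurrence off the exceptional set *)

Section SparseRecurrence.
Variables (K : fieldType) (S : pred nat) (a : nat -> K).
Hypothesis K0 : [pchar K] =i pred0.

Lemma eqr_nat_pchar0 m n : (m%:R == n%:R :> K) = (m == n).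
Proof.
wlog le_mn : m n / (m <= n)%N => [H|].
  by case: (leqP m n) => [/H // | /ltnW /H]; rewrite eq_sym => ->; rewrite eq_sym.
rewrite eq_sym -subr_eq0 -natrB // ((GRing.pcharf0P K).1 K0) subn_eq0.
by rewrite eqn_leq le_mn.
Qed.

Definition sieve M E : {poly K} := \prod_(M <= s < E | S s) ('X - s%:R%:P).

Lemma sieve_recr M E : (M <= E)%N ->
  sieve M E.+1 = (if S E then 'X - E%:R%:P else 1) * sieve M E.
Proof. by move=> leME; rewrite /sieve big_mkcond big_nat_recr //= -big_mkcond mulrC. Qed.

Lemma sieve_neq0 M E k : ~~ S k -> (sieve M E).[k%:R] != 0.
Proof.
move=> nSk; rewrite horner_prod prodf_seq_neq0; apply/allP => s _.
apply/implyP => Ss; rewrite hornerXsubC subr_eq0.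
by rewrite eqr_nat_pchar0; apply: contraNneq nSk => ->.
Qed.

Lemma sieve_eq0 M E k : S k -> (M <= k < E)%N -> (sieve M E).[k%:R] = 0.
Proof.
move=> Sk kME; rewrite horner_prod (big_rem k) ?mem_index_iota //= Sk.
by rewrite hornerXsubC subrr mul0r.
Qed.

Lemma coprime_sieve M N E : coprimep (sieve M N) (sieve N E).
Proof.
rewrite /sieve big_mkcond big_seq; apply: (big_ind (fun p => coprimep p (sieve N E))).
- exact: coprime1p.
- by move=> p q pE qE; rewrite coprimepMl pE.
move=> s; rewrite mem_index_iota => /andP[_ ltsN]; case: ifP => _; last exact: coprime1p.
rewrite coprimep_sym coprimep_XsubC /sieve rootE horner_prod prodf_seq_neq0.
apply/allP => t; rewrite mem_index_iota => /andP[leNt _]; apply/implyP => _.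
rewrite hornerXsubC subr_eq0 eqr_nat_pchar0; lia.
Qed.

(* For n = (E - M) / 7 the indices k + j, with M <= k < M + 6 n and j < n, stay
   below E, and 6 n exceeds the order of the recurrences compared below. *)
Definition window_size M E := ((E - M) %/ 7)%N.

(** Linear dependence of the [n] columns of a [6 n] by [n] Hankel matrix of the sieved sequence,
    read as a recurrence that holds on a window. *)
Definition window_relation M E := exists Q : {poly K},
  [/\ Q != 0, (size Q <= window_size M E)%N &
   forall k, (M <= k < M + 6 * window_size M E)%N ->
     act Q (fun l => (sieve M E).[l%:R] * a l) k = 0].

(* Two recurrences of order at most n and 2 n that agree on a window of length
   6 n agree forever, so passing from E to E + 1 multiplies the extended
   sequence by k - E if S E, and by 1 otherwise. *)
Lemma window_relation_linrec M E1 :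
    (M + 7 <= E1)%N -> (forall E, (E1 <= E)%N -> window_relation M E) ->
  exists2 u, linrec M u &
    forall k, (M <= k)%N -> ~~ S k -> (sieve M E1).[k%:R] * a k = u k.
Proof.
move=> leME1 KP.
pose good E (Qu : {poly K} * (nat -> K)) := [/\ Qu.1 != 0,
  (size Qu.1 <= window_size M E)%N, forall k, (M <= k)%N -> act Qu.1 Qu.2 k = 0 &
  forall k, (M <= k < M + 6 * window_size M E)%N -> Qu.2 k = (sieve M E).[k%:R] * a k].
have ex E : (E1 <= E)%N -> exists Qu, good E Qu.
  move=> /KP[Q [nzQ szQ Qa]].
  have [w Qw wa] := rec_extend (fun l => (sieve M E).[l%:R] * a l) M nzQ.
  by exists (Q, w); split=> //= k kM; apply: wa Qa _ _; lia.
have step E Qu Qv : (E1 <= E)%N -> good E Qu -> good E.+1 Qv ->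
    forall k, (M <= k)%N -> Qv.2 k = (if S E then 'X - E%:R%:P else 1).[k%:R] * Qu.2 k.
  case: Qu Qv => [P u] [Q v] leE [/= nzP szP Pu ua] [/= nzQ szQ Qv va] k leMk.
  pose g := fun l => (if S E then 'X - E%:R%:P else 1).[l%:R] * u l.
  have Pg l : (M <= l)%N -> act (P ^+ 2) g l = 0.
    rewrite /g; case: (S E) => leMl.
      rewrite -(@act_sqr_mulX K P u E%:R M Pu l leMl).
      by apply: eq_act => j _; rewrite hornerXsubC.
    rewrite expr2 act_mul; apply: act_vanish leMl => j leMj.
    by rewrite -(Pu j leMj); apply: eq_act => i _; rewrite hornerC mul1r.
  apply/eqP; rewrite -subr_eq0; apply/eqP.
  apply: (@rec_unique _ (Q * P ^+ 2) (fun l => v l - g l) M) leMk => [|l leMl|l lM].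
  - by rewrite mulf_neq0 ?expf_neq0.
  - by rewrite act_subr (@act_mul_vanishl _ _ _ _ M) ?(@act_mul_vanishr _ _ _ _ M) ?subr0.
  have szQP : ((size (Q * P ^+ 2)%R).-1 <= 6 * window_size M E)%N.
    rewrite size_mul ?expf_neq0 // expr2 size_mul //.
    have : (0 < size P)%N by rewrite size_poly_gt0.
    have : (0 < size Q)%N by rewrite size_poly_gt0.
    move: szP szQ; rewrite /window_size; set n1 := size Q; set n2 := size P; lia.
  have lE : (M <= l < M + 6 * window_size M E)%N.
    case/andP: lM => -> lM /=; apply: leq_trans lM _; by rewrite leq_add2l.
  have lE1 : (M <= l < M + 6 * window_size M E.+1)%N.
    by move: lE; rewrite /window_size; lia.
  by rewrite va // /g ua // sieve_recr ?hornerM ?mulrA ?subrr //; lia.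
have [[Q1 u1] good1] := ex E1 (leqnn _).
exists u1; first by case: good1 => /= nzQ _ Qu _; exists Q1.
(* Telescoping of [step], written without division since [sieve M E1] vanishes at the points of [S]
   in its range. *)
have chain t Qv : good (E1 + t)%N Qv ->
    forall k, (M <= k)%N -> Qv.2 k * (sieve M E1).[k%:R] = (sieve M (E1 + t)).[k%:R] * u1 k.
  elim: t Qv => [|t IHt] Qv.
    rewrite addn0 => gv k leMk; rewrite mulrC; congr (_ * _).
    case: Qv gv => [Q v] [/= nzQ szQ Qv va].
    case: good1 => /= nzQ1 szQ1 Qu1 ua1.
    apply/eqP; rewrite -subr_eq0; apply/eqP.
    apply: (@rec_unique _ (Q * Q1) (fun l => v l - u1 l) M) leMk => [|l leMl|l lM].
    - by rewrite mulf_neq0.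
    - by rewrite act_subr (@act_mul_vanishl _ _ _ _ M) ?(@act_mul_vanishr _ _ _ _ M) ?subr0.
    have : ((size (Q * Q1)%R).-1 <= 6 * window_size M E1)%N.
      rewrite size_mul //; move: szQ szQ1.
      set n1 := size Q; set n2 := size Q1; lia.
    move=> szQQ; have lE : (M <= l < M + 6 * window_size M E1)%N.
      case/andP: lM => -> lM /=; apply: leq_trans lM _; by rewrite leq_add2l.
    by rewrite va ?ua1 ?subrr.
  rewrite addnS => gv k leMk.
  have [Qu gu] := ex (E1 + t)%N (leq_addr _ _).
  rewrite (step _ _ _ (leq_addr _ _) gu gv k leMk) -mulrA (IHt _ gu) //.
  by rewrite sieve_recr ?hornerM ?mulrA //; lia.
move=> k leMk nSk.
(* Here [window_size] exceeds [k], so the window of [E1 + 7 k] contains [k]; off [S] the value of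
   [sieve M (E1 + 7 k)] at [k] can be cancelled. *)
have [Qv gv] := ex (E1 + 7 * k)%N (leq_addr _ _).
have := chain _ _ gv k leMk; case: gv => _ _ _ va; rewrite va; last first.
  rewrite /window_size; lia.
rewrite -mulrA => /(mulfI (sieve_neq0 _ _ nSk)) <-; exact: mulrC.
Qed.

Lemma window_relation_recurrence E0 :
    (forall M E, (E0 <= E)%N -> (2 * M <= E)%N -> window_relation M E) ->
  exists b k0, linrec k0 b /\ forall k, ~~ S k -> b k = a k.
Proof.
move=> KP; pose E1 := maxn E0 14.
have [||u1 lr1 ua1] := @window_relation_linrec 0 E1.
- by rewrite /E1; lia.
- by move=> E leE; apply: KP; rewrite /E1 in leE *; lia.
have [||u2 lr2 ua2] := @window_relation_linrec E1 (2 * E1).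
- by rewrite /E1; lia.
- by move=> E leE; apply: KP; rewrite /E1 in leE *; lia.
have /Bezout_eq1_coprimepP[[U V] /= UV] := coprime_sieve 0 E1 (2 * E1).
pose w k := U.[k%:R] * u1 k + V.[k%:R] * u2 k.
have [Q nzQ Qw] : linrec E1 w.
  apply: linrec_add; apply: linrec_poly => //; exact: linrec_widen lr1.
(* The sequence [u2] is only known to be a multiple of [a] from [E1] on, so [b] copies [a] below,
   and the recurrence starts at [E1]. *)
exists (fun k => if (k < E1)%N then a k else w k), E1; split.
  exists Q => // k leE1k; rewrite -(Qw k leE1k); apply: eq_act => j _.
  by rewrite ltnNge (leq_trans leE1k) ?leq_addr.
move=> k nSk; case: ltnP => // leE1k.
by rewrite /w -ua1 // -ua2 // !mulrA -mulrDl -!hornerM -hornerD UV hornerC mul1r.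
Qed.

End SparseRecurrence.

(** * Algebraic integers with bounded conjugates *)

(** Transported to [algC], where a rational algebraic integer is an integer. *)
Lemma rat_integral_int (F : numFieldType) (q : rat) :
  integralOver (intr : int -> F) (ratr q) -> q \is a Num.int.
Proof.
case=> p mon_p; have -> : map_poly (intr : int -> F) p = map_poly ratr (map_poly intr p).
  by rewrite -map_poly_comp; apply: eq_map_poly => z /=; rewrite rmorph_int.
rewrite fmorph_root => pq0.
have : (ratr q : algC) \in Aint.
  apply: (@root_monic_Aint (map_poly intr p)); last by apply/polyOverP => i; rewrite coef_map intr_int.
    have -> : map_poly (intr : int -> algC) p = map_poly ratr (map_poly intr p).
      by rewrite -map_poly_comp; apply: eq_map_poly => z /=; rewrite rmorph_int.
    by rewrite fmorph_root.
  exact: monic_map.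
move=> /(Cint_rat_Aint _); rewrite Crat_rat => /(_ isT) /intrP[z qz].
apply/intrP; exists z; apply: (fmorph_inj (ratr : {rmorphism rat -> algC})).
by rewrite rmorph_int.
Qed.

(** * The regular representation and the embeddings of a number field *)

Section NumberField.
Variables (K : fieldExtType rat) (C : numClosedFieldType).
Notation n := (dim K).
Implicit Types (x y : K) (sigma : {rmorphism K -> C}).

Lemma dim_field_gt0 : (0 < n)%N.
Proof.
rewrite lt0n; apply/eqP => n0.
suff : v2r (1 : K) = v2r 0 by move/(can_inj v2rK)/eqP; rewrite oner_eq0.
by apply/rowP => i; have := ltn_ord i; rewrite {2}n0.
Qed.

Definition regular_row x (u : 'rV[rat]_n) : 'rV[rat]_n := v2r (r2v u * x).

Fact regular_row_linear x : linear (regular_row x).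
Proof. by move=> c u v; rewrite /regular_row !linearP /= mulrDl -scalerAl linearP. Qed.

HB.instance Definition _ x := GRing.isLinear.Build rat 'rV[rat]_n 'rV[rat]_n *:%R
  (regular_row x) (regular_row_linear x).

(** Regular representation of [K] over the rationals. Its determinant and trace are the norm and the
    trace of [x], so both are rational without any Galois theory. *)
Definition regular_mx x : 'M[rat]_n := lin1_mx (regular_row x).

Lemma mul_regular_mx x u : u *m regular_mx x = v2r (r2v u * x).
Proof. by rewrite mul_rV_lin1. Qed.

Lemma regular_mxM x y : regular_mx (x * y) = regular_mx x *m regular_mx y.
Proof.
apply/row_matrixP => i; rewrite !rowE mulmxA !mul_regular_mx.
by rewrite v2rK mulrA.
Qed.

Lemma regular_mxD x y : regular_mx (x + y) = regular_mx x + regular_mx y.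
Proof.
apply/row_matrixP => i; rewrite !rowE mulmxDr !mul_regular_mx mulrDr.
by rewrite linearD.
Qed.

Lemma regular_mxZ (c : rat) x : regular_mx (c *: x) = c *: regular_mx x.
Proof.
apply/row_matrixP => i; rewrite !rowE -scalemxAr !mul_regular_mx.
by rewrite -scalerAr linearZ.
Qed.

Lemma regular_mx1 : regular_mx 1 = 1%:M.
Proof.
apply/row_matrixP => i; rewrite !rowE mulmx1 mul_regular_mx.
by rewrite mulr1 r2vK.
Qed.

Definition cregular x : 'M[C]_n := map_mx ratr (regular_mx x).

Lemma cregularM x y : cregular (x * y) = cregular x *m cregular y.
Proof. by rewrite /cregular regular_mxM map_mxM. Qed.

Lemma cregularD x y : cregular (x + y) = cregular x + cregular y.
Proof. by rewrite /cregular regular_mxD map_mxD. Qed.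

Lemma cregular_comm x y : comm_mx (cregular x) (cregular y).
Proof. by rewrite /comm_mx -!cregularM mulrC. Qed.

Definition canonical_basis (i : 'I_n) : K := r2v (delta_mx 0 i).

Lemma canonical_basis_sum x : x = \sum_i v2r x 0 i *: canonical_basis i.
Proof.
rewrite -{1}[x]v2rK [v2r x]row_sum_delta linear_sum /=.
apply: eq_bigr => i _; rewrite linearZ /=; congr (_ *: _).
by rewrite -row_sum_delta.
Qed.

(** On a common eigenvector of all multiplication matrices the eigenvalue is additive and
    multiplicative in [y]: this character is an embedding. *)
Lemma eigenvector_embedding (v : 'rV[C]_n) : v != 0 ->
    (forall y, exists l, v *m cregular y = l *: v) ->
  exists sigma, forall y, v *m cregular y = sigma y *: v.
Proof.
move=> nzv ev; have /existsP[i nzvi] : [exists i, v 0 i != 0].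
  apply: contraNT nzv => /existsPn v0; apply/eqP/rowP => i.
  by rewrite mxE; apply/eqP; have := v0 i; rewrite negbK.
pose f y := (v *m cregular y) 0 i / v 0 i.
have fE y : v *m cregular y = f y *: v.
  by have [l El] := ev y; rewrite /f El mxE mulfK.
have fI y l : v *m cregular y = l *: v -> f y = l.
  by rewrite /f => ->; rewrite mxE mulfK.
have fB : zmod_morphism f.
  move=> x y; apply: fI; rewrite -[y in LHS]opprK -(mulN1r y).
  have -> : - (-1 * y) = y by rewrite mulN1r opprK.
  have -> : x - y = x + (-1) *: y by rewrite scaleN1r.
  rewrite cregularD mulmxDr fE.
  have -> : cregular (-1 *: y) = - cregular y.
    by rewrite /cregular regular_mxZ scaleN1r map_mxN.
  by rewrite mulmxN fE scalerBl.
have fM : monoid_morphism f.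
  split; first by apply: fI; rewrite /cregular regular_mx1 map_mx1 mulmx1 scale1r.
  move=> x y; apply: fI; rewrite cregularM mulmxA fE -scalemxAl fE.
  by rewrite scalerA.
pose fa := GRing.isZmodMorphism.Build K C f fB.
pose fm := GRing.isMonoidMorphism.Build K C f fM.
pose F : {rmorphism K -> C} := HB.pack f fa fm.
by exists F.
Qed.

(** The commuting matrices [cregular y] preserve the eigenspace of [cregular x] for [l] and have a
    common eigenvector in it, whose character sends [x] to [l]. *)
Lemma eigenvalue_embedding x l : root (char_poly (cregular x)) l ->
  exists sigma, sigma x = l.
Proof.
rewrite -eigenvalue_root_char => l_eig; set A := cregular x in l_eig.
pose V := eigenspace A l.
pose As := [seq restrictmx V (cregular (canonical_basis i)) | i <- enum 'I_n].
have stab y : stablemx V (cregular y).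
  exact: comm_mx_stable_eigenspace (cregular_comm _ _).
have [||w nzw /allP /= wP] := @common_eigenvector C (\rank V) As.
- by rewrite lt0n mxrank_eq0.
- move=> _ _ /mapP[i _ ->] /mapP[j _ ->].
  rewrite /comm_mx -!conjmxM ?inE ?stablemx_row_base ?stab //.
  by rewrite cregular_comm.
pose v := w *m row_base V.
have nzv : v != 0 by rewrite mulmx_free_eq0 ?row_base_free.
have evb i : exists l, v *m cregular (canonical_basis i) = l *: v.
  apply/sub_rVP; rewrite -[(_ <= _)%MS]/(stablemx _ _) -stablemx_restrict ?stab //.
  by apply: wP; apply/mapP; exists i; rewrite ?mem_enum.
have [y|sigma sigmaE] := eigenvector_embedding nzv.
  have [L LE] := boolp.choice evb.
  exists (\sum_i ratr (v2r y 0 i) * L i); rewrite {1}[y]canonical_basis_sum.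
  have c0 : cregular (0 : K) = 0.
    by rewrite /cregular -(scale0r (0 : K)) regular_mxZ scale0r map_mx0.
  rewrite (big_morph _ cregularD c0).
  rewrite mulmx_sumr scaler_suml; apply: eq_bigr => i _.
  by rewrite /cregular regular_mxZ map_mxZ -scalemxAr LE scalerA.
exists sigma; apply/eqP; rewrite -subr_eq0; apply/eqP.
have : (v <= V)%MS by rewrite mulmx_sub // eq_row_base.
move=> /eigenspaceP; rewrite -/A sigmaE => /eqP.
by rewrite -subr_eq0 -scalerBl scaler_eq0 (negPf nzv) orbF => /eqP.
Qed.

(** The row of the [sigma]-images of the basis is an eigenvector of the transposed matrix. *)
Lemma embedding_eigenvalue sigma x : root (char_poly (cregular x)) (sigma x).
Proof.
have -> : char_poly (cregular x) = char_poly (cregular x)^T.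
  rewrite /char_poly -det_tr; congr (\det _); apply/matrixP => i j.
  by rewrite !mxE eq_sym.
rewrite -eigenvalue_root_char; apply/eigenvalueP.
exists (\row_i sigma (canonical_basis i)); last first.
  apply/eqP => /rowP v0; have : sigma 1 = 0; last by rewrite rmorph1 => /eqP; rewrite oner_eq0.
  rewrite [1]canonical_basis_sum rmorph_sum big1 // => i _.
  have := v0 i; rewrite !mxE => si0; rewrite -mulr_algl rmorphM /= si0.
  by rewrite mulr0.
apply/rowP => i; rewrite !mxE -rmorphM mulrC.
rewrite [canonical_basis i * x]canonical_basis_sum rmorph_sum.
apply: eq_bigr => j _; rewrite !mxE /regular_row -mulr_algl rmorphM /= mulrC.
congr (_ * _).
by rewrite -(fmorph_eq_rat (sigma \o in_alg K)).
Qed.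

(** The roots of the characteristic polynomial, with multiplicity, serve as the list of conjugates;
    products and sums of conjugates become a determinant and a trace. *)
Lemma regular_conjugates x : exists s : seq C,
  [/\ size s = n, char_poly (cregular x) = \prod_(l <- s) ('X - l%:P),
      forall l, l \in s -> exists sigma, sigma x = l &
      forall sigma, sigma x \in s].
Proof.
have [s sE] := closed_field_poly_normal (char_poly (cregular x)).
move: sE; rewrite (monicP (char_poly_monic _)) scale1r => sE.
exists s; split=> //.
- by have := size_char_poly (cregular x); rewrite sE size_prod_XsubC => -[].
- by move=> l ls; apply: eigenvalue_embedding; rewrite sE root_prod_XsubC.
- by move=> sigma; rewrite -root_prod_XsubC -sE embedding_eigenvalue.
Qed.

Lemma ratr_det_regular x s : size s = n ->
    char_poly (cregular x) = \prod_(l <- s) ('X - l%:P) ->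
  ratr (\det (regular_mx x)) = \prod_(l <- s) l.
Proof.
move=> sz_s sE; have := char_poly_det (cregular x).
rewrite sE coef0_prod_XsubC sz_s => /(mulfI _) -> //; first by rewrite det_map_mx.
by rewrite signr_eq0.
Qed.

Lemma ratr_trace_regular x s : size s = n ->
    char_poly (cregular x) = \prod_(l <- s) ('X - l%:P) ->
  ratr (\tr (regular_mx x)) = \sum_(l <- s) l.
Proof.
move=> sz_s sE; have := char_poly_trace (cregular x) dim_field_gt0.
rewrite sE -[in X in _`_X]sz_s coefPn_prod_XsubC; last by rewrite sz_s -lt0n dim_field_gt0.
by move/oppr_inj ->; rewrite trace_map_mx.
Qed.

Lemma integral_embedding sigma x :
  algebraic_integer x -> integralOver (intr : int -> C) (sigma x).
Proof.
case=> p mon_p px0; exists p => //.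
have <- : map_poly sigma (map_poly intr p) = map_poly intr p.
  by rewrite -map_poly_comp; apply: eq_map_poly => z /=; rewrite rmorph_int.
exact: rmorph_root.
Qed.

Lemma integral_det_regular x : algebraic_integer x -> \det (regular_mx x) \is a Num.int.
Proof.
move=> x_int; have [s [sz_s sE s_emb _]] := regular_conjugates x.
apply: (@rat_integral_int C); rewrite (ratr_det_regular sz_s sE).
have : forall l, l \in s -> integralOver (intr : int -> C) l.
  by move=> l /s_emb[sigma <-]; apply: integral_embedding.
elim: (s) => [|l t IHt] t_int; first by rewrite big_nil; exact: integral1.
rewrite big_cons; apply: integral_mul; first by apply: t_int; rewrite mem_head.
by apply: IHt => l' l't; apply: t_int; rewrite inE l't orbT.
Qed.

Lemma integral_trace_regular x : algebraic_integer x -> \tr (regular_mx x) \is a Num.int.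
Proof.
move=> x_int; have [s [sz_s sE s_emb _]] := regular_conjugates x.
apply: (@rat_integral_int C); rewrite (ratr_trace_regular sz_s sE).
have : forall l, l \in s -> integralOver (intr : int -> C) l.
  by move=> l /s_emb[sigma <-]; apply: integral_embedding.
elim: (s) => [|l t IHt] t_int; first by rewrite big_nil; exact: mxpoly.integral0.
rewrite big_cons; apply: integral_add; first by apply: t_int; rewrite mem_head.
by apply: IHt => l' l't; apply: t_int; rewrite inE l't orbT.
Qed.

Lemma det_regular_neq0 x : x != 0 -> \det (regular_mx x) != 0.
Proof.
move=> nzx; have : \det (regular_mx x *m regular_mx x^-1) = 1.
  by rewrite -regular_mxM mulfV // regular_mx1 det1.
by rewrite det_mulmx => /eqP; apply: contraTneq => ->; rewrite mul0r eq_sym oner_eq0.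
Qed.

(** Liouville's inequality: the norm is a nonzero integer; one conjugate is kept and the [n - 1]
    others are bounded by [B]. *)
Lemma embedding_norm_lower_bound sigma x (B : C) :
    algebraic_integer x -> x != 0 -> (forall tau : {rmorphism K -> C}, `|tau x| <= B) ->
  1 <= `|sigma x| * B ^+ n.-1.
Proof.
move=> x_int nzx xB; have [s [sz_s sE s_emb emb_s]] := regular_conjugates x.
have D_int := integral_det_regular x_int.
have nzD := det_regular_neq0 nzx.
have : 1 <= `|ratr (\det (regular_mx x)) : C|.
  rewrite -(ratr_norm C) -(rmorph1 (ratr : {rmorphism rat -> C})) ler_rat.
  exact: norm_intr_ge1.
rewrite (ratr_det_regular sz_s sE) (big_rem (sigma x)) //= normrM => /le_trans -> //.
rewrite ler_wpM2l // -sz_s -(size_rem (emb_s sigma)) normr_prod.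
have : forall l, l \in rem (sigma x) s -> `|l| <= B.
  by move=> l /mem_rem/s_emb[tau <-].
elim: (rem _ _) => [|l t IHt] tB; first by rewrite big_nil expr0.
rewrite big_cons exprS ler_pM // ?prodr_ge0 //; first by apply: tB; rewrite mem_head.
by apply: IHt => l' l't; apply: tB; rewrite inE l't orbT.
Qed.

Lemma trace_regular_bound x (B : nat) : (forall tau : {rmorphism K -> C}, `|tau x| <= B%:R) ->
  `|\tr (regular_mx x)| <= (n * B)%:R.
Proof.
move=> xB; have [s [sz_s sE s_emb _]] := regular_conjugates x.
rewrite -(ler_rat C) ratr_norm (ratr_trace_regular sz_s sE) -sz_s ratr_nat.
have : forall l, l \in s -> `|l| <= B%:R by move=> l /s_emb[tau <-].
elim: (s) => [|l t IHt] tB; first by rewrite big_nil normr0.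
rewrite big_cons mulSn natrD (le_trans (ler_normD _ _)) // lerD //.
  by apply: tB; rewrite mem_head.
by apply: IHt => l' l't; apply: tB; rewrite inE l't orbT.
Qed.

(** Expanding [x^-1] in the basis would give [Tr (x x^-1) = 0], but this trace is the degree [n].
    The factors [d i] leave room for clearing the denominators of the basis. *)
Lemma trace_form_nondegenerate x (d : 'I_n -> nat) : (forall i, (0 < d i)%N) ->
  (forall i, \tr (regular_mx (x * ((d i)%:R * canonical_basis i))) = 0) -> x = 0.
Proof.
move=> d_gt0 tr0; apply: contraTeq isT => nzx.
have trb i : \tr (regular_mx (x * canonical_basis i)) = 0.
  have := tr0 i; rewrite mulrCA -[(d i)%:R]mulr1 mulr_natl mulrnAl mul1r.
  rewrite -scaler_nat regular_mxZ mxtraceZ => /eqP.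
  by rewrite mulf_eq0 pnatr_eq0 eqn0Ngt d_gt0 => /eqP.
have : \tr (regular_mx (x * x^-1)) = 0.
  rewrite [x^-1]canonical_basis_sum mulr_sumr.
  have r0 : regular_mx (0 : K) = 0 by rewrite -(scale0r (0 : K)) regular_mxZ scale0r.
  rewrite (big_morph _ regular_mxD r0) raddf_sum big1 // => i _.
  by rewrite -scalerAr regular_mxZ /= mxtraceZ trb mulr0.
rewrite mulfV // regular_mx1 mxtrace1 => /eqP.
by rewrite pnatr_eq0 eqn0Ngt dim_field_gt0.
Qed.

End NumberField.

(** * Finiteness of the integers with bounded conjugates *)

Section Northcott.
Variables (R : realType) (K : fieldExtType rat).
Notation C := R[i].
Notation n := (dim K).

Lemma complex_bound (z : C) : exists W : nat, `|z| <= W%:R.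
Proof.
exists (Num.bound (ComplexField.Normc.normc z)).
have -> : `|z| = (ComplexField.Normc.normc z)%:C%C by [].
rewrite -(rmorph_nat (real_complex R)) lecR.
by apply/ltW/archi_boundP; case: z => u v; apply: sqrtr_ge0.
Qed.

Lemma conjugates_bounded (x : K) :
  exists W : nat, forall sigma : {rmorphism K -> C}, `|sigma x| <= W%:R.
Proof.
have [s [_ _ _ emb_s]] := regular_conjugates C x.
suff [W sW] : exists W : nat, forall l, l \in s -> `|l| <= W%:R.
  by exists W => sigma; apply: sW.
elim: (s) => [|l t [W tW]]; first by exists 0%N.
have [W' lW'] := complex_bound l; exists (W + W')%N => l'.
rewrite inE natrD => /predU1P[->|/tW/le_trans]; first by rewrite ler_wpDl.
by apply; rewrite ler_wpDr.
Qed.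

(* The trace pairing with an integral basis embeds the set of algebraic integers
   with conjugates bounded by B into a box of Z^n of side O(B). *)
Lemma bounded_integers_code : exists W : nat, forall B : nat,
  exists code : K -> {ffun 'I_n -> 'I_(W * B).*2.+1},
  forall x y : K, algebraic_integer x -> algebraic_integer y ->
    (forall sigma : {rmorphism K -> C}, `|sigma x| <= B%:R) ->
    (forall sigma : {rmorphism K -> C}, `|sigma y| <= B%:R) ->
  code x = code y -> x = y.
Proof.
have /boolp.choice[d dP] : forall i : 'I_n, exists d : nat,
    (0 < d)%N /\ algebraic_integer (d%:R * canonical_basis i : K).
  move=> i; have [d /andP[d0 /asboolP di]] := den_exists (canonical_basis i : K).
  by exists d.
pose w i : K := (d i)%:R * canonical_basis i.
have [W' W'P] := boolp.choice (fun i => conjugates_bounded (w i)).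
(* [|Tr (x w_i)| <= n B W'_i], so these traces lie in [[- W B, W B]]; the shift by [W B] keeps the
   argument of [inord] in range. *)
pose W := (n * \sum_i W' i)%N; exists W => B.
pose t x i := Num.floor (\tr (regular_mx (x * w i))).
exists (fun x => [ffun i => inord (absz (t x i + (W * B)%N%:Z))]).
have tP x i : algebraic_integer x ->
    (forall sigma : {rmorphism K -> C}, `|sigma x| <= B%:R) ->
    (t x i)%:~R = \tr (regular_mx (x * w i)) /\ `|t x i| <= (W * B)%N%:Z.
  move=> x_int xB; have tE : (t x i)%:~R = \tr (regular_mx (x * w i)).
    apply: floorK; apply: (integral_trace_regular C).
    by apply: integral_mul => //; case: (dP i).
  split=> //; rewrite -(ler_int rat) intr_norm tE.
  have : `|\tr (regular_mx (x * w i))| <= (n * (B * W' i))%:R.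
    apply: (@trace_regular_bound K C) => tau; rewrite rmorphM normrM natrM ler_pM //.
  move=> /le_trans; apply; rewrite -pmulrn ler_nat /W.
  by rewrite -mulnA leq_mul2l mulnC leq_mul2r (bigD1 i) //= leq_addr !orbT.
move=> x y x_int y_int xB yB /ffunP txy; apply/eqP; rewrite -subr_eq0; apply/eqP.
apply: (@trace_form_nondegenerate K (x - y) d) => i; first by case: (dP i).
have [tx xW] := tP x i x_int xB; have [ty yW] := tP y i y_int yB.
have rB (u v : K) : regular_mx (u - v) = regular_mx u - regular_mx v.
  have -> : u - v = u + (-1) *: v by rewrite scaleN1r.
  by rewrite regular_mxD regular_mxZ scaleN1r.
rewrite -/(w i) mulrBl rB raddfB /= -tx -ty; apply/eqP; rewrite subr_eq0; apply/eqP.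
congr (_%:~R); have := txy i; rewrite !ffunE => /(congr1 val) /=.
rewrite !inordK //; lia.
Qed.

End Northcott.

Section AlgebraicIntegers.
Variable K : fieldExtType rat.
Implicit Types x y : K.

Lemma algint_add x y : algebraic_integer x -> algebraic_integer y -> algebraic_integer (x + y).
Proof. exact: integral_add. Qed.

Lemma algint_mul x y : algebraic_integer x -> algebraic_integer y -> algebraic_integer (x * y).
Proof. exact: integral_mul. Qed.

Lemma algint_opp x : algebraic_integer x -> algebraic_integer (- x).
Proof. exact: integral_opp. Qed.

Lemma algint_nat k : algebraic_integer (k%:R : K).
Proof. exact: integral_nat. Qed.

Lemma algint_sum I (r : seq I) (P : pred I) (F : I -> K) :
  (forall i, P i -> algebraic_integer (F i)) -> algebraic_integer (\sum_(i <- r | P i) F i).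
Proof. by move=> F_int; apply: big_ind => //; [exact: (algint_nat 0)|exact: algint_add]. Qed.

Lemma algint_prod I (r : seq I) (P : pred I) (F : I -> K) :
  (forall i, P i -> algebraic_integer (F i)) -> algebraic_integer (\prod_(i <- r | P i) F i).
Proof. by move=> F_int; apply: big_ind => //; [exact: (algint_nat 1)|exact: algint_mul]. Qed.

Lemma den_gt0 x : (0 < den x)%N.
Proof. by rewrite /den; case: ex_minnP => d /andP[]. Qed.

Lemma algint_den_dvd x d : (den x %| d)%N -> algebraic_integer (d%:R * x).
Proof.
case/dvdnP=> q ->; rewrite natrM -mulrA; apply: algint_mul; first exact: algint_nat.
by rewrite /den; case: ex_minnP => d' /andP[_ /asboolP].
Qed.

Lemma common_denominator (u : nat -> K) m : exists2 e, (0 < e)%N &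
  forall k, (k < m)%N -> algebraic_integer (e%:R * u k).
Proof.
exists (\prod_(k < m) den (u k))%N; first by rewrite prodn_gt0 // => k; apply: den_gt0.
by move=> k km; apply: algint_den_dvd; rewrite (bigD1 (Ordinal km)) //= dvdn_mulr.
Qed.

Lemma act_map (C : fieldType) (sigma : {rmorphism K -> C}) (P : {poly K}) u k :
  act (map_poly sigma P) (sigma \o u) k = sigma (act P u k).
Proof.
rewrite /act size_map_poly rmorph_sum; apply: eq_bigr => j _.
by rewrite coef_map rmorphM.
Qed.

End AlgebraicIntegers.

Section Embeddings.
Variables (R : realType) (K : fieldExtType rat).
Notation C := R[i].
Notation n := (dim K).

(** An embedding is determined by its values on the basis, each one of [n] eigenvalues. Bounds over
    all embeddings only require an enumeration with repetitions: [tau f] defaults to [iota] when no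
    embedding fits [f]. *)
Lemma finite_embeddings (iota : {rmorphism K -> C}) :
  exists tau : {ffun 'I_n -> 'I_n} -> {rmorphism K -> C},
  forall sigma : {rmorphism K -> C}, exists f, forall x, sigma x = tau f x.
Proof.
have /boolp.choice[s sP] := fun i : 'I_n => regular_conjugates C (canonical_basis i : K).
pose fits (f : {ffun 'I_n -> 'I_n}) (sigma : {rmorphism K -> C}) :=
  forall i, sigma (canonical_basis i) = nth 0 (s i) (f i).
have /boolp.choice[tau tauP] : forall f, exists tau,
    (exists sigma, fits f sigma) -> fits f tau.
  move=> f; have [[sigma fsigma] | nex] := pselect (exists sigma, fits f sigma).
    by exists sigma.
  by exists iota => /nex.
exists tau => sigma.
have lt_s i : (index (sigma (canonical_basis i)) (s i) < n)%N.
  by have [sz _ _ /(_ sigma) ssi] := sP i; rewrite -[X in (_ < X)%N]sz index_mem.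
pose f := [ffun i => Ordinal (lt_s i)]; exists f => x.
have fs : fits f sigma.
  by move=> i; rewrite ffunE /= nth_index //; have [_ _ _ ->] := sP i.
have ft := tauP f (ex_intro _ sigma fs).
rewrite [x]canonical_basis_sum !rmorph_sum; apply: eq_bigr => i _.
rewrite -mulr_algl !rmorphM /= fs ft; congr (_ * _).
by rewrite -[LHS]/((sigma \o in_alg K) _) -[RHS]/((tau f \o in_alg K) _) !fmorph_eq_rat.
Qed.

Definition growth (u : nat -> K) := forall e : R, 0 < e -> exists c : R,
  forall (sigma : {rmorphism K -> C}) k, nm (sigma (u k)) <= c * expR (e * k%:R).

Lemma uniform_growth (iota : {rmorphism K -> C}) (u : nat -> K) :
    (forall (sigma : {rmorphism K -> C}) (e : R), 0 < e -> exists c : R,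
      forall k, nm (sigma (u k)) <= c * expR (e * k%:R)) ->
  growth u.
Proof.
move=> gu e e0; have [tau tauP] := finite_embeddings iota.
have /boolp.choice[c cP] := fun f => gu (tau f) e e0.
exists (\sum_f `|c f|) => sigma k; have [f sf] := tauP sigma.
rewrite sf (le_trans (cP f k)) // ler_wpM2r ?expR_ge0 // (bigD1 f) //=.
by rewrite (le_trans (ler_norm _)) // lerDl sumr_ge0.
Qed.

End Embeddings.

(** * Windows free of a sparse set *)

Section Sparse.
Variables (R : realType) (S : pred nat).

Definition scount m := (\sum_(0 <= k < m) S k)%N.

Definition sparse := forall e : R, 0 < e ->
  exists n0, forall n, (n0 <= n)%N -> (scount n)%:R <= e * n%:R.

Definition free_window r k := all (fun j => ~~ S (k + j)%N) (iota 0 r).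

Lemma free_windowP r k : reflect (forall j, (j < r)%N -> ~~ S (k + j)%N) (free_window r k).
Proof.
apply: (iffP allP) => [H j jr|H j]; first by apply: H; rewrite mem_iota.
by rewrite mem_iota => /andP[_]; apply: H.
Qed.

(** Each point of [S] spoils at most [r] windows, so at most [N + r |S cap [0, n + r)|] indices are
    lost. The density [1 / (8 (r + 1))] bounds the second term by [n / 4], and [n >= 8 N] bounds the
    first by [n / 8]. *)
Lemma free_windows_dense (S_sparse : sparse) r N : exists n0, forall n, (n0 <= n)%N ->
  (n <= 2 * #|[set k : 'I_n | (N <= k)%N && free_window r k]|)%N.
Proof.
have r0 : 0 < (8 * r.+1%:R : R)^-1 by rewrite invr_gt0 mulr_gt0.
have [m mP] := S_sparse _ r0; exists (m + 8 * N + r)%N => n len.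
set A := [set k | _].
have : (n <= #|A| + (N + r * scount (n + r)))%N.
  rewrite -{1}(card_ord n) -(cardC (mem A)) leq_add2l.
  rewrite -sum1_card big_mkcond /=.
  apply: (@leq_trans (\sum_(k < n) ((k < N) + \sum_(j < r) S (k + j)))%N).
    apply: leq_sum => k _; case: ifP => //; rewrite !inE negb_and -ltnNge.
    case/orP=> [-> // | /allPn[j]]; rewrite mem_iota negbK => /andP[_ jr] Skj.
    by rewrite (bigD1 (Ordinal jr)) //= Skj addnCA leq_addr.
  rewrite big_split leq_add //=.
    apply: (@leq_trans (\sum_(0 <= k < n) (k < N))%N); first by rewrite big_mkord.
    apply: leq_trans (geq_minr n N).
    elim: n {A len} => [|l IHl]; first by rewrite big_geq.
    by rewrite big_nat_recr //=; case: ltnP; lia.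
  rewrite exchange_big /= -[r in (r * _)%N]card_ord -sum_nat_const.
  apply: leq_sum => j _; rewrite /scount -(big_mkord xpredT (fun k => S (k + j) : nat)).
  rewrite (@big_cat_nat _ _ _ j _ (n + r)) //=; last by have := ltn_ord j; lia.
  rewrite (@big_cat_nat _ _ _ (n + j) _ (n + r)) //=; [|lia|by have := ltn_ord j; lia].
  have -> : (\sum_(j <= i < n + j) S i = \sum_(0 <= k < n) S (k + j))%N.
    by rewrite -{1}[nat_of_ord j]add0n big_addn addnK.
  by rewrite addnCA leq_addr.
have : (4 * (r * scount (n + r)) <= n)%N.
  have := mP (n + r)%N (ltac:(lia)); rewrite mulrC ler_pdivlMr ?mulr_gt0 //.
  rewrite -!natrM ler_nat; have : (0 < r.+1)%N by []. nia.
lia.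
Qed.

End Sparse.

(** * Minimal annihilators *)

Section MinimalAnnihilator.
Variable K : fieldType.
Implicit Types (P Q : {poly K}) (u : nat -> K).

Definition eventually_kills P u := exists M, forall k, (M <= k)%N -> act P u k = 0.

(** The polynomials that eventually kill [u] form an ideal, and [Q] is a generator. If [X] divided
    [Q], the quotient would kill [u] from one index later on, against minimality. *)
Lemma minimal_annihilator M u : linrec M u -> exists Q N,
  [/\ Q != 0, forall k, (N <= k)%N -> act Q u k = 0, Q`_0 != 0 &
      forall P, eventually_kills P u -> Q %| P].
Proof.
move=> [Q1 nzQ1 Q1u].
have ex : exists m, `[< exists P, [/\ P != 0, size P = m & eventually_kills P u] >].
  by exists (size Q1); apply/asboolP; exists Q1; split => //; exists M.
case: (ex_minnP ex) => m /asboolP[Q [nzQ szQ [N Qu]]] m_min.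
have Qmin P : eventually_kills P u -> Q %| P.
  move=> [N' Pu]; rewrite /dvdp; apply/negPn/negP => nzr.
  have : (m <= size (P %% Q)%R)%N.
    apply: m_min; apply/asboolP; exists (P %% Q); split=> //.
    exists (maxn N N') => k; rewrite geq_max => /andP[Nk N'k].
    have -> : P %% Q = P - P %/ Q * Q by rewrite {2}(divp_eq P Q) addrC addKr.
    by rewrite actB Pu // (@act_mul_vanishr _ _ _ _ N) ?subrr.
  by rewrite -szQ leqNgt ltn_modp nzQ.
exists Q, N; split=> //; apply: contraTneq isT => Q0.
have /factor_theorem[Q' QE] : root Q 0 by rewrite rootE horner_coef0 Q0.
rewrite subr0 in QE.
have nzQ' : Q' != 0 by apply: contraNneq nzQ => Q'0; rewrite QE Q'0 mul0r.
have : Q %| Q'.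
  apply: Qmin; exists N.+1 => -[//|k] leNk.
  by rewrite -(Qu k leNk) QE mulrC act_mul -[X in act X _ k]expr1 actXn addn1.
by rewrite gtNdvdp // QE size_mulX.
Qed.

(** A kernel vector is a nonzero polynomial [P] of degree less than [deg Q] with [act P u] zero at
    [deg Q] consecutive indices; this sequence satisfies [Q], so it vanishes and [Q] would divide
    [P]. *)
Lemma hankel_unit Q N u : Q != 0 -> (forall k, (N <= k)%N -> act Q u k = 0) ->
    (forall P, eventually_kills P u -> Q %| P) ->
  \det (\matrix_(i < (size Q).-1, j < (size Q).-1) u (N + i + j)%N) != 0.
Proof.
move=> nzQ Qu Qmin; set d := (size Q).-1.
have sQ : size Q = d.+1 by rewrite prednK // size_poly_gt0.
apply/negP => /det0P[v nzv vH].
pose P := \poly_(j < d) (if insub j is Some j' then v 0 j' else 0).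
have Pj (j : 'I_d) : P`_j = v 0 j by rewrite coef_poly ltn_ord valK.
have szP : (size P <= d)%N by apply: size_poly.
have nzP : P != 0.
  apply: contraNneq nzv => P0; apply/eqP/rowP => j; rewrite mxE -Pj P0.
  by rewrite coef0.
have Pu0 k : (N <= k < N + d)%N -> act P u k = 0.
  move=> /andP[leNk ltk]; have kd : (k - N < d)%N by lia.
  have := congr1 (fun M : 'rV__ => M 0 (Ordinal kd)) vH; rewrite !mxE => vH0.
  rewrite (actE _ _ szP) -[RHS]vH0; apply: eq_bigr => j _.
  by rewrite mxE Pj /=; congr (_ * u _); lia.
have : Q %| P.
  apply: Qmin; exists N; apply: (@rec_unique _ Q (act P u) N nzQ).
  - by move=> k leNk; rewrite actX_comm; apply: act_vanish leNk.
  - by move=> k; apply: Pu0.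
by rewrite gtNdvdp // sQ ltnS.
Qed.

End MinimalAnnihilator.

(** In characteristic 0 a root of multiplicity [m + 1] of [p] has multiplicity exactly [m] in [p'],
    so it survives in the quotient. *)
Lemma root_div_gcd_deriv (F : fieldType) (p : {poly F}) x : [pchar F] =i pred0 ->
  p != 0 -> root p x -> root (p %/ gcdp p p^`()) x.
Proof.
move=> F0 nzp px0; have [[|m] [s sx0 ps]] := multiplicity_XsubC p x.
  by move: px0 sx0; rewrite nzp ps expr0 mulr1 => ->.
apply: contraT => qx; rewrite nzp /= in sx0.
set g := gcdp p p^`() in qx *; have pg : p = p %/ g * g by rewrite divpK ?dvdp_gcdl.
have : ('X - x%:P) ^+ m.+1 %| p^`().
  apply: dvdp_trans (dvdp_gcdr p p^`()); rewrite -/g.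
  have : ('X - x%:P) ^+ m.+1 %| p %/ g * g by rewrite -pg ps dvdp_mull.
  by rewrite Gauss_dvdpr // coprimep_expl // coprimep_sym coprimep_XsubC.
rewrite ps derivM deriv_exp derivXsubC mul1r /= dvdp_addr; last exact: dvdp_mull.
rewrite exprS -mulr_natr mulrCA mulrC dvdp_mul2l ?expf_neq0 ?polyXsubC_eq0 //.
rewrite -polyC_natr mulrC dvdp_XsubCl rootE hornerM hornerC mulf_eq0.
by rewrite ((GRing.pcharf0P F).1 F0) /= ?orbF => sx; move: sx0; rewrite rootE sx.
Qed.

Lemma numfield_pchar (K : fieldExtType rat) : [pchar K] =i pred0.
Proof. by move=> p; rewrite (fmorph_pchar (in_alg K)) pchar_num. Qed.

Lemma numfield_natr_neq0 (K : fieldExtType rat) k : (0 < k)%N -> k%:R != 0 :> K.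
Proof. by rewrite ((GRing.pcharf0P K).1 (@numfield_pchar K)) lt0n. Qed.

(** * A recurrence with coefficients 0, 1 and -1 *)

Section RootsOfUnity.
Variables (R : realType) (K : fieldExtType rat) (iota : {rmorphism K -> R[i]}).
Notation C := R[i].
Variables (S : pred nat) (a b : nat -> K).
Hypothesis S_sparse : sparse R S.
Hypothesis ab : forall k, ~~ S k -> b k = a k.
Hypothesis a_growth : growth R a.

Definition lcm_den n := (\big[lcmn/1%N]_(0 <= k < n.+1 | ~~ S k) den (a k))%N.

Hypothesis a_den : subexp (fun n => (lcm_den n)%:R : R).

Variables (Q : {poly K}) (N : nat).
Hypothesis nzQ : Q != 0.
Hypothesis Qb : forall k, (N <= k)%N -> act Q b k = 0.

Let r := size Q.
Let r_gt0 : (0 < r)%N. Proof. by rewrite size_poly_gt0. Qed.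

Lemma den_dvd_lcm n k : ~~ S k -> (k <= n)%N -> (den (a k) %| lcm_den n)%N.
Proof.
move=> nSk kn; rewrite /lcm_den big_mkord.
exact: (@biglcmn_sup _ (Ordinal (kn : (k < n.+1)%N))).
Qed.

Lemma lcm_den_gt0 n : (0 < lcm_den n)%N.
Proof.
rewrite /lcm_den; apply: (big_ind (fun m => 0 < m)%N) => // [x y x0 y0|k _].
  by rewrite lcmn_gt0 x0.
exact: den_gt0.
Qed.

(* Pigeonhole: there are more sets of shifts of b over windows free of S than
   values of their sums, which are bounded algebraic integers over a common
   denominator. *)
Lemma signed_annihilator : exists P : {poly K},
  [/\ P != 0, forall k, act P b k = 0 & forall j, P`_j \in [:: 0; 1; -1]].
Proof.
pose m := dim K; have m_gt0 : (0 < m)%N := dim_field_gt0 K.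
have [W WP] := bounded_integers_code R K.
have ln2 : 0 < ln 2 :> R by rewrite ln_gt0 // ltr1n.
(* With this rate [q ^ (m r) <= exp (2 e n m r) = 2 ^ (n / 4)], less than the number of subsets of
   [T], which has at least [n / 2] elements. *)
pose e : R := ln 2 / (8 * (m * r)%:R).
have mr0 : 0 < (m * r)%:R :> R by rewrite ltr0n muln_gt0 m_gt0 r_gt0.
have e0 : 0 < e by rewrite divr_gt0 ?mulr_gt0.
have [c cP] := a_growth e0.
pose c' := `|c| * expR (e * r%:R).
have c'0 : 0 <= c' by rewrite mulr_ge0 ?expR_ge0.
pose y n := (lcm_den (n + r))%:R * (n%:R * c') : R.
have y0 n : 0 <= y n by rewrite !mulr_ge0.
have sub_z : subexp (fun n => (2 * W + 1)%:R * (y n + 1)).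
  apply: subexpM; [by []|by move=> n; rewrite addr_ge0|exact: subexp_cst|].
  apply: (@subexp_le _ _ (fun n => 2 * ((lcm_den (1 * n + r))%:R * (n%:R * (c' + 1))))).
    exists 1%N => n n1; rewrite mul1n.
    have : 1 <= (lcm_den (n + r))%:R * (n%:R * (c' + 1)).
      by rewrite !mulr_ege1 ?ler1n ?lcm_den_gt0 // lerDr.
    have : y n <= (lcm_den (n + r))%:R * (n%:R * (c' + 1)).
      by rewrite /y !ler_wpM2l // lerDl.
    lra.
  apply: subexpM => // [n||]; [by rewrite !mulr_ge0 ?addr_ge0|exact: subexp_cst|].
  apply: subexpM => // [n||]; first by rewrite mulr_ge0 ?addr_ge0.
    exact: (subexp_affine (u := fun n => (lcm_den n)%:R)).
  by apply: subexpM => // [n||]; [rewrite addr_ge0|exact: subexp_id|exact: subexp_cst].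
have [n1 n1P] := sub_z _ e0.
have [n2 n2P] := free_windows_dense S_sparse r N.
pose n := (n1 + n2 + 1)%N.
have {n1P}zn := n1P n (ltac:(rewrite /n; lia)).
have {n2P} := n2P n (ltac:(rewrite /n; lia)); set T := [set k | _] => nT.
have TP (k : 'I_n) j : k \in T -> (j < r)%N ->
    (N <= k)%N /\ ~~ S (k + j)%N.
  by rewrite inE => /andP[Nk /free_windowP w] jr; split=> //; apply: w.
pose x := y n * expR (e * n%:R); have x0 : 0 <= x by rewrite mulr_ge0 ?expR_ge0.
have xE : x = (lcm_den (n + r))%:R * (n%:R * (c' * expR (e * n%:R))).
  by rewrite /x /y -2!mulrA.
pose B := (Num.truncn x).+1.
have [Bx xB] : B%:R <= x + 1 /\ x <= B%:R.
  have /andP[H1 H2] := truncn_itv x0; split; last exact: ltW.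
  by rewrite /B -natr1 lerD2r.
have [code codeP] := WP B; set q := (W * B).*2.+1 in code codeP.
have qe : q%:R <= expR (2 * e * n%:R).
  apply: (@le_trans _ _ ((2 * W + 1)%:R * (y n + 1) * expR (e * n%:R))); last first.
    have -> : 2 * e * n%:R = e * n%:R + e * n%:R by ring.
    by rewrite expRD ler_pM ?expR_ge0 // mulr_ge0 // addr_ge0.
  apply: (@le_trans _ _ ((2 * W + 1)%:R * B%:R)).
    by rewrite -natrM ler_nat /q -addn1 mulnDl mul1n -mul2n mulnA leq_add.
  rewrite -mulrA ler_wpM2l // (le_trans Bx) // mulrDl mul1r lerD2l.
  by rewrite -expR0 ler_expR mulr_ge0 // ltW.
(* The sums for [r] consecutive shifts suffice: for [A] inside [T] all shifts are at least [N], so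
   the shifted sums of [b] satisfy the recurrence [Q] from index 0 on. *)
pose X (A : {set 'I_n}) j : K := (lcm_den (n + r))%:R * \sum_(k in A) b (k + j)%N.
pose F (A : {set 'I_n}) : {ffun 'I_r -> {ffun 'I_m -> 'I_q}} := [ffun j : 'I_r => code (X A j)].
have X_int (A : {set 'I_n}) j : A \subset T -> (j < r)%N -> algebraic_integer (X A j).
  move=> sAT jr; rewrite /X mulr_sumr; apply: algint_sum => k kA.
  have [_ nS] := TP k j (fintype.subsetP sAT k kA) jr.
  rewrite ab //; apply: algint_den_dvd; apply: den_dvd_lcm => //.
  by rewrite leq_add // ltnW.
have X_bound (A : {set 'I_n}) j (sigma : {rmorphism K -> C}) : A \subset T -> (j < r)%N ->
    `|sigma (X A j)| <= B%:R.
  move=> sAT jr; rewrite -(rmorph_nat (real_complex R)) nm_le (le_trans _ xB) //.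
  rewrite /X rmorphM rmorph_nat nmM nm_nat xE ler_wpM2l // rmorph_sum.
  apply: (le_trans (nm_sum _ _ _)).
  apply: (@le_trans _ _ (\sum_(k in A) c' * expR (e * n%:R))).
    apply: ler_sum => k kA; have [_ nS] := TP k j (fintype.subsetP sAT k kA) jr.
    rewrite ab // (le_trans (cP sigma _)) // /c' -mulrA -expRD.
    apply: (@le_trans _ _ (`|c| * expR (e * (k + j)%:R))).
      by rewrite ler_wpM2r ?expR_ge0 // ler_norm.
    rewrite ler_wpM2l // ler_expR -mulrDr ler_wpM2l ?(ltW e0) // -natrD ler_nat.
    by rewrite addnC leq_add // ltnW.
  rewrite sumr_const -[leLHS]mulr_natl ler_wpM2r ?mulr_ge0 ?expR_ge0 // ler_nat.
  by rewrite -[X in (_ <= X)%N](card_ord n) max_card.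
have /dinjectivePn[A1 sA1 [A2]] : ~~ dinjectiveb F (powerset T).
  apply/negP => /dinjectiveP/card_in_imset cardE.
  have : (2 ^ #|T| <= (q ^ m) ^ r)%N.
    rewrite -card_powerset -cardE (leq_trans (max_card _)) //.
    by rewrite card_ffun card_ord card_ffun !card_ord.
  rewrite leqNgt => /negP; apply; rewrite -(ltr_nat R) !natrX.
  apply: (@le_lt_trans _ _ (expR (2 * e * n%:R) ^+ (m * r))).
    by rewrite exprM lerXn2r ?nnegrE ?exprn_ge0 ?expR_ge0 // lerXn2r ?nnegrE ?expR_ge0.
  rewrite -expRM_natl -[X in _ < X ^+ _](@lnK _ 2) ?posrE // -expRM_natl ltr_expR.
  have -> : (m * r)%:R * (2 * e * n%:R) = ln 2 * n%:R / 4 :> R.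
    by rewrite /e; field; rewrite !pnatr_eq0 -!lt0n r_gt0 m_gt0.
  have n0 : 0 < n%:R :> R by rewrite ltr0n /n addn1.
  have : n%:R <= 2 * #|T|%:R :> R by rewrite -natrM ler_nat.
  nra.
rewrite !inE => /andP[A21 sA2] FA.
have XE j : (j < r)%N -> X A1 j = X A2 j.
  move=> jr; move/ffunP/(_ (Ordinal jr)): FA; rewrite !ffunE /=.
  by rewrite powersetE in sA1; apply: codeP; by [apply: X_int|move=> s; apply: X_bound].
rewrite powersetE in sA1.
pose P : {poly K} := \sum_(k in A1) 'X^k - \sum_(k in A2) 'X^k.
have coefS (A : {set 'I_n}) (j : 'I_n) : (\sum_(k in A) 'X^k : {poly K})`_j = (j \in A)%:R.
  rewrite coef_sum; case: (boolP (j \in A)) => jA.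
    rewrite (bigD1 j) //= coefXn eqxx big1 ?addr0 // => k /andP[_ kj].
    by rewrite coefXn eq_sym (inj_eq val_inj) (negPf kj).
  rewrite big1 // => k kA; rewrite coefXn (inj_eq val_inj).
  by case: eqP => // jk; rewrite jk kA in jA.
have szS (A : {set 'I_n}) : (size (\sum_(k in A) 'X^k : {poly K})%R <= n)%N.
  by apply: (leq_trans (size_sum _ _ _)); apply/bigmax_leqP => k _; rewrite size_polyXn.
have actS (A : {set 'I_n}) w j : act (\sum_(k in A) 'X^k : {poly K}) w j = \sum_(k in A) w (j + k)%N.
  by rewrite act_sum; apply: eq_bigr => k _; rewrite actXn.
exists P; split.
- apply: contraNneq A21 => P0; apply/eqP/setP => j; apply/eqP.
  have := congr1 (fun p : {poly K} => p`_j) P0; rewrite coefB !coefS coef0 => /eqP.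
  rewrite subr_eq0 (eqr_nat_pchar0 (@numfield_pchar K)).
  by case: (j \in A1); case: (j \in A2).
- move=> k; apply: (@rec_unique _ Q (act P b) 0 nzQ) => [{}k _|{}k /andP[_ kr]|//].
    rewrite actX_comm /P actB !actS !big1 ?subrr // => i iA; rewrite Qb //.
      have [iT _] := TP i 0 (fintype.subsetP sA2 i iA) r_gt0; exact: leq_trans (leq_addl _ _).
    have [iT _] := TP i 0 (fintype.subsetP sA1 i iA) r_gt0; exact: leq_trans (leq_addl _ _).
  have kr' : (k < r)%N by rewrite (leq_trans kr) // add0n leq_pred.
  apply: (@mulfI _ (lcm_den (n + r))%:R); first by rewrite numfield_natr_neq0 // lcm_den_gt0.
  have sumC (A : {set 'I_n}) : \sum_(i in A) b (k + i)%N = \sum_(i in A) b (i + k)%N.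
    by apply: eq_bigr => i _; rewrite addnC.
  by rewrite mulr0 /P actB !actS mulrBr !sumC -!/(X _ _) XE // subrr.
move=> j; have [jn|nj] := ltnP j n.
  rewrite coefB (coefS A1 (Ordinal jn)) (coefS A2 (Ordinal jn)) !inE.
  by case: (_ \in A1); case: (_ \in A2); rewrite ?subrr ?subr0 ?sub0r ?eqxx ?orbT.
by rewrite coefB !nth_default ?subrr ?mem_head // (leq_trans (szS _)).
Qed.

End RootsOfUnity.

(** * The roots of the annihilator are roots of unity *)

(** The leading coefficient is [1] or [-1], so each term is an integral combination of the preceding
    ones, and the common denominator of the first [d] terms persists. *)
Lemma signed_recurrence_integral (K : fieldExtType rat) (P : {poly K}) (b : nat -> K) :
    P != 0 -> (forall k, act P b k = 0) -> (forall j, P`_j \in [:: 0; 1; -1]) ->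
  exists2 e, (0 < e)%N & forall k, algebraic_integer (e%:R * b k).
Proof.
move=> nzP Pb Pcoef; pose d := (size P).-1.
have sP : size P = d.+1 by rewrite prednK // size_poly_gt0.
have P_int j : algebraic_integer P`_j.
  have := Pcoef j; rewrite !inE => /or3P[] /eqP->; first exact: (algint_nat K 0).
    exact: (algint_nat K 1).
  by apply: algint_opp; exact: (algint_nat K 1).
have [e e0 eb] := common_denominator b d; exists e => //.
elim/ltn_ind => k IHk; have [/eb // | dk] := ltnP k d.
have lP2 : P`_d * P`_d = 1.
  have : P`_d != 0 by rewrite -[P`_d]/(lead_coef P) lead_coef_eq0.
  by have := Pcoef d; rewrite !inE => /or3P[] /eqP->; rewrite ?eqxx ?mulr1 ?mulrNN ?mulr1.
have := Pb (k - d)%N; rewrite (@actE _ d.+1) ?sP // big_ord_recr /= subnK //.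
move=> /(congr1 (fun x => P`_d * x)); rewrite mulrDr mulrA lP2 mul1r mulr0.
move/eqP; rewrite addrC addr_eq0 => /eqP ->.
rewrite mulrN; apply: algint_opp; rewrite mulrCA; apply: algint_mul => //.
rewrite mulr_sumr; apply: algint_sum => j _; rewrite mulrCA; apply: algint_mul => //.
by apply: IHk; have := ltn_ord j; lia.
Qed.

Lemma act_shiftn (K : comNzRingType) (P : {poly K}) u m k :
  act P (fun i => u (m + i)%N) k = act P u (m + k)%N.
Proof. by apply: eq_bigr => j _; rewrite addnA. Qed.

Section ComplexRecurrence.
Variable R : realType.
Notation C := R[i].
Implicit Types (u : nat -> C) (l : C).

Lemma act_XsubC l u k : act ('X - l%:P) u k = u k.+1 - l * u k.
Proof. by rewrite actB actC -['X]expr1 actXn addn1. Qed.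

Lemma geometric_sequence l u M : (forall k, (M <= k)%N -> act ('X - l%:P) u k = 0) ->
  forall k, u (M + k)%N = l ^+ k * u M.
Proof.
move=> lu; elim=> [|k IHk]; first by rewrite addn0 mul1r.
have := lu (M + k)%N (leq_addr _ _); rewrite act_XsubC => /eqP.
by rewrite subr_eq0 addnS => /eqP ->; rewrite IHk exprS mulrA.
Qed.

(** [v = q u] is geometric of ratio [l], and [q] acts on it as the scalar [q(l)], nonzero because
    the roots are distinct. Subtracting [v / q(l)] from [u] removes the root [l]. *)
Lemma bounded_recurrence (s : seq C) u M : uniq s -> (forall l, l \in s -> nm l <= 1) ->
    (forall k, (M <= k)%N -> act (\prod_(l <- s) ('X - l%:P)) u k = 0) ->
  exists B, forall k, (M <= k)%N -> nm (u k) <= B.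
Proof.
elim: s u => [|l s IHs] u.
  move=> _ _ u0; exists 0 => k /u0; rewrite big_nil -[1]/(1%:P) actC mul1r => ->.
  by rewrite nm0.
move=> /= /andP[ls uniq_s] s1; rewrite big_cons => lsu.
set q := \prod_(l <- s) _ in lsu *; pose v k := act q u k.
have qv k : (M <= k)%N -> act ('X - l%:P) v k = 0 by move=> /lsu; rewrite act_mul.
have ql : q.[l] != 0.
  by rewrite -[_ == 0]/(root q l) root_prod_XsubC.
have vE k : (M <= k)%N -> v k = l ^+ (k - M) * v M.
  by move=> Mk; rewrite -(geometric_sequence qv) subnKC.
have qvE k : (M <= k)%N -> act q v k = q.[l] * v k.
  move=> Mk; rewrite horner_coef /act mulr_suml; apply: eq_bigr => j _.
  rewrite -mulrA; congr (_ * _); rewrite vE ?(leq_trans Mk) ?leq_addr //.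
  rewrite (vE k) // mulrA -exprD; congr (l ^+ _ * _).
  by rewrite addnC addnBA.
have [|||B uB] := IHs (fun k => u k - q.[l]^-1 * v k).
- exact: uniq_s.
- by move=> l' l's; apply: s1; rewrite inE l's orbT.
- move=> k Mk; rewrite act_subr act_scaler qvE // mulrA mulVf // mul1r subrr //.
exists (B + nm (q.[l]^-1 * v M)) => k Mk.
rewrite -[u k](subrK (q.[l]^-1 * v k)) (le_trans (nmD _ _)) // lerD ?uB //.
rewrite vE // mulrCA nmM nmX ler_piMl ?nm_ge0 // exprn_ile1 ?nm_ge0 //.
by apply: s1; rewrite mem_head.
Qed.

End ComplexRecurrence.

Section RootsOfUnity.
Variables (R : realType) (K : fieldExtType rat) (iota : {rmorphism K -> R[i]}).
Notation C := R[i].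
Variables (S : pred nat) (a b : nat -> K).
Hypothesis S_sparse : sparse R S.
Hypothesis ab : forall k, ~~ S k -> b k = a k.
Hypothesis a_growth : growth R a.
Hypothesis a_den : subexp (fun n => (lcm_den S a n)%:R : R).
Variables (Q : {poly K}) (N : nat).
Hypothesis nzQ : Q != 0.
Hypothesis Qb : forall k, (N <= k)%N -> act Q b k = 0.
Hypothesis Q0 : Q`_0 != 0.
Hypothesis Qmin : forall P, eventually_kills P b -> Q %| P.

(* Killing the other roots turns b into a geometric sequence of ratio l, which
   inherits the subexponential growth of a on the windows free of S. *)
Lemma annihilator_roots_disc (sigma : {rmorphism K -> C}) l :
  root (map_poly sigma Q) l -> nm l <= 1.
Proof.
move=> rl; have /factor_theorem[Q1 QE] := rl.
set u := sigma \o b; pose v k := act Q1 u k.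
have Qu k : (N <= k)%N -> act (map_poly sigma Q) u k = 0.
  by move=> /Qb Qbk; rewrite act_map Qbk rmorph0.
have nzQ1 : Q1 != 0.
  by apply: contraNneq nzQ => Q10; rewrite -(map_poly_eq0 sigma) QE Q10 mul0r.
have szQ1 : size Q1 = (size Q).-1.
  by rewrite -(size_map_poly sigma) QE size_mul ?polyXsubC_eq0 // size_XsubC addn2.
have lv k : (N <= k)%N -> act ('X - l%:P) v k = 0.
  by move=> Nk; rewrite -act_mul mulrC -QE Qu.
(* [Q1] has coefficients in [C], so the minimality of [Q] over [K] does not apply to it directly;
   the nonvanishing of the Hankel determinant does transfer through [sigma]. *)
have nzv : v N != 0.
  apply/negP => /eqP vN0; have vz k : (N <= k)%N -> v k = 0.
    by move=> Nk; rewrite -(subnKC Nk) (geometric_sequence lv) vN0 mulr0.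
  have := hankel_unit nzQ Qb Qmin; set H := \matrix_(i, j) _.
  rewrite -(fmorph_eq0 sigma) -det_map_mx -det_tr => /negP; apply; apply/det0P.
  exists (\row_j Q1`_j).
    apply: contraNneq nzQ1 => /rowP q0; apply/eqP/polyP => j; rewrite coef0.
    have [jd|dj] := ltnP j (size Q).-1; first by have := q0 (Ordinal jd); rewrite !mxE.
    by rewrite nth_default // szQ1.
  apply/rowP => i; rewrite !mxE -[RHS](vz (N + i)%N) ?leq_addr // /v /act szQ1.
  by apply: eq_bigr => j _; rewrite !mxE.
rewrite leNgt; apply/negP => l1.
have l0 : 0 < nm l by apply: lt_trans l1.
(* [|l| = exp (2 e)] is set against the growth [exp (e k)] of [a]. *)
pose e : R := ln (nm l) / 2; have e0 : 0 < e by rewrite divr_gt0 // ln_gt0.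
have lE : nm l = expR (2 * e) by rewrite /e mulrCA mulfV ?mulr1 ?lnK ?posrE.
have [c cP] := a_growth e0.
pose A := \sum_(j < (size Q).-1) nm Q1`_j * (`|c| * expR (e * (size Q)%:R)).
have vA k : (N <= k)%N -> free_window S (size Q) k -> nm (v k) <= A * expR (e * k%:R).
  move=> Nk /free_windowP nS; rewrite /v /act szQ1 (le_trans (nm_sum _ _ _)) //.
  rewrite /A mulr_suml; apply: ler_sum => j _; rewrite nmM -mulrA ler_wpM2l ?nm_ge0 //.
  have jQ : (j < size Q)%N by apply: leq_trans (ltn_ord j) (leq_pred _).
  rewrite /u /= ab ?nS // (le_trans (cP sigma _)) // -[leRHS]mulrA -expRD -mulrDr.
  apply: (@le_trans _ _ (`|c| * expR (e * (k + j)%:R))).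
    by rewrite ler_wpM2r ?expR_ge0 // ler_norm.
  rewrite ler_wpM2l // ler_expR ler_wpM2l ?(ltW e0) // -natrD ler_nat addnC leq_add2r.
  exact: ltnW.
have A0 : 0 <= A by rewrite sumr_ge0 // => j _; rewrite !mulr_ge0 ?nm_ge0 ?expR_ge0.
have v0 : 0 < nm (v N) by rewrite lt_neqAle nm_ge0 eq_sym nm_eq0 nzv.
have [n1 n1P] := @subexp_cst R (A * nm l ^+ N / nm (v N) + 1) _ e0.
have [n2 n2P] := free_windows_dense S_sparse (size Q) (n1 + N).
have := n2P (n2 + 1)%N (leq_addr _ _); rewrite addn1; set T := [set k | _] => nT.
have /card_gt0P[k] : (0 < #|T|)%N by move: nT; case: #|T|.
rewrite inE => /andP[]; move: (nat_of_ord k) => {}k nk wk.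
have Nk : (N <= k)%N by apply: leq_trans nk; apply: leq_addl.
have n1k : (n1 <= k)%N by apply: leq_trans nk; apply: leq_addr.
have := vA k Nk wk; rewrite -{1}(subnKC Nk) (geometric_sequence lv) nmM nmX.
apply/negP; rewrite -ltNge -(ltr_pM2l (exprn_gt0 N l0)) [ltRHS]mulrA -exprD subnKC //.
have := n1P k n1k; set E := expR (e * k%:R) => nE.
have -> : nm l ^+ k = E * E.
  by rewrite lE -expRM_natl /E -expRD; congr expR; ring.
have E0 : 0 < E by apply: expR_gt0.
have h : A * nm l ^+ N < E * nm (v N).
  by rewrite -ltr_pdivrMr //; apply: lt_le_trans nE; rewrite ltrDl.
have -> : nm l ^+ N * (A * E) = A * nm l ^+ N * E by rewrite mulrCA mulrA.
have -> : E * E * nm (v N) = E * nm (v N) * E by rewrite mulrAC.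
by rewrite ltr_pM2r.
Qed.

(* gcd(Q, Q') maps b to a sequence killed by the squarefree part of Q, hence
   bounded at every place and, being integral up to a factor, eventually
   periodic. *)
Lemma annihilator_roots_of_unity l : root (map_poly iota Q) l ->
  exists2 m, (0 < m)%N & l ^+ m = 1.
Proof.
have [P [nzP Pb Pcoef]] := signed_annihilator S_sparse ab a_growth a_den nzQ Qb.
have [e e0 eb] := signed_recurrence_integral nzP Pb Pcoef.
pose T := gcdp Q Q^`(); pose q := Q %/ T.
have QE : Q = q * T by rewrite divpK ?dvdp_gcdl.
have nzT : T != 0 by rewrite gcdp_eq0 negb_and nzQ.
have nzq : q != 0 by apply: contraNneq nzQ => q0; rewrite QE q0 mul0r.
have [d d0 dT] := common_denominator (fun j => T`_j) (size T).
pose b' := act T b; pose w k : K := (d * e)%:R * b' k.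
have de0 : (0 < d * e)%N by rewrite muln_gt0 d0.
have w_int k : algebraic_integer (w k).
  rewrite /w /b' /act mulr_sumr; apply: algint_sum => j _.
  by rewrite natrM mulrACA; apply: algint_mul; [apply: dT|apply: eb].
have qb' k : (N <= k)%N -> act q b' k = 0 by move=> Nk; rewrite -act_mul -QE Qb.
have b'_bd (sigma : {rmorphism K -> C}) : exists B : R, forall k, (N <= k)%N -> nm (sigma (w k)) <= B.
  have [s qs] := closed_field_poly_normal (map_poly sigma q).
  have nzl : lead_coef (map_poly sigma q) != 0 by rewrite lead_coef_eq0 map_poly_eq0.
  have [||k Nk|B BP] := @bounded_recurrence R s (sigma \o b') N.
  - rewrite -separable_prod_XsubC -(eqp_separable (eqp_scale _ nzl)) -qs separable_map.
    exact: make_separable.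
  - move=> x xs; apply: (@annihilator_roots_disc sigma).
    by rewrite QE rmorphM rootM /= qs rootZ // root_prod_XsubC xs.
  - apply: (mulfI nzl); rewrite mulr0 -actZ -qs act_map qb' // rmorph0 //.
  exists ((d * e)%:R * B) => k Nk.
  by rewrite /w rmorphM rmorph_nat nmM nm_nat ler_wpM2l // BP.
have [tau tauP] := finite_embeddings iota.
have /boolp.choice[B BP] := fun f => b'_bd (tau f).
pose M := Num.bound (\sum_f `|B f|).
have w_bd (sigma : {rmorphism K -> C}) k : (N <= k)%N -> `|sigma (w k)| <= M%:R.
  move=> Nk; have [f sf] := tauP sigma.
  rewrite -(rmorph_nat (real_complex R)) nm_le sf (le_trans (BP f k Nk)) //.
  apply: le_trans (ltW (archi_boundP _)); last by rewrite sumr_ge0.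
  by rewrite (bigD1 f) //= (le_trans (ler_norm _)) // lerDl sumr_ge0.
have [W WP] := bounded_integers_code R K; have [code codeP] := WP M.
pose r := size q.
pose F (k : nat) := [ffun j : 'I_r => code (w (N + k + j)%N)].
have [k1 [k2 [k12 F12]]] : exists k1 k2, (k1 < k2)%N /\ F k1 = F k2.
  pose m := #|{: {ffun 'I_r -> {ffun 'I_(dim K) -> 'I_(W * M).*2.+1}}}|.
  have /injectivePn[x [y xy Fxy]] : ~~ injectiveb (fun k : 'I_m.+1 => F k).
    by apply/injectiveP => /leq_card; rewrite card_ord ltnn.
  have [lt_xy|lt_yx|/val_inj exy] := ltngtP x y; first by exists x, y.
    by exists y, x.
  by rewrite exy eqxx in xy.
(* Two equal windows of length [size q] force equality forever: [T b] has period [k2 - k1] from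
   [N + k1] on. *)
have z0 k : b' (N + k2 + k)%N - b' (N + k1 + k)%N = 0.
  apply: (@rec_unique _ q (fun i => b' (N + k2 + i)%N - b' (N + k1 + i)%N) 0 nzq) => // i.
    move=> _; rewrite act_subr !act_shiftn !qb' ?subrr //.
      by rewrite -addnA leq_addr.
    by rewrite -addnA leq_addr.
  move=> /andP[_ ir]; have ir' : (i < r)%N by rewrite (leq_trans ir) // add0n leq_pred.
  have := congr1 (fun f : {ffun _ -> _} => f (Ordinal ir')) F12; rewrite !ffunE /=.
  move=> /codeP wE; apply/eqP; rewrite subr_eq0; apply/eqP.
  apply: (@mulfI _ (d * e)%:R); first by rewrite numfield_natr_neq0.
  by apply/esym/wE => // s; apply: w_bd; rewrite -addnA leq_addr.
(* Minimality turns the period of [T b] into a divisibility; after cancelling [T], the squarefree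
   part [q], which has all the roots of [Q], divides [X^k2 - X^k1]. *)
have : Q %| ('X^k2 - 'X^k1) * T.
  apply: Qmin; exists N => k Nk; rewrite act_mul actB !actXn.
  by rewrite -(z0 (k - N)%N); congr (b' _ - b' _); lia.
rewrite {1}QE dvdp_mul2r // => q_dvd rl.
have nzl : l != 0.
  apply: contraTneq rl => ->; rewrite rootE horner_coef0 coef_map fmorph_eq0.
  exact: Q0.
have : root (map_poly iota Q %/ gcdp (map_poly iota Q) (map_poly iota Q)^`()) l.
  apply: root_div_gcd_deriv => //; last by rewrite map_poly_eq0.
  exact: pchar_num.
rewrite deriv_map -gcdp_map -map_divp -/T -/q => rql.
have : root (map_poly iota ('X^k2 - 'X^k1)) l.
  by move: rql; apply: root_dvdp; rewrite dvdp_map.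
rewrite rmorphB /= !map_polyXn rootE !hornerE subr_eq0 => /eqP lk.
exists (k2 - k1)%N; first by rewrite subn_gt0.
apply: (mulIf (expf_neq0 k1 nzl)); rewrite -exprD subnK ?mul1r //.
exact: ltnW.
Qed.

End RootsOfUnity.

(** * Averages over circles *)

Section Circle.
Variable R : realType.
Notation C := R[i].
Implicit Types (x y : R).

Definition expi x : C := (cos x +i* sin x)%C.

Lemma expi0 : expi 0 = 1.
Proof. by rewrite /expi cos0 sin0. Qed.

Lemma expiD x y : expi (x + y) = expi x * expi y.
Proof. by rewrite /expi cosD sinD; apply/eqP; rewrite eq_complex /=; apply/andP; split; apply/eqP; ring. Qed.

Lemma expi_pi2 : expi (pi *+ 2) = 1.
Proof. by rewrite /expi cos2pi sin2pi. Qed.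

Lemma expiX x n : expi x ^+ n = expi (n%:R * x).
Proof.
elim: n => [|n IHn]; first by rewrite mul0r expi0.
by rewrite exprS IHn -expiD mulrSr mulrDl mul1r addrC.
Qed.

Lemma nm_expi x : nm (expi x) = 1.
Proof. by apply: complexI; rewrite -nmE normc_def /= cos2Dsin2 sqrtr1. Qed.

Lemma sin_le_id x : 0 <= x -> sin x <= x.
Proof.
rewrite le_eqVlt => /predU1P[<-|x0]; first by rewrite sin0.
have [|c _] := @MVT R sin cos 0 x x0 (fun z _ => is_derive_sin z).
  exact/continuous_subspaceT/continuous_sin.
rewrite sin0 !subr0 => ->; rewrite ler_piMl ?cos_le1 //; exact: ltW.
Qed.

Lemma nm_sqr (z : C) : nm z ^+ 2 = complex.Re z ^+ 2 + complex.Im z ^+ 2.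
Proof. by apply: complexI; rewrite rmorphXn /= -nmE -add_Re2_Im2. Qed.

Lemma nm_le_sqr (z : C) x : 0 <= x -> complex.Re z ^+ 2 + complex.Im z ^+ 2 <= x ^+ 2 -> nm z <= x.
Proof. by move=> x0; rewrite -nm_sqr ler_pXn2r // ?nnegrE ?nm_ge0. Qed.

Lemma one_sub_cos x : 2 - 2 * cos x = 4 * sin (x / 2) ^+ 2.
Proof.
have -> : cos x = cos ((x / 2) *+ 2) by congr cos; rewrite -mulr_natr divfK.
by rewrite cos_mulr2n sin2cos2 -mulr_natr; ring.
Qed.

Lemma cos_lower x : 0 <= x <= 1 -> 1 - x ^+ 2 / 2 <= cos x.
Proof.
move=> /andP[x0 x1]; have s0 : 0 <= sin (x / 2).
  by apply: sin_ge0_pi; have := pi_ge2 R; lra.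
have sx : sin (x / 2) <= x / 2 by apply: sin_le_id; lra.
have := one_sub_cos x; nra.
Qed.

Lemma nm_expi_sub1 x : 0 <= x <= 1 -> nm (expi x - 1) <= x.
Proof.
move=> x01; have /andP[x0 _] := x01; apply: nm_le_sqr => //=; rewrite subr0.
have := cos_lower x01; have := cos2Dsin2 x; nra.
Qed.

Lemma expi_neq1 x : 0 < x < pi *+ 2 -> expi x != 1.
Proof.
move=> /andP[x0 x2]; rewrite eq_complex /= negb_and; apply/orP; left.
have c1 y : 0 < y <= pi -> cos y < 1.
  move=> /andP[y0 yp]; rewrite -[X in _ < X](@cos0 R) ltr_cos ?in_itv /= ?lexx ?pi_ge0 ?(ltW y0) //.
rewrite lt_eqF //; have [xp|px] := leP x pi; first by apply: c1; rewrite x0.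
rewrite -cosN -(cosD2pi (- x)) c1 // mulr2n; apply/andP; split; rewrite -?mulr2n; first by rewrite addrC subr_gt0.
by rewrite mulr2n; lra.
Qed.

Lemma cos_ge_cos x y : 0 <= y <= pi -> `|x| <= y -> cos y <= cos x.
Proof.
move=> /andP[y0 yp] xy; rewrite -(cos_norm x) leNgt ltr_cos ?in_itv /= ?normr_ge0 ?y0 //.
  by rewrite -leNgt.
by rewrite (le_trans xy).
Qed.

Lemma cos_le_cos x y : 0 <= y <= pi -> y <= x <= pi *+ 2 - y -> cos x <= cos y.
Proof.
move=> /andP[y0 yp] /andP[yx xy].
have main z : y <= z <= pi -> cos z <= cos y.
  move=> /andP[yz zp]; rewrite leNgt ltr_cos ?in_itv /= ?y0 ?zp ?(le_trans y0) //.
  by rewrite -leNgt.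
have [xp|px] := leP x pi; first by apply: main; rewrite yx.
rewrite -(cosN x) -(cosD2pi (- x)); apply: main; move: xy; rewrite mulr2n; lra.
Qed.

Lemma sum_powers_eq0 (u : C) N : u != 1 -> u ^+ N = 1 -> \sum_(l < N) u ^+ l = 0.
Proof.
move=> u1 uN; apply: (@mulfI _ (u - 1)); first by rewrite subr_eq0.
by rewrite -subrX1 uN subrr mulr0.
Qed.

Lemma expi_root N : (0 < N)%N -> expi (pi *+ 2 / N%:R) ^+ N = 1.
Proof. by move=> N0; rewrite expiX mulrC divfK ?expi_pi2 // pnatr_eq0 -lt0n. Qed.

Lemma expi_root_neq1 N e : (0 < e < N)%N -> expi (pi *+ 2 / N%:R) ^+ e != 1.
Proof.
move=> /andP[e0 eN]; have N0 : (0 < N)%N by apply: leq_trans eN.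
rewrite expiX; apply: expi_neq1.
have p2 : 0 < pi *+ 2 :> R by rewrite mulrn_wgt0 // pi_gt0.
rewrite mulr_gt0 ?ltr0n ?divr_gt0 //= ?ltr0n // mulrCA gtr_pMr //.
by rewrite ltr_pdivrMr ?ltr0n // mul1r ltr_nat.
Qed.

(* Orthogonality of characters: the mean of z^k z^-j over the N-th roots of
   unity, rotated and rescaled by z0, is [k = j] as soon as |k - j| < N. *)
Lemma mean_monomial (z0 : C) N k j : z0 != 0 -> (k < N)%N -> (j < N)%N ->
  N%:R^-1 * \sum_(l < N) (z0 * expi (pi *+ 2 / N%:R) ^+ l) ^+ k * (z0 * expi (pi *+ 2 / N%:R) ^+ l)^-1 ^+ j
  = (k == j)%:R.
Proof.
move=> nz0 kN jN; have N0 : (0 < N)%N by apply: leq_trans kN.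
set w := expi _; have wN : w ^+ N = 1 := expi_root N0.
have nzw : w != 0 by rewrite -nm_eq0 nm_expi oner_eq0.
have [->|kj] := eqVneq k j.
  under eq_bigr => l _ do rewrite -exprMn divff ?mulf_neq0 ?expf_neq0 // expr1n.
  by rewrite sumr_const card_ord -[1 *+ N]/(N%:R) mulVf // pnatr_eq0 -lt0n.
suff -> : \sum_(l < N) (z0 * w ^+ l) ^+ k * (z0 * w ^+ l)^-1 ^+ j = 0 by rewrite mulr0.
have [lt_kj|lt_jk|/eqP] := ltngtP k j; last by rewrite (negPf kj).
  transitivity (z0^-1 ^+ (j - k) * \sum_(l < N) (w^-1 ^+ (j - k)) ^+ l).
    rewrite mulr_sumr; apply: eq_bigr => l _.
    rewrite -{1}(subnK (ltnW lt_kj)) exprD mulrCA -exprMn divff ?mulf_neq0 ?expf_neq0 // expr1n mulr1.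
    by rewrite invfM exprMn -exprVn -!exprM mulnC.
  rewrite sum_powers_eq0 ?mulr0 //; last by rewrite exprAC exprVn wN invr1 expr1n.
  rewrite exprVn invr_eq1 expi_root_neq1 // subn_gt0 lt_kj /=.
  exact: leq_ltn_trans (leq_subr _ _) _.
transitivity (z0 ^+ (k - j) * \sum_(l < N) (w ^+ (k - j)) ^+ l).
  rewrite mulr_sumr; apply: eq_bigr => l _.
  rewrite -{1}(subnK (ltnW lt_jk)) exprD -mulrA -exprMn divff ?mulf_neq0 ?expf_neq0 // expr1n mulr1.
  by rewrite exprMn -!exprM mulnC.
rewrite sum_powers_eq0 ?mulr0 //; last by rewrite exprAC wN expr1n.
rewrite expi_root_neq1 // subn_gt0 lt_jk /=.
exact: leq_ltn_trans (leq_subr _ _) _.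
Qed.

End Circle.

(** * Riemann sums and uniform approximation by polynomials *)

Section PolynomialEstimates.
Variable R : realType.
Notation C := R[i].
Implicit Types (p q Q : {poly C}) (z w : C).

Lemma nm_horner p z (x : R) : nm z <= x -> nm p.[z] <= \sum_(j < size p) nm p`_j * x ^+ j.
Proof.
move=> zx; rewrite horner_coef (le_trans (nm_sum _ _ _)) // ler_sum // => j _.
rewrite nmM nmX ler_wpM2l ?nm_ge0 // lerXn2r ?nnegrE ?nm_ge0 //.
exact: le_trans (nm_ge0 z) zx.
Qed.

Lemma poly_bounded p (x : R) : exists2 B, 0 <= B & forall z, nm z <= x -> nm p.[z] <= B.
Proof.
exists (\sum_(j < size p) nm p`_j * `|x| ^+ j).
  by rewrite sumr_ge0 // => j _; rewrite mulr_ge0 ?nm_ge0.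
by move=> z zx; apply: nm_horner; apply: le_trans zx (ler_norm _).
Qed.

(** Taylor formula with a remainder uniform on the disc of radius 2, which contains the dented
    circles since [r' <= 2]. *)
Lemma poly_second_order Q : exists2 K, 0 <= K & forall z w, nm z <= 2 -> nm w <= 2 ->
  nm (Q.[w] - Q.[z] - Q^`().[z] * (w - z)) <= K * nm (w - z) ^+ 2.
Proof.
elim/poly_ind: Q => [|Q c [K K0 KP]].
  by exists 0 => // z w _ _; rewrite deriv0 !horner0 mul0r !subr0 nm0 mul0r.
have [B B0 BP] := poly_bounded Q^`() 2; exists (2 * K + B) => [|z w z2 w2].
  by rewrite addr_ge0 ?mulr_ge0.
have -> : (Q * 'X + c%:P)^`().[z] = Q^`().[z] * z + Q.[z].
  by rewrite derivD derivM derivX derivC !hornerE.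
rewrite !hornerMXaddC.
have -> : Q.[w] * w + c - (Q.[z] * z + c) - (Q^`().[z] * z + Q.[z]) * (w - z) =
    w * (Q.[w] - Q.[z] - Q^`().[z] * (w - z)) + Q^`().[z] * (w - z) ^+ 2 by ring.
rewrite [leRHS]mulrDl (le_trans (nmD _ _)) // lerD //.
  by rewrite nmM -mulrA ler_pM ?nm_ge0 ?KP.
by rewrite nmM nmX ler_wpM2r ?exprn_ge0 ?nm_ge0 ?BP.
Qed.

Lemma le_of_le_divn (x y K : R) : (forall n, (0 < n)%N -> x <= y + K / n%:R) -> x <= y.
Proof.
move=> H; rewrite leNgt; apply/negP => yx.
have d0 : 0 < x - y by rewrite subr_gt0.
have /archi_boundP : 0 <= `|K| / (x - y) by rewrite divr_ge0 // ltW.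
set n := Num.bound _; rewrite ltr_pdivrMr // => Kn.
have n0 : (0 < n)%N by rewrite lt0n; apply: contraTneq Kn => ->; rewrite mul0r -leNgt.
have := H n n0; rewrite addrC -lerBlDr ler_pdivlMr ?ltr0n // leNgt mulrC.
by rewrite (le_lt_trans (ler_norm _) Kn).
Qed.

(** Discrete fundamental theorem of calculus: the Riemann sum of [Q'] over a chain of [n] steps of
    length at most [D / n] misses the increment of [Q] by [O(1 / n)]. It stands in for contour
    integration. *)
Lemma riemann_sum_poly Q : exists2 K, 0 <= K & forall n (x : nat -> C) (D : R), (0 < n)%N ->
    (forall l, (l <= n)%N -> nm (x l) <= 2) ->
    (forall l, (l < n)%N -> nm (x l.+1 - x l) <= D / n%:R) ->
  nm (Q.[x n] - Q.[x 0%N] - \sum_(l < n) Q^`().[x l] * (x l.+1 - x l)) <= K * D ^+ 2 / n%:R.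
Proof.
have [K K0 KP] := poly_second_order Q; exists K => // n x D n0 x2 xD.
have -> : Q.[x n] - Q.[x 0%N] = \sum_(l < n) (Q.[x l.+1] - Q.[x l]).
  by rewrite -(telescope_sumr (fun l => Q.[x l]) (leq0n n)) big_mkord.
rewrite -sumrB (le_trans (nm_sum _ _ _)) //.
apply: (@le_trans _ _ (\sum_(l < n) K * (D / n%:R) ^+ 2)).
  apply: ler_sum => l _; have ln := ltn_ord l.
  apply: (le_trans (KP _ _ (x2 l (ltnW ln)) (x2 l.+1 ln))).
  rewrite ler_wpM2l // lerXn2r ?nnegrE ?nm_ge0 ?xD //.
  exact: le_trans (nm_ge0 _) (xD l ln).
rewrite sumr_const card_ord -mulr_natl.
have nz : n%:R != 0 :> R by rewrite pnatr_eq0 -lt0n.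
by rewrite le_eqVlt; apply/orP; left; apply/eqP; field.
Qed.

Lemma path_bound Q n (x : nat -> C) (D Y K : R) : (0 < n)%N ->
    (forall l, (l < n)%N -> nm (x l.+1 - x l) <= D / n%:R) ->
    (forall l, (l < n)%N -> nm Q^`().[x l] <= Y) -> 0 <= D -> 0 <= Y ->
    nm (Q.[x n] - Q.[x 0%N] - \sum_(l < n) Q^`().[x l] * (x l.+1 - x l)) <= K ->
  nm (Q.[x n] - Q.[x 0%N]) <= D * Y + K.
Proof.
move=> n0 xD xY D0 Y0 rK.
set d := Q.[x n] - Q.[x 0%N] in rK *; set s := \sum_(l < n) _ in rK.
have -> : d = s + (d - s) by rewrite addrC subrK.
rewrite (le_trans (nmD _ _)) // lerD // (le_trans (nm_sum _ _ _)) //.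
apply: (@le_trans _ _ (\sum_(l < n) Y * (D / n%:R))).
  by apply: ler_sum => l _; rewrite nmM ler_pM ?nm_ge0 ?xD ?xY.
rewrite sumr_const card_ord -mulr_natl.
have nz : n%:R != 0 :> R by rewrite pnatr_eq0 -lt0n.
by rewrite le_eqVlt; apply/orP; left; apply/eqP; field.
Qed.

Lemma segment_bound Q (a b : C) (Y : R) : 0 <= Y -> nm a <= 2 -> nm b <= 2 ->
    (forall s : R, 0 <= s <= 1 -> nm Q^`().[a + s%:C%C * (b - a)] <= Y) ->
  nm (Q.[b] - Q.[a]) <= nm (b - a) * Y.
Proof.
move=> Y0 a2 b2 QY; have [K K0 KP] := riemann_sum_poly Q.
apply: (@le_of_le_divn _ _ (K * nm (b - a) ^+ 2)) => n n0.
have nz : n%:R != 0 :> R by rewrite pnatr_eq0 -lt0n.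
pose x (l : nat) := a + (l%:R / n%:R)%:C%C * (b - a).
have s01 l : (l <= n)%N -> 0 <= (l%:R / n%:R : R) <= 1.
  by move=> ln; rewrite divr_ge0 //= ler_pdivrMr ?ltr0n // mul1r ler_nat.
have xn : x n = b by rewrite /x divff // rmorph1 mul1r addrC subrK.
have x0 : x 0%N = a by rewrite /x mul0r rmorph0 mul0r addr0.
have xD l : (l < n)%N -> nm (x l.+1 - x l) <= nm (b - a) / n%:R.
  move=> _; rewrite /x; set t1 := _%:C%C; set t2 := _%:C%C.
  have -> : a + t1 * (b - a) - (a + t2 * (b - a)) = (t1 - t2) * (b - a) by ring.
  rewrite nmM mulrC /t1 /t2 -rmorphB nm_real -mulrBl -natr1 addrAC subrr add0r mul1r.
  by rewrite ger0_norm // invr_ge0.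
have x2 l : (l <= n)%N -> nm (x l) <= 2.
  move=> /s01; rewrite /x; set t := l%:R / _ => /andP[t0 t1].
  have -> : a + t%:C%C * (b - a) = (1 - t)%:C%C * a + t%:C%C * b.
    by rewrite rmorphB rmorph1; ring.
  rewrite (le_trans (nmD _ _)) // !nmM !nm_real !ger0_norm ?subr_ge0 //; nra.
have := @path_bound Q n x (nm (b - a)) Y _ n0 xD _ (nm_ge0 _) Y0 (KP n x _ n0 x2 xD).
by rewrite xn x0; apply => l ln; apply: QY; apply: s01; apply: ltnW.
Qed.

(* Stands in for analyticity near 1: path independence is elementary for
   polynomials and passes to uniform limits. *)
Definition papprox (D : C -> Prop) (h : C -> C) := forall e : R, 0 < e ->
  exists q : {poly C}, forall z, D z -> nm (h z - q.[z]) <= e.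

Lemma papprox_poly D q : papprox D (horner q).
Proof. by move=> e e0; exists q => z _; rewrite subrr nm0 ltW. Qed.

Lemma papprox_ext D h1 h2 : (forall z, D z -> h1 z = h2 z) -> papprox D h1 -> papprox D h2.
Proof. by move=> h12 ap e /ap[q qP]; exists q => z Dz; rewrite -h12 ?qP. Qed.

Lemma papproxD D h1 h2 : papprox D h1 -> papprox D h2 -> papprox D (fun z => h1 z + h2 z).
Proof.
move=> a1 a2 e e0; have e20 : 0 < e / 2 by rewrite divr_gt0.
have [q1 q1P] := a1 _ e20; have [q2 q2P] := a2 _ e20; exists (q1 + q2) => z Dz.
rewrite hornerD opprD addrACA (le_trans (nmD _ _)) //.
by have := q1P z Dz; have := q2P z Dz; lra.
Qed.

Lemma papprox_bounded D h (x : R) : (forall z, D z -> nm z <= x) -> papprox D h ->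
  exists2 B, 0 <= B & forall z, D z -> nm (h z) <= B.
Proof.
move=> Dx /(_ 1 ltr01)[q qP]; have [B B0 BP] := poly_bounded q x.
exists (1 + B) => [|z Dz]; first by rewrite addr_ge0.
by rewrite -(subrK q.[z] (h z)) (le_trans (nmD _ _)) // lerD ?qP ?BP ?Dx.
Qed.

Lemma papproxM D h1 h2 (x : R) : (forall z, D z -> nm z <= x) ->
  papprox D h1 -> papprox D h2 -> papprox D (fun z => h1 z * h2 z).
Proof.
move=> Dx a1 a2 e e0; have [B1 B10 B1P] := papprox_bounded Dx a1.
have [|q2 q2P] := a2 (e / 2 / (B1 + 1)); first by rewrite !divr_gt0 // ltr_wpDl.
have [B2 B20 B2P] := poly_bounded q2 x.
have [|q1 q1P] := a1 (e / 2 / (B2 + 1)); first by rewrite !divr_gt0 // ltr_wpDl.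
exists (q1 * q2) => z Dz; rewrite hornerM.
have -> : h1 z * h2 z - q1.[z] * q2.[z] = h1 z * (h2 z - q2.[z]) + (h1 z - q1.[z]) * q2.[z] by ring.
rewrite (le_trans (nmD _ _)) // !nmM.
have le1 : nm (h1 z) * nm (h2 z - q2.[z]) <= e / 2.
  apply: (@le_trans _ _ ((B1 + 1) * (e / 2 / (B1 + 1)))).
    by rewrite ler_pM ?nm_ge0 ?q2P // (le_trans (B1P z Dz)) // lerDl.
  by rewrite mulrC divfK // gt_eqF // ltr_wpDl.
have le2 : nm (h1 z - q1.[z]) * nm q2.[z] <= e / 2.
  apply: (@le_trans _ _ ((e / 2 / (B2 + 1)) * (B2 + 1))).
    by rewrite ler_pM ?nm_ge0 ?q1P // (le_trans (B2P z (Dx z Dz))) // lerDl.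
  by rewrite divfK // gt_eqF // ltr_wpDl.
lra.
Qed.

Definition disc1 (x : R) z := nm (z - 1) <= x.

Lemma disc1_bounded x z : x <= 1 -> disc1 x z -> nm z <= 2.
Proof.
move=> x1 zx; rewrite -(subrK 1 z) (le_trans (nmD _ _)) // nm1.
by rewrite /disc1 in zx; lra.
Qed.

(** Geometric series in [1 - z], of ratio at most [1 / 2]; the tail after [n] terms is at most
    [2 x^n]. *)
Lemma papprox_inv (x : R) : 0 <= x <= 1 / 2 -> papprox (disc1 x) (fun z => z^-1).
Proof.
move=> /andP[x0 x2] e e0.
have [n nP] : exists n, 2 * x ^+ n <= e.
  have /archi_boundP : 0 <= 2 / e by rewrite divr_ge0 // ltW.
  set n := Num.bound _; rewrite ltr_pdivrMr // => ne; exists n.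
  have n2 : n%:R <= 2 ^+ n :> R by rewrite -natrX ler_nat ltnW // ltn_expl.
  have xn : x ^+ n <= (1 / 2) ^+ n by rewrite lerXn2r ?nnegrE.
  have h1 : (1 / 2) ^+ n * (2 ^+ n * e) = e.
    by rewrite mulrA -exprMn mul1r mulVf ?expr1n ?mul1r.
  rewrite -h1 (le_trans (ler_wpM2l _ xn)) // mulrC ler_wpM2l ?exprn_ge0 //.
  by rewrite (le_trans (ltW ne)) // ler_wpM2r // ltW.
exists (\sum_(k < n) (1 - 'X) ^+ k) => z zx.
have zh : 1 / 2 <= nm z.
  have : nm 1 <= nm (1 - z) + nm z by rewrite -{1}(subrK z 1) nmD.
  by rewrite nm1 nm_dist; rewrite /disc1 in zx; lra.
have nz : z != 0 by rewrite -nm_eq0 gt_eqF //; lra.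
have -> : z^-1 - (\sum_(k < n) (1 - 'X) ^+ k).[z] = z^-1 * (1 - z) ^+ n.
  apply: (mulfI nz); rewrite mulrBr mulrA mulfV // mul1r horner_sum.
  under eq_bigr => k _ do rewrite horner_exp !hornerE.
  have := subrX1 (1 - z) n; rewrite addrAC subrr add0r mulNr => /eqP.
  rewrite subr_eq addrC => /eqP ->. rewrite [RHS]addrC; congr (_ - _ * _); apply: eq_bigr => k _.
rewrite nmM nmV nmX (le_trans _ nP) // ler_pM ?invr_ge0 ?exprn_ge0 ?nm_ge0 //.
  by rewrite -[leRHS]invrK lef_pV2 ?posrE //; lra.
by rewrite lerXn2r ?nnegrE ?nm_ge0 // nm_dist.
Qed.

Lemma papprox_poly_inv p (x : R) : 0 <= x <= 1 / 2 -> papprox (disc1 x) (fun z => p.[z^-1]).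
Proof.
move=> x2; have xb z : disc1 x z -> nm z <= 2 by apply: disc1_bounded; lra.
elim/poly_ind: p => [|p c IHp].
  by apply: (papprox_ext _ (@papprox_poly _ 0)) => z _; rewrite !horner0.
apply: (@papprox_ext _ (fun z => p.[z^-1] * z^-1 + c%:P.[z])).
  by move=> z _; rewrite !hornerE.
apply: papproxD; last exact: papprox_poly.
exact: papproxM xb IHp (papprox_inv x2).
Qed.

End PolynomialEstimates.

(** * The contour functional *)

Section Contour.
Variable R : realType.
Notation C := R[i].

(** [g] is the cosine of the half-angle of the dent. The three pieces are the circle of radius [r]
    outside the sector, the two radial sides, and the whole circle of radius [r'], on which the
    later estimates hold throughout. *)
Definition dented_circle (g r r' : R) (z : C) :=
  [\/ nm z = r /\ complex.Re z <= g * r,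
      r <= nm z <= r' /\ complex.Re z = g * nm z | nm z = r'].

(** Formally the mean of [f(z) p(1/z)] over a circle inside the disc of convergence, where [f] has
    the coefficients [c]. *)
Definition pairing (c : nat -> C) (p : {poly C}) := \sum_(j < size p) p`_j * c j.

Variables (c : nat -> C) (f g : C -> C) (r r' rho : R) (m : nat).
(** With the half-angle [2 pi / m], equidistant points that start at one endpoint of the dent also
    hit the other one, as soon as their number is a multiple of [m]. *)
Let gam : R := cos (pi *+ 2 / m%:R).
Hypothesis m_ge8 : (8 <= m)%N.
Hypothesis m_even : ~~ odd m.
Hypothesis r01 : 0 < r < 1.
Hypothesis r'12 : 1 < r' <= 2.
Hypothesis rho12 : 0 <= rho <= 1 / 2.
Hypothesis f_approx : forall e : R, 0 < e -> exists T0, forall T, (T0 <= T)%N ->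
  forall z, nm z = r -> nm (f z - \sum_(k < T) c k * z ^+ k) <= e.
Hypothesis g_approx : papprox (disc1 rho) g.
Hypothesis fg : forall z, disc1 rho z -> nm z = r -> f z = g z.
Hypothesis near1 : forall z : C, r <= nm z <= r' -> gam * nm z <= complex.Re z -> disc1 rho z.

Let t1 : R := pi *+ 2 / m%:R.
Let m0 : (0 < m)%N. Proof. by apply: leq_trans m_ge8. Qed.

Let t1_bounds : 0 < t1 <= 1.
Proof.
have p2 := pihalf_lt2 R; have p0 := pi_gt0 R; have m0' : 0 < m%:R :> R by rewrite ltr0n m0.
rewrite /t1; apply/andP; split; first by rewrite divr_gt0 // pmulrn_lgt0.
rewrite ler_pdivrMr // mul1r mulr2n.
have : 8 <= m%:R :> R by rewrite ler_nat.
lra.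
Qed.

Let step n : R := pi *+ 2 / (m * n)%:R.
Let root_ n := expi (step n).
(** The sampling starts at angle [- t1]: the indices up to [2 n] run over the arc of the dent, the
    remaining ones up to [m n] over the rest of the circle. *)
Let pt n (s : R) l := s%:C%C * expi (- t1) * root_ n ^+ l.

Let ptE n s l : pt n s l = s%:C%C * expi (l%:R * step n - t1).
Proof. by rewrite /pt /root_ expiX -mulrA -expiD addrC. Qed.

Let step_t1 n : (0 < n)%N -> n%:R * step n = t1.
Proof.
move=> n0; rewrite /step natrM /t1; field.
by rewrite !pnatr_eq0 -!lt0n n0 m0.
Qed.

Let step_bounds n : (0 < n)%N -> 0 <= step n <= 1 /\ step n = t1 / n%:R.
Proof.
move=> n0; have sE : step n = t1 / n%:R by rewrite -(step_t1 n0) mulrAC divff ?mul1r // pnatr_eq0 -lt0n.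
split=> //; have /andP[t0 t1'] := t1_bounds; rewrite sE divr_ge0 ?(ltW t0) //=.
by rewrite ler_pdivrMr ?ltr0n // mul1r (le_trans t1') // ler1n.
Qed.

Let nm_pt n s l : 0 <= s -> nm (pt n s l) = s.
Proof. by move=> s0; rewrite ptE nmM nm_real nm_expi mulr1 ger0_norm. Qed.

Let Re_pt n s l : complex.Re (pt n s l) = s * cos (l%:R * step n - t1).
Proof. by rewrite ptE /= mul0r subr0. Qed.

Let pt_diff n s l : (0 < n)%N -> 0 <= s <= 2 -> nm (pt n s l.+1 - pt n s l) <= 4 / (2 * n)%:R.
Proof.
move=> n0 /andP[s0 s2]; rewrite /pt exprSr mulrA -[X in _ - X]mulr1 -mulrBr nmM.
rewrite -/(pt n s l) nm_pt //.
have [sb sE] := step_bounds n0; have := nm_expi_sub1 sb; rewrite -/(root_ n) => h.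
have /andP[t0 t1'] := t1_bounds; have n0' : 0 < n%:R :> R by rewrite ltr0n.
apply: (@le_trans _ _ (2 * step n)); first by rewrite ler_pM ?nm_ge0.
have -> : 4 / (2 * n)%:R = 2 / n%:R :> R by rewrite natrM; field; rewrite gt_eqF.
by rewrite sE mulrA ler_wpM2r ?invr_ge0 ?ler0n // ler_piMr.
Qed.

Let arc_in n s l : (0 < n)%N -> (l <= 2 * n)%N -> r <= s <= r' -> disc1 rho (pt n s l).
Proof.
move=> n0 l2 /andP[rs sr]; have /andP[r0 _] := r01; have s0 : 0 <= s by apply: le_trans rs; apply: ltW.
apply: near1; rewrite nm_pt // ?rs // Re_pt mulrC ler_wpM2l //.
have /andP[t0 t1'] := t1_bounds; have p2 := pi_ge2 R.
have t1pi : t1 <= pi by rewrite (le_trans t1') // (le_trans _ p2) // ler1n.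
apply: cos_ge_cos; first by rewrite (ltW t0).
have [/andP[st0 _] _] := step_bounds n0.
have l2' : l%:R * step n <= 2 * t1.
  by rewrite -(step_t1 n0) mulrA -natrM ler_wpM2r // ler_nat.
have l0' : 0 <= l%:R * step n by rewrite mulr_ge0.
by rewrite ler_norml -/t1; apply/andP; split; lra.
Qed.

Let off_arc n l : (0 < n)%N -> (2 * n <= l < m * n)%N -> dented_circle gam r r' (pt n r l).
Proof.
move=> n0 /andP[l2 lm]; have /andP[r0 _] := r01; constructor 1; rewrite nm_pt ?(ltW r0) //.
split=> //; rewrite Re_pt mulrC ler_wpM2r ?(ltW r0) //.
have /andP[t0 t1'] := t1_bounds; have p2 := pi_ge2 R.
have t1pi : t1 <= pi by rewrite (le_trans t1') // (le_trans _ p2) // ler1n.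
apply: cos_le_cos; first by rewrite (ltW t0).
have [/andP[st0 _] _] := step_bounds n0.
have l2' : 2 * t1 <= l%:R * step n.
  by rewrite -(step_t1 n0) mulrA -natrM ler_wpM2r // ler_nat.
have lm' : l%:R * step n <= pi *+ 2.
  have <- : (m * n)%:R * step n = pi *+ 2.
    by rewrite mulrC divfK // pnatr_eq0 muln_eq0 negb_or -!lt0n m0.
  by rewrite ler_wpM2r // ler_nat ltnW.
by rewrite -/t1; apply/andP; split; lra.
Qed.

Let ends n s : (0 < n)%N -> pt n s 0 = s%:C%C * expi (- t1) /\ pt n s (2 * n) = s%:C%C * expi t1.
Proof.
move=> n0; rewrite !ptE mul0r add0r; split=> //.
by rewrite natrM -mulrA step_t1 // mulr_natl mulr2n addrK.
Qed.

(* The primitive of q has the same increment along the inner arc as along the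
   outer path: out radially, along the arc of radius r', and back in. *)
Let outer_path (Q : {poly C}) (Y : R) : 0 <= Y ->
    (forall z, disc1 rho z -> (r <= nm z <= r' /\ complex.Re z = gam * nm z) \/ nm z = r' ->
      nm Q^`().[z] <= Y) ->
  nm (Q.[r%:C%C * expi t1] - Q.[r%:C%C * expi (- t1)]) <= 8 * Y.
Proof.
move=> Y0 QY; have /andP[r0 r1] := r01; have /andP[r'1 r'2] := r'12.
have r'0 : 0 <= r' by lra.
have seg t : cos t = gam -> nm (Q.[r'%:C%C * expi t] - Q.[r%:C%C * expi t]) <= 2 * Y.
  move=> ct; have nE (s : R) : 0 <= s -> nm (s%:C%C * expi t) = s.
    by move=> s0; rewrite nmM nm_real nm_expi mulr1 ger0_norm.
  have ra : nm (r%:C%C * expi t) <= 2 by rewrite nE; lra.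
  have rb : nm (r'%:C%C * expi t) <= 2 by rewrite nE.
  have hs (s : R) : 0 <= s <= 1 ->
      nm Q^`().[r%:C%C * expi t + s%:C%C * (r'%:C%C * expi t - r%:C%C * expi t)] <= Y.
    move=> /andP[s0 s1].
    have -> : r%:C%C * expi t + s%:C%C * (r'%:C%C * expi t - r%:C%C * expi t) =
        (r + s * (r' - r))%:C%C * expi t by rewrite rmorphD rmorphM rmorphB; ring.
    set x := r + s * (r' - r); have xr : r <= x <= r' by rewrite /x; apply/andP; split; nra.
    have x0 : 0 <= x by have /andP[] := xr; lra.
    have Rex : complex.Re (x%:C%C * expi t) = gam * nm (x%:C%C * expi t).
      by rewrite nE //= mul0r subr0 ct mulrC.
    apply: QY; last by left; split; [rewrite nE | exact: Rex].
    apply: near1; first by rewrite nE.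
    by rewrite Rex.
  have := segment_bound Y0 ra rb hs.
  move=> /le_trans; apply; rewrite -mulrBl -rmorphB nmM nm_real nm_expi mulr1.
  by rewrite ger0_norm ?ler_wpM2r //; lra.
have arc : nm (Q.[r'%:C%C * expi t1] - Q.[r'%:C%C * expi (- t1)]) <= 4 * Y.
  have [K K0 KP] := riemann_sum_poly Q.
  apply: (@le_of_le_divn _ _ _ (K * 4 ^+ 2)) => n n0.
  have n20 : (0 < 2 * n)%N by rewrite muln_gt0.
  have [e0 e2] := ends r' n0; rewrite -e0 -e2.
  apply: (@le_trans _ _ (4 * Y + K * 4 ^+ 2 / (2 * n)%:R)).
    apply: path_bound => //.
    - by move=> l _; apply: pt_diff => //; rewrite r'0.
    - move=> l l2; apply: QY; first by apply: arc_in; [|exact: ltnW|rewrite lexx andbT (le_trans (ltW r1)) // ltW].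
      by right; rewrite nm_pt.
    apply: KP => // [l l2|l _]; first by rewrite nm_pt.
    by apply: pt_diff => //; rewrite r'0.
  rewrite lerD2l ler_wpM2l ?mulr_ge0 // ?exprn_ge0 // lef_pV2 ?posrE ?ltr0n //.
  by rewrite ler_nat leq_pmull.
have gE : cos t1 = gam by [].
have s1 := seg t1 gE; have s2 := seg (- t1) (etrans (cosN _) gE).
have -> : Q.[r%:C%C * expi t1] - Q.[r%:C%C * expi (- t1)] =
    - (Q.[r'%:C%C * expi t1] - Q.[r%:C%C * expi t1]) +
    (Q.[r'%:C%C * expi t1] - Q.[r'%:C%C * expi (- t1)]) +
    (Q.[r'%:C%C * expi (- t1)] - Q.[r%:C%C * expi (- t1)]) by ring.
rewrite (le_trans (nmD _ _)) //.
have := nmD (- (Q.[r'%:C%C * expi t1] - Q.[r%:C%C * expi t1]))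
  (Q.[r'%:C%C * expi t1] - Q.[r'%:C%C * expi (- t1)]).
rewrite nmN; move: s1 s2 arc; lra.
Qed.

(** By orthogonality, and up to truncating [f], [pairing c p] is a mean of [f(z) p(1/z)] over
    equidistant points. Off the dent the values are at most [Mf X]. On the dent [f = g], and the sum
    becomes a Riemann sum of a polynomial [q] close to [g(z) p(1/z) / z], whose primitive has its
    increment bounded along the outer path. The approximation error and the step then tend to 0. *)
Lemma contour_functional_bound : exists2 B, 0 <= B & forall p (X : R), 0 <= X ->
  (forall z, dented_circle gam r r' z -> nm p.[z^-1] <= X) -> nm (pairing c p) <= B * X.
Proof.
have /andP[r0 r1] := r01; have /andP[r'1 r'2] := r'12; have /andP[rho0 rho2] := rho12.
have b2 z : disc1 rho z -> nm z <= 2 by apply: disc1_bounded; lra.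
have [Mg Mg0 MgP] := papprox_bounded b2 g_approx.
have [Mf Mf0 MfP] : exists2 Mf, 0 <= Mf & forall z, nm z = r -> nm (f z) <= Mf.
  have [T /(_ T (leqnn T)) TP] := f_approx ltr01.
  have [B B0 BP] := poly_bounded (\poly_(k < T) c k) r.
  exists (1 + B) => [|z zr]; first by rewrite addr_ge0.
  have := TP z zr; have := BP z; rewrite zr lexx horner_poly => /(_ isT).
  set s := \sum_(k < T) _ => sB fs; rewrite -(subrK s (f z)) (le_trans (nmD _ _)) //.
  exact: lerD.
exists (Mf + 4 * (Mg / r)) => [|p X X0 pX].
  by rewrite addr_ge0 ?mulr_ge0 ?invr_ge0 // ltW.
have [P P0 PP] : exists2 P, 0 <= P & forall z, nm z = r -> nm p.[z^-1] <= P.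
  have [P P0 PP] := poly_bounded p r^-1; exists P => // z zr.
  by apply: PP; rewrite nmV zr.
pose Psi z := g z * p.[z^-1] * z^-1.
have Psi_approx : papprox (disc1 rho) Psi.
  apply: (papproxM b2 _ (papprox_inv rho12)); apply: (papproxM b2 g_approx).
  exact: papprox_poly_inv.
suff main e : 0 < e -> nm (pairing c p) <= (Mf + 4 * (Mg / r)) * X + e * (P + 8).
  apply/ler_addgt0Pr => e e0.
  have P8 : 0 < P + 8 by lra.
  by have := main (e / (P + 8)) (divr_gt0 e0 P8); rewrite divfK // gt_eqF.
move=> e0; have [q qP] := Psi_approx e e0.
have [Q QE] : exists Q : {poly C}, Q^`() = q.
  exists (\poly_(k < (size q).+1) (q`_k.-1 / k%:R)); apply/polyP => k.
  rewrite coef_deriv coef_poly ltnS /=; case: ltnP => kq.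
    by rewrite -[LHS]mulr_natr divfK // pnatr_eq0.
  by rewrite mul0rn nth_default.
pose Y := Mg * X / r + e; have Y0 : 0 <= Y.
  by rewrite addr_ge0 ?mulr_ge0 ?invr_ge0 // ltW.
have QY z : disc1 rho z -> (r <= nm z <= r' /\ complex.Re z = gam * nm z) \/ nm z = r' ->
    nm Q^`().[z] <= Y.
  move=> dz Gz; rewrite QE -(subrK (Psi z) q.[z]) addrC (le_trans (nmD _ _)) //.
  rewrite lerD // ?[nm (q.[z] - _)]nm_dist ?qP // /Psi !nmM nmV.
  have zr : r <= nm z by case: Gz => [[/andP[]]//|->]; lra.
  rewrite ler_pM ?mulr_ge0 ?nm_ge0 ?invr_ge0 ?nm_ge0 //.
    rewrite ler_pM ?nm_ge0 ?MgP ?pX //.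
    by case: Gz => [?|?]; [constructor 2|constructor 3].
  by rewrite lef_pV2 ?posrE //; apply: lt_le_trans zr.
have {QY}QAB := outer_path Y0 QY.
have [K K0 KP] := riemann_sum_poly Q; rewrite QE in KP.
have [T0 TP] := f_approx e0.
apply: (@le_of_le_divn _ _ _ (2 * K)) => n n0.
(* A multiple of [m], so that the dent ends at sample points, and large enough for the truncation of
   [f], for orthogonality up to the degree of [p], and for an error [O(1 / n)]. *)
pose N := (m * (n + T0 + size p))%N; pose n' := (n + T0 + size p)%N.
have n'0 : (0 < n')%N by rewrite /n' -addnA ltn_addr.
have N0 : (0 < N)%N by rewrite muln_gt0 m0.
pose z l := pt n' r l.
have zr l : nm (z l) = r by apply: nm_pt; apply: ltW.
have nz l : z l != 0 by rewrite -nm_eq0 zr gt_eqF.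
pose T := (T0 + size p)%N.
have TN : (T <= N)%N.
  by rewrite /N /T -addnA (leq_trans (leq_addl n _)) // leq_pmull.
pose fT w := \sum_(k < T) c k * w ^+ k.
have meanE : N%:R^-1 * \sum_(l < N) fT (z l) * p.[(z l)^-1] = pairing c p.
  have zE l : z l = (r%:C%C * expi (- t1)) * expi (pi *+ 2 / N%:R) ^+ l by [].
  have nz0 : r%:C%C * expi (- t1) != 0 by have := nz 0%N; rewrite zE expr0 mulr1.
  transitivity (\sum_(k < T) \sum_(j < size p) c k * p`_j *
      (N%:R^-1 * \sum_(l < N) z l ^+ k * (z l)^-1 ^+ j)).
    rewrite mulr_sumr.
    under eq_bigr => l _ do rewrite /fT horner_coef mulr_suml mulr_sumr.
    rewrite exchange_big; apply: eq_bigr => k _.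
    under eq_bigr => l _ do rewrite !mulr_sumr.
    rewrite exchange_big; apply: eq_bigr => j _; rewrite !mulr_sumr.
    by apply: eq_bigr => l _; ring.
  rewrite exchange_big /pairing; apply: eq_bigr => j _ /=.
  have jT : (j < T)%N by rewrite (leq_trans (ltn_ord j)) // leq_addl.
  have mean k i : (k < N)%N -> (i < N)%N ->
      N%:R^-1 * \sum_(l < N) z l ^+ k * (z l)^-1 ^+ i = (k == i)%:R.
    by move=> kN iN; exact: (mean_monomial nz0 kN iN).
  rewrite (bigD1 (Ordinal jT)) //= [X in _ + X]big1 ?addr0 => [|k kj].
    by rewrite mean ?eqxx ?mulr1 1?mulrC // (leq_trans jT).
  rewrite mean ?(leq_trans _ TN) //; case: eqP => [kj'|_]; last by rewrite mulr0.
  by case/eqP: kj; apply: val_inj.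
have dif : nm (N%:R^-1 * \sum_(l < N) (f (z l) - fT (z l)) * p.[(z l)^-1]) <= e * P.
  have mean_le (h : 'I_N -> C) (B : R) : (forall l, nm (h l) <= B) ->
      nm (N%:R^-1 * \sum_(l < N) h l) <= B.
    move=> hB; rewrite nmM nmV nm_nat ler_pdivrMl ?ltr0n //.
    rewrite (le_trans (nm_sum _ _ _)) // (le_trans (ler_sum _ (fun l _ => hB l))) //.
    by rewrite sumr_const card_ord -[leLHS]mulr_natl.
  apply: mean_le => l; rewrite nmM ler_pM ?nm_ge0 ?PP ?zr //.
  by apply: TP; rewrite ?zr // leq_addr.
have off : nm (\sum_(2 * n' <= l < N) f (z l) * p.[(z l)^-1]) <= N%:R * (Mf * X).
  rewrite (le_trans (nm_sum _ _ _)) //.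
  apply: (@le_trans _ _ (\sum_(2 * n' <= l < N) Mf * X)).
    rewrite big_nat_cond [leRHS]big_nat_cond; apply: ler_sum => l /andP[lN _].
    by rewrite nmM ler_pM ?nm_ge0 ?MfP ?zr ?pX //; apply: off_arc.
  rewrite sumr_const_nat -[leLHS]mulr_natl ler_wpM2r ?mulr_ge0 // ler_nat.
  exact: leq_subr.
(* For the primitive [N]-th root of unity [w], [w^(N / 2) = -1] as [m] is even, while
   [|w^k - 1| <= k |w - 1|]; take [k = N / 2]. *)
have w1 : N%:R * nm (root_ n' - 1) >= 4.
  have [m' mE] : exists m', m = (2 * m')%N.
    by exists m./2; rewrite mul2n -[LHS]odd_double_half (negPf m_even).
  have h : root_ n' ^+ (m' * n') = -1.
    rewrite /root_ expiX /step mE; have -> : (m' * n')%:R * (pi *+ 2 / (2 * m' * n')%:R) = pi :> R.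
      have nn : n'%:R != 0 :> R by rewrite pnatr_eq0 -lt0n.
      have mm : m'%:R != 0 :> R.
        by rewrite pnatr_eq0; apply: contraTneq m0 => m'0; rewrite mE m'0.
      by rewrite !natrM; field; rewrite nn mm.
    by apply/eqP; rewrite eq_complex /= cospi sinpi oppr0 !eqxx.
  have pw k : nm (root_ n' ^+ k - 1) <= k%:R * nm (root_ n' - 1).
    elim: k => [|k IHk]; first by rewrite expr0 subrr nm0 mul0r.
    have -> : root_ n' ^+ k.+1 - 1 = root_ n' * (root_ n' ^+ k - 1) + (root_ n' - 1).
      by rewrite exprS; ring.
    by rewrite (le_trans (nmD _ _)) // nmM nm_expi mul1r -natr1 mulrDl mul1r lerD2r.
  have := pw (m' * n')%N; rewrite h -opprD nmN -[1 + 1]/(2%:R) nm_nat => h2.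
  have -> : N%:R = 2 * (m' * n')%:R :> R by rewrite /N mE -natrM mulnA.
  lra.
have arc : nm (\sum_(l < 2 * n') f (z l) * p.[(z l)^-1]) <= N%:R * (1 / 4 * (8 * Y + K * 4 ^+ 2 / (2 * n')%:R + 4 * e)).
  have r0' : 0 <= r <= 2 by rewrite (ltW r0) (le_trans (ltW r1)) // ler1n.
  have rr : r <= r <= r' by rewrite lexx (ltW (lt_trans r1 r'1)).
  have zball (l : 'I_(2 * n')) : disc1 rho (z l) := arc_in n'0 (ltnW (ltn_ord l)) rr.
  have w0 : root_ n' - 1 != 0.
    by apply: contraTneq w1 => ->; rewrite nm0 mulr0 -ltNge.
  (* [z_(l + 1) - z_l = (w - 1) z_l], so a sum of values is a Riemann sum for [dz / z] up to the
     factor [w - 1]. *)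
  have -> : \sum_(l < 2 * n') f (z l) * p.[(z l)^-1] =
      (root_ n' - 1)^-1 * \sum_(l < 2 * n') Psi (z l) * (z l.+1 - z l).
    rewrite mulr_sumr; apply: eq_bigr => l _.
    have zS : z l.+1 - z l = (root_ n' - 1) * z l by rewrite /z /pt exprSr; ring.
    rewrite fg ?zr //.
    by rewrite zS /Psi; field; rewrite nz.
  have zD l : (l < 2 * n')%N -> nm (z l.+1 - z l) <= 4 / (2 * n')%:R.
    by move=> _; apply: pt_diff.
  have S1 : nm (\sum_(l < 2 * n') (Psi (z l) - q.[z l]) * (z l.+1 - z l)) <= 4 * e.
    rewrite (le_trans (nm_sum _ _ _)) //.
    apply: (@le_trans _ _ (\sum_(l < 2 * n') e * (4 / (2 * n')%:R))).
      by apply: ler_sum => l _; rewrite nmM ler_pM ?nm_ge0 ?zD ?qP.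
    rewrite sumr_const card_ord -[leLHS]mulr_natl.
    have nz2 : (2 * n')%:R != 0 :> R by rewrite pnatr_eq0 -lt0n muln_gt0.
    by rewrite mulrCA [_ * (4 / _)]mulrC divfK // mulrC.
  have S2 : nm (\sum_(l < 2 * n') q.[z l] * (z l.+1 - z l)) <= 8 * Y + K * 4 ^+ 2 / (2 * n')%:R.
    have n20 : (0 < 2 * n')%N by rewrite muln_gt0.
    have z2 l : (l <= 2 * n')%N -> nm (z l) <= 2 by move=> _; rewrite zr; case/andP: r0'.
    have h := KP _ z 4 n20 z2 zD.
    have [z0E z2E] : z 0%N = r%:C%C * expi (- t1) /\ z (2 * n')%N = r%:C%C * expi t1 := ends r n'0.
    rewrite z0E z2E in h.
    move: QAB h; set d := Q.[_] - Q.[_]; set s := \sum_(l < _) _ => dY ds.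
    have -> : s = d - (d - s) by rewrite opprB addrC subrK.
    by rewrite (le_trans (nmB _ _)) // lerD.
  rewrite nmM nmV ler_pdivrMl ?lt_def ?nm_ge0 ?nm_eq0 ?w0 //.
  apply: (@le_trans _ _ (8 * Y + K * 4 ^+ 2 / (2 * n')%:R + 4 * e)).
    have -> : \sum_(l < 2 * n') Psi (z l) * (z l.+1 - z l) =
        \sum_(l < 2 * n') q.[z l] * (z l.+1 - z l) +
        \sum_(l < 2 * n') (Psi (z l) - q.[z l]) * (z l.+1 - z l).
      by rewrite -big_split; apply: eq_bigr => l _; rewrite /= -mulrDl [q.[z l] + _]addrC subrK.
    by rewrite (le_trans (nmD _ _)) // lerD.
  set Z := _ + 4 * e; have Z0 : 0 <= Z.
    by rewrite !addr_ge0 ?mulr_ge0 ?invr_ge0 ?exprn_ge0 // ltW.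
  have -> : nm (root_ n' - 1) * (N%:R * (1 / 4 * Z)) = N%:R * nm (root_ n' - 1) / 4 * Z by field.
  by rewrite ler_peMl // ler_pdivlMr // mul1r.
have n2N : (2 * n' <= N)%N by rewrite leq_mul2r (leq_trans _ m_ge8) ?orbT.
have split_sum : N%:R * pairing c p =
    \sum_(l < 2 * n') f (z l) * p.[(z l)^-1] + \sum_(2 * n' <= l < N) f (z l) * p.[(z l)^-1]
    - \sum_(l < N) (f (z l) - fT (z l)) * p.[(z l)^-1].
  rewrite -meanE mulrA divff ?mul1r; last by rewrite pnatr_eq0 -lt0n.
  rewrite -(big_mkord xpredT (fun l => f (z l) * p.[(z l)^-1])) -big_cat_nat //= big_mkord.
  by rewrite -sumrB; apply: eq_bigr => l _; rewrite mulrBl opprB addrC subrK.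
have NR : 0 < N%:R :> R by rewrite ltr0n.
have dif' : nm (\sum_(l < N) (f (z l) - fT (z l)) * p.[(z l)^-1]) <= N%:R * (e * P).
  by move: dif; rewrite nmM nmV nm_nat ler_pdivrMl.
rewrite -(ler_pM2l NR) -{1}(nm_nat R N) -nmM split_sum.
rewrite (le_trans (nmB _ _)) // (le_trans (lerD (nmD _ _) (lexx _))) //.
have Kn : K * 4 ^+ 2 / (2 * n')%:R <= 8 * K / n%:R.
  have n'R : 0 < n'%:R :> R by rewrite ltr0n.
  have -> : K * 4 ^+ 2 / (2 * n')%:R = 8 * K / n'%:R by rewrite natrM; field; rewrite gt_eqF.
  rewrite ler_wpM2l ?mulr_ge0 // lef_pV2 ?posrE ?ltr0n // ler_nat /n' -addnA.
  exact: leq_addr.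
apply: (@le_trans _ _ (N%:R * (1 / 4 * (8 * Y + K * 4 ^+ 2 / (2 * n')%:R + 4 * e)) + N%:R * (Mf * X) + N%:R * (e * P))).
  by rewrite lerD // lerD.
rewrite -!mulrDr ler_pM2l // /Y.
have -> : 4 * (Mg / r) = 4 * Mg / r by rewrite mulrA.
have : (Mf + 4 * Mg / r) * X = Mf * X + 4 * (Mg * X / r) by ring.
have : 0 <= Mg * X / r by rewrite !mulr_ge0 ?invr_ge0 // ltW.
have : 2 * K / n%:R = 2 * (K / n%:R) by rewrite mulrA.
have : 8 * K / n%:R = 8 * (K / n%:R) by rewrite mulrA.
have : e * (P + 8) = e * P + e * 8 by rewrite mulrDr.
move: Kn; set u := Mg * X / r; set v := K / n%:R; lra.
Qed.

End Contour.

(** * Polynomials small on a dented circle *)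

Section DentPolynomial.
Variable R : realType.
Notation C := R[i].

Lemma exists_expr_le (x e : R) : 0 <= x < 1 -> 0 < e -> exists n, x ^+ n <= e.
Proof.
move=> /andP[x0 x1] e0; have [->|nzx] := eqVneq x 0; first by exists 1%N; rewrite ltW.
have xp : 0 < x by rewrite lt_def nzx.
have yp : 0 < x^-1 - 1 by rewrite subr_gt0 invf_gt1.
have /archi_boundP : 0 <= e^-1 / (x^-1 - 1) by rewrite divr_ge0 ?invr_ge0 // ltW.
set n := Num.bound _; rewrite ltr_pdivrMr // => ne; exists n.
rewrite -[x]invrK exprVn -[e]invrK lef_pV2 ?posrE ?exprn_gt0 ?invr_gt0 //.
have bern k : 1 + k%:R * (x^-1 - 1) <= x^-1 ^+ k.
  elim: k => [|k IHk]; first by rewrite mul0r addr0.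
  rewrite exprS -natr1; have k0 : 0 <= k%:R :> R by [].
  have xi0 : 0 <= x^-1 by rewrite invr_ge0.
  apply: le_trans (ler_wpM2l xi0 IHk); rewrite -subr_ge0.
  have -> : x^-1 * (1 + k%:R * (x^-1 - 1)) - (1 + (k%:R + 1) * (x^-1 - 1)) =
    k%:R * (x^-1 - 1) ^+ 2 by ring.
  by rewrite mulr_ge0 ?sqr_ge0.
by have := bern n; lra.
Qed.

Lemma bernoulli_lower (y : R) d : 0 <= y <= 1 -> 1 - d%:R * y <= (1 - y) ^+ d.
Proof.
move=> /andP[y0 y1]; elim: d => [|d IHd]; first by rewrite mul0r subr0.
rewrite exprS -natr1; have y1' : 0 <= 1 - y by rewrite subr_ge0.
apply: le_trans (ler_wpM2l y1' IHd); rewrite -subr_ge0.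
have -> : (1 - y) * (1 - d%:R * y) - (1 - (d%:R + 1) * y) = d%:R * y ^+ 2 by ring.
by rewrite mulr_ge0 ?sqr_ge0.
Qed.

Lemma poly_lipschitz (h : {poly C}) : exists2 L, 0 <= L & forall z w, nm z <= 2 -> nm w <= 2 ->
  nm (h.[w] - h.[z]) <= L * nm (w - z).
Proof.
have [K K0 KP] := poly_second_order h; have [B B0 BP] := poly_bounded h^`() 2.
exists (4 * K + B) => [|z w z2 w2]; first by rewrite addr_ge0 ?mulr_ge0.
rewrite -(subrK (h^`().[z] * (w - z)) (h.[w] - h.[z])) (le_trans (nmD _ _)) //.
rewrite [leRHS]mulrDl lerD // ?nmM ?ler_wpM2r ?nm_ge0 ?BP //.
apply: (le_trans (KP z w z2 w2)); have -> : 4 * K * nm (w - z) = K * (4 * nm (w - z)) by ring.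
rewrite (ler_wpM2l K0) // expr2 ler_wpM2r ?nm_ge0 //.
by rewrite (le_trans (nmB _ _)) //; lra.
Qed.

Lemma Re_le_nm (w : C) : complex.Re w <= nm w.
Proof.
rewrite (le_trans (ler_norm _)) // -(@ler_pXn2r _ 2) ?nnegrE ?nm_ge0 //.
by rewrite real_normK ?num_real // nm_sqr lerDl sqr_ge0.
Qed.

(* Re 1/(1 - u) = 1/2 on the unit circle: a long truncation of the geometric
   series in lam u, lam close to 1, has real part close to 1/2 off 1. *)
Lemma truncated_geometric (g : R) : -1 <= g < 1 -> exists (h : {poly C}) (d : nat),
  [/\ (0 < d)%N, h`_0 = 0, (size h <= d.+1)%N &
      forall u, nm u = 1 -> complex.Re u <= g -> complex.Re h.[u] <= - (1 / 4)].
Proof.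
(* With this [lam] the full series has real part at most [5 / 8] where [Re u <= g]; the tail is at
   most [1 / 8], and dropping the constant term 1 leaves at most [- 1 / 4]. *)
move=> /andP[g0 g1]; pose x := (1 - g) / 8; pose lam := 1 - x.
have x0 : 0 < x by rewrite /x; lra.
have x4 : x <= 1 / 4 by rewrite /x; lra.
have l01 : 0 <= lam < 1 by rewrite /lam; apply/andP; split; lra.
have [d dP] := exists_expr_le l01 (e := x / 8) (divr_gt0 x0 (ltr0n _ 8)).
exists (\poly_(k < d.+2) (if k == 0%N then 0 else lam%:C%C ^+ k)), d.+1.
split=> [||| u u1 ug]; [by []|by rewrite coef_poly|exact: size_poly|].
rewrite horner_poly big_ord_recl /= mul0r add0r.
set v := lam%:C%C * u; have nv : nm v = lam.
  by rewrite nmM u1 mulr1 nm_real ger0_norm //; case/andP: l01.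
have v1 : 1 - v != 0.
  rewrite subr_eq0; apply: contraTneq isT => v1.
  by move: nv; rewrite -v1 nm1 => l1; move: l01; rewrite -l1 ltxx andbF.
have -> : \sum_(i < d.+1) lam%:C%C ^+ bump 0 i * u ^+ bump 0 i = (1 - v)^-1 - (1 - v)^-1 * v ^+ d.+2 - 1.
  under eq_bigr => i _ do rewrite /bump /= add1n -exprMn -/v exprS.
  rewrite -mulr_sumr; apply: (mulfI v1); have := subrX1 v d.+1.
  set s := \sum_(i < d.+1) _ => sE.
  have -> : (1 - v) * ((1 - v)^-1 - (1 - v)^-1 * v ^+ d.+2 - 1) =
    (1 - v) / (1 - v) * (1 - v ^+ d.+2) - (1 - v) by ring.
  rewrite divff // mul1r exprS.
  have -> : v ^+ d.+1 = (v - 1) * s + 1 by rewrite -sE subrK.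
  ring.
have nv1 : x <= nm (1 - v).
  have : nm 1 <= nm (1 - v) + nm v by rewrite -{1}(subrK v 1) nmD.
  by rewrite nm1 nv /lam; lra.
have small : nm ((1 - v)^-1 * v ^+ d.+2) <= 1 / 8.
  rewrite nmM nmV nmX nv ler_pdivrMl; last by apply: lt_le_trans nv1.
  have l2 : lam ^+ d.+2 <= lam ^+ d.
    have [l0 l1] := andP l01; apply: ler_wiXn2l => //; first exact: ltW.
    by rewrite -addn2 leq_addr.
  nra.
have Re_small (w : C) : - complex.Re w <= nm w by rewrite -nmN -raddfN Re_le_nm.
have ReE : complex.Re ((1 - v)^-1 - (1 - v)^-1 * v ^+ d.+2 - 1) =
    complex.Re (1 - v)^-1 - complex.Re ((1 - v)^-1 * v ^+ d.+2) - 1.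
  by rewrite !raddfB.
have := Re_small ((1 - v)^-1 * v ^+ d.+2); rewrite ReE.
suff : complex.Re (1 - v)^-1 <= 5 / 8 by lra.
have u2 : complex.Re u ^+ 2 + complex.Im u ^+ 2 = 1 by rewrite -nm_sqr u1 expr1n.
have -> : complex.Re (1 - v)^-1 = (1 - lam * complex.Re u) / nm (1 - v) ^+ 2.
  rewrite nm_sqr /v; case: (u) => a b /=.
  by rewrite !mul0r subr0.
have DE : nm (1 - v) ^+ 2 = 1 - 2 * (lam * complex.Re u) + lam ^+ 2.
  rewrite nm_sqr /v; move: u2; case: (u) => a b /= ab.
  rewrite !mul0r subr0 addr0 sub0r sqrrN.
  have -> : (1 - lam * a) ^+ 2 + (lam * b) ^+ 2 =
    1 - 2 * (lam * a) + lam ^+ 2 * (a ^+ 2 + b ^+ 2) by ring.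
  by rewrite ab mulr1.
rewrite ler_pdivrMr; last by rewrite exprn_gt0 // (lt_le_trans x0).
rewrite DE; have [l0 l1] := andP l01.
have lc : lam * complex.Re u <= lam * g by rewrite ler_wpM2l.
have gx : g = 1 - 8 * x by rewrite /x; field.
move: lc; rewrite gx /lam; set y := (1 - x) * _; nra.
Qed.

(** [P(1/z) = z^-d (1 + nu h(z))] with [h] from [truncated_geometric]. Off the dent and on its sides
    [Re h <= - 1 / 8] makes the second factor at most [1 - nu / 16], and [|z|^-d] is at most
    [1 / (1 - nu / 32)] for [r] near 1. On the outer circle [|z|^-d <= 1 / (1 + del)] outweighs
    [1 + nu H <= 1 + del / 2]. Neither bound depends on [r]. *)
Lemma dent_polynomial (g dmax : R) : -1 <= g < 1 -> 0 < dmax ->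
  exists (P : {poly C}) (d : nat) (r' r0 theta : R),
  [/\ P \is monic, size P = d.+1, (0 < d)%N,
      [/\ 1 < r' <= 2, r' <= 1 + dmax, 0 < r0 < 1 & 0 < theta < 1] &
      forall r z, r0 <= r < 1 -> dented_circle g r r' z -> nm P.[z^-1] <= theta].
Proof.
move=> g01 dmax0; have [h [d [d0 h0 szh hg]]] := truncated_geometric g01.
have [L L0 LP] := poly_lipschitz h; have [H H0 HP] := poly_bounded h 2.
(* Moving a point by at most [del1] changes [h] by at most [1 / 8], so [Re h <= - 1 / 4] on the unit
   circle becomes [Re h <= - 1 / 8] nearby. *)
pose del1 : R := (8 * (L + 1))^-1.
have del1_0 : 0 < del1 by rewrite invr_gt0 mulr_gt0 // ltr_wpDl.
have L1 : (L + 1) * del1 = 1 / 8 by rewrite /del1; field; rewrite gt_eqF // ltr_wpDl.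
pose del := Num.min (Num.min del1 dmax) 1.
have del0 : 0 < del by rewrite !lt_min del1_0 dmax0 ltr01.
have del_1 : del <= 1 by rewrite ge_min lexx orbT.
have del_del1 : del <= del1 by rewrite !ge_min lexx.
have del_dmax : del <= dmax by rewrite !ge_min lexx orbT.
(* The first bound keeps [nu^2 |h|^2] below [nu / 8], half of the gain [- 2 nu Re h >= nu / 4]; the
   second gives [nu H <= del / 2]. *)
pose nu := Num.min (8 * (H ^+ 2 + 1))^-1 (del / (2 * (H + 1))).
have H21 : 0 < 8 * (H ^+ 2 + 1) by rewrite mulr_gt0 // ltr_wpDl ?sqr_ge0.
have H1 : 0 < 2 * (H + 1) by rewrite mulr_gt0 // ltr_wpDl.
have nu0 : 0 < nu by rewrite lt_min invr_gt0 H21 divr_gt0.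
have nu1 : nu * (8 * (H ^+ 2 + 1)) <= 1.
  by rewrite -ler_pdivlMr // div1r ge_min lexx.
have nu2 : nu * (2 * (H + 1)) <= del by rewrite -ler_pdivlMr // ge_min lexx orbT.
have nule : nu <= 1 by nra.
(* Bernoulli's inequality then gives [r^d >= 1 - nu / 32] for [r >= 1 - y]. *)
pose y := nu / (32 * d%:R).
have dR : 1 <= d%:R :> R by rewrite ler1n.
have y0 : 0 < y by rewrite divr_gt0 // mulr_gt0 // (lt_le_trans ltr01).
have yd : d%:R * y = nu / 32 by rewrite /y; field; rewrite gt_eqF // (lt_le_trans ltr01).
have y1 : y <= 1 / 32.
  rewrite /y ler_pdivrMr ?mulr_gt0 ?(lt_le_trans ltr01) //; clear -nule dR; lra.
pose r0 := Num.max (1 - y) (Num.max (1 - del) (1 / 2)).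
have r0_0 : 0 < r0 by rewrite !lt_max divr_gt0 // !orbT.
have r0_1 : r0 < 1.
  by rewrite !gt_max; apply/and3P; split; clear -y0 del0; lra.
have r0y : 1 - y <= r0 by rewrite le_max lexx.
have r0d : 1 - del <= r0 by rewrite !le_max lexx orbT.
pose th1 := (1 - nu / 16) / (1 - nu / 32).
pose th2 := (1 + del / 2) / (1 + del).
pose P : {poly C} := 'X^d + \sum_(k < d) (nu%:C%C * h`_k.+1) *: 'X^(d - k.+1).
have szS : (size (\sum_(k < d) (nu%:C%C * h`_k.+1) *: 'X^(d - k.+1) : {poly C})%R <= d)%N.
  apply: (leq_trans (size_sum _ _ _)); apply/bigmax_leqP => k _.
  by rewrite (leq_trans (size_scale_leq _ _)) // size_polyXn subnSK // leq_subr.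
have szP : size P = d.+1 by rewrite size_polyDl ?size_polyXn.
have PE z : z != 0 -> P.[z^-1] = z^-1 ^+ d * (1 + nu%:C%C * h.[z]).
  move=> nz; rewrite hornerD hornerXn horner_sum mulrDr mulr1; congr (_ + _).
  rewrite (horner_coef_wide _ szh) big_ord_recl h0 mul0r add0r mulrCA !mulr_sumr.
  apply: eq_bigr => k _; rewrite hornerZ hornerXn -mulrA; congr (_ * _).
  rewrite mulrCA; congr (_ * _); have kd : (k.+1 <= d)%N := ltn_ord k.
  have -> : z^-1 ^+ d = z^-1 ^+ (d - k.+1) * z^-1 ^+ k.+1 by rewrite -exprD subnK.
  by rewrite lift0 -mulrA -exprMn mulVf // expr1n mulr1.
exists P, d, (1 + del), r0, (Num.max th1 th2); split=> //.
- by rewrite monicE lead_coefE szP /= coefD coefXn eqxx nth_default ?addr0.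
- have th1_1 : 0 < th1 < 1.
    have A : 0 < 1 - nu / 16 by clear -nule; lra.
    have B : 0 < 1 - nu / 32 by clear -nule; lra.
    by rewrite /th1 divr_gt0 //= ltr_pdivrMr // mul1r; clear -nu0; lra.
  have th2_1 : 0 < th2 < 1.
    have A : 0 < 1 + del / 2 by clear -del0; lra.
    have B : 0 < 1 + del by clear -del0; lra.
    by rewrite /th2 divr_gt0 //= ltr_pdivrMr // mul1r; clear -del0; lra.
  split.
  - by rewrite ltrDl del0 lerD2l.
  - by rewrite lerD2l.
  - by rewrite r0_0.
  - by rewrite lt_max gt_max; case/andP: th1_1 => -> ->; case/andP: th2_1 => _ ->.
move=> r z /andP[r0r r1] Gz.
have rp : 0 < r by apply: lt_le_trans r0r.
have caseA : r <= nm z <= 1 + del -> complex.Re z <= g * nm z -> nm P.[z^-1] <= th1.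
  set s := nm z => /andP[rs s1] zg; have s0 : 0 < s by apply: lt_le_trans rs.
  have nz : z != 0 by rewrite -nm_eq0 gt_eqF.
  pose u := s^-1%:C%C * z.
  have nu_u : nm u = 1 by rewrite nmM nm_real ger0_norm ?invr_ge0 ?ltW // mulVf // gt_eqF.
  have ug : complex.Re u <= g.
    have -> : complex.Re u = complex.Re z / s.
      by rewrite /u; case: (z) => a b /=; rewrite mul0r subr0 mulrC.
    by rewrite ler_pdivrMr.
  have dist : nm (z - u) <= del1.
    have -> : z - u = (s - 1)%:C%C * u.
      by rewrite rmorphB rmorph1 mulrBl mul1r /u mulrA -rmorphM divff ?gt_eqF // rmorph1 mul1r.
    rewrite nmM nu_u mulr1 nm_real ler_norml; apply/andP; split; clear -s1 rs r0r r0d del_del1; lra.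
  have z2 : nm z <= 2 by rewrite -/s; clear -s1 del_1; lra.
  have u2 : nm u <= 2 by rewrite nu_u ler1n.
  have hz : complex.Re h.[z] <= - (1 / 8).
    have := hg u nu_u ug.
    have : complex.Re (h.[z] - h.[u]) <= 1 / 8.
      apply: (@le_trans _ _ (nm (h.[z] - h.[u]))).
        exact: Re_le_nm.
      apply: (le_trans (LP u z u2 z2)); rewrite -L1.
      by apply: ler_pM; rewrite ?nm_ge0 // lerDl.
    rewrite raddfB /=; clear; lra.
  have hH : complex.Re h.[z] ^+ 2 + complex.Im h.[z] ^+ 2 <= H ^+ 2.
    by rewrite -nm_sqr ler_pXn2r ?nnegrE ?nm_ge0 ?HP.
  have h1 : nm (1 + nu%:C%C * h.[z]) <= 1 - nu / 16.
    apply: nm_le_sqr; first by clear -nule; lra.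
    move: hz hH; case: (h.[z]) => a b /= ha hab.
    rewrite !mul0r subr0 addr0 add0r.
    have -> : (1 + nu * a) ^+ 2 + (nu * b) ^+ 2 = 1 + 2 * (nu * a) + nu * (nu * (a ^+ 2 + b ^+ 2)) by ring.
    have e1 : nu * (nu * (a ^+ 2 + b ^+ 2)) <= nu * (1 / 8).
      rewrite ler_wpM2l ?(ltW nu0) //; apply: le_trans (_ : nu * H ^+ 2 <= _).
        by rewrite ler_wpM2l ?(ltW nu0).
      by move: nu1; have := ltW nu0; clear; set nH := H ^+ 2; lra.
    have e2 : nu * a <= nu * - (1 / 8) by rewrite ler_wpM2l ?(ltW nu0).
    have e3 : 0 <= (nu / 16) ^+ 2 by apply: sqr_ge0.
    by rewrite sqrrB expr1n mul1r; clear -e1 e2 e3; lra.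
  rewrite PE // nmM nmX nmV -/s /th1 [leRHS]mulrC.
  have h1' : 0 < 1 - nu / 32 by clear -nule; lra.
  have sd : s^-1 ^+ d <= (1 - nu / 32)^-1.
    rewrite exprVn lef_pV2 ?posrE ?exprn_gt0 //.
    have y01 : 0 <= y <= 1 by rewrite (ltW y0) (le_trans y1) // ler_pdivrMr // mul1r ler1n.
    have := bernoulli_lower d y01; rewrite yd => /le_trans; apply.
    rewrite lerXn2r ?nnegrE ?(ltW s0) //; first by clear -y1; lra.
    by apply: le_trans rs; apply: le_trans r0r.
  by apply: ler_pM; rewrite ?nm_ge0 ?exprn_ge0 ?invr_ge0 // ltW.
have caseB : nm z = 1 + del -> nm P.[z^-1] <= th2.
  move=> zs; have s0 : 0 < 1 + del by clear -del0; lra.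
  have nz : z != 0 by rewrite -nm_eq0 zs gt_eqF.
  rewrite PE // nmM nmX nmV zs /th2 [leRHS]mulrC.
  apply: ler_pM; rewrite ?nm_ge0 ?exprn_ge0 ?invr_ge0 ?(ltW s0) //.
    rewrite exprVn lef_pV2 ?posrE ?exprn_gt0 // -{1}[1 + del]expr1.
    by rewrite ler_weXn2l // lerDl ltW.
  rewrite (le_trans (nmD _ _)) // nm1 lerD2l nmM nm_real ger0_norm ?(ltW nu0) //.
  have : nm h.[z] <= H by apply: HP; rewrite zs lerD2l.
  move=> hH; apply: (@le_trans _ _ (nu * H)); first by rewrite ler_wpM2l ?(ltW nu0).
  by clear -nu2 nu0; lra.
rewrite le_max; case: Gz => [[zr zg]|[/andP[rz zr'] zg]|zr'].
- by rewrite caseA ?zr ?lexx //= (le_trans (ltW r1)) // lerDl ltW.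
- by rewrite caseA ?rz ?zr' ?zg.
- by rewrite caseB ?orbT.
Qed.

End DentPolynomial.

(** * A weighted norm and the Euler operators *)

Section WeightedNorm.
Variables (R : realType) (x : R).
Hypothesis x0 : 0 <= x.
Notation C := R[i].
Implicit Types (p q : {poly C}).

(** Submultiplicative, an upper bound for [|p|] on the disc of radius [x], and multiplied by at most
    [size p] under [X d/dX], so that iterated differential operators need no Cauchy estimates. *)
Definition l1 p := \sum_(j < size p) nm p`_j * x ^+ j.

Lemma l1E n p : (size p <= n)%N -> l1 p = \sum_(j < n) nm p`_j * x ^+ j.
Proof.
move=> le_n; rewrite /l1 (big_ord_widen n (fun j => nm p`_j * x ^+ j)) //.
rewrite big_mkcond /=; apply: eq_bigr => j _; case: ltnP => // le_j.
by rewrite nth_default // nm0 mul0r.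
Qed.

Lemma l1_ge0 p : 0 <= l1 p.
Proof. by rewrite sumr_ge0 // => j _; rewrite mulr_ge0 ?nm_ge0 ?exprn_ge0. Qed.

Lemma l1D p q : l1 (p + q) <= l1 p + l1 q.
Proof.
pose n := maxn (size p) (size q).
rewrite (@l1E n (p + q)) ?size_polyD // (@l1E n p) ?leq_maxl // (@l1E n q) ?leq_maxr //.
rewrite -big_split /=; apply: ler_sum => j _.
by rewrite coefD -mulrDl ler_wpM2r ?exprn_ge0 ?nmD.
Qed.

Lemma l1Z c p : l1 (c *: p) = nm c * l1 p.
Proof.
rewrite (@l1E (size p)) ?size_scale_leq // mulr_sumr.
by apply: eq_bigr => j _; rewrite coefZ nmM mulrA.
Qed.

Lemma l1N p : l1 (- p) = l1 p.
Proof. by rewrite -scaleN1r l1Z nmN nm1 mul1r. Qed.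

Lemma l1MX p : l1 (p * 'X) = x * l1 p.
Proof.
rewrite (@l1E (size p).+1); last first.
  by apply: leq_trans (size_polyMleq _ _) _; rewrite size_polyX addn2.
rewrite big_ord_recl coefMX eqxx nm0 mul0r add0r mulr_sumr.
by apply: eq_bigr => j _; rewrite coefMX /= exprS mulrCA.
Qed.

Lemma l1M p q : l1 (p * q) <= l1 p * l1 q.
Proof.
elim/poly_ind: p => [|p c IHp]; first by rewrite mul0r /l1 size_poly0 !big_ord0 mul0r.
have l1p : l1 (p * 'X + c%:P) = x * l1 p + nm c.
  rewrite (@l1E (size p).+1); last first.
    rewrite (leq_trans (size_polyD _ _)) // geq_max (leq_trans (size_polyC_leq1 _)) // andbT.
    by apply: leq_trans (size_polyMleq _ _) _; rewrite size_polyX addn2.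
  rewrite big_ord_recl coefD coefMX coefC eqxx add0r expr0 mulr1 addrC; congr (_ + _).
  rewrite mulr_sumr; apply: eq_bigr => j _.
  by rewrite coefD coefMX coefC /= addr0 exprS mulrCA.
rewrite l1p mulrDl mulrDl mul_polyC (le_trans (l1D _ _)) // l1Z lerD2r.
by rewrite mulrAC l1MX -mulrA ler_wpM2l.
Qed.

Lemma l1_deriv p : l1 (p^`() * 'X) <= (size p)%:R * l1 p.
Proof.
rewrite (@l1E (size p)); last first.
  have [-> | nzp] := eqVneq p 0; first by rewrite deriv0 mul0r.
  apply: leq_trans (size_polyMleq _ _) _; rewrite size_polyX addn2.
  exact: lt_size_deriv.
rewrite mulr_sumr; apply: ler_sum => j _; rewrite mulrA ler_wpM2r ?exprn_ge0 //.
rewrite coefMX; case: (nat_of_ord j) (ltn_ord j) => [|i] ip /=.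
  by rewrite nm0 mulr_ge0 ?nm_ge0.
by rewrite coef_deriv -(mulr_natr p`_i.+1) nmM nm_nat mulrC ler_wpM2r ?nm_ge0 // ler_nat ltnW.
Qed.

Lemma l1Xn n : l1 'X^n = x ^+ n.
Proof.
elim: n => [|n IHn]; first by rewrite expr0 /l1 size_poly1 big_ord1 coefC nm1 mul1r.
by rewrite exprSr l1MX IHn exprS.
Qed.

Lemma nm_horner_l1 p w : nm w <= x -> nm p.[w] <= l1 p.
Proof. exact: nm_horner. Qed.

End WeightedNorm.

Section EulerTwist.
Variables (R : realType) (x : R).
Hypothesis x0 : 0 <= x.
Notation C := R[i].
Implicit Types (p q : {poly C}).

(** The composite of the operators [X d/dX - s]; for [pairing] it is the adjoint of multiplying the
    [l]-th term of a sequence by the product of the [l - s]. *)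
Definition euler_twist (sl : seq nat) p := foldr (fun s q => q^`() * 'X - s%:R *: q) p sl.

Lemma coef_euler_twist sl p l :
  (euler_twist sl p)`_l = (\prod_(s <- sl) (l%:R - s%:R)) * p`_l.
Proof.
elim: sl => [|s sl IHsl] /=; first by rewrite big_nil mul1r.
rewrite coefB coefZ coefMX big_cons -mulrA -IHsl mulrBl; congr (_ - _).
by case: l {IHsl} => [|l] /=; rewrite ?mul0r // coef_deriv mulr_natl.
Qed.

(** Differentiating [P^m Q] lowers the exponent by one and leaves a cofactor. The first part of the
    constant comes from [P'], the second from [P (X Q' - s Q)], and its [+ 1] from the case of an
    exhausted exponent, where the truncated subtraction stays at 0. *)
Lemma euler_twist_power (P : {poly C}) (N : R) (sl : seq nat) m (Q : {poly C}) :
    (forall s, s \in sl -> s%:R <= N) -> m%:R <= N ->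
    (size Q + size P * size sl)%:R <= N ->
  exists Q' : {poly C}, [/\ euler_twist sl (P ^+ m * Q) = P ^+ (m - size sl) * Q',
    l1 x Q' <= ((l1 x (P^`() * 'X) + 2 * (l1 x P + 1)) * N) ^+ size sl * l1 x Q &
    (size Q' <= size Q + size P * size sl)%N].
Proof.
set G := l1 x (P^`() * 'X) + 2 * (l1 x P + 1).
have dP0 : 0 <= l1 x (P^`() * 'X) := l1_ge0 x0 _.
have P0 : 0 <= l1 x P := l1_ge0 x0 _.
move=> slN mN; elim: sl slN => [|s sl IHsl] slN szN.
  by exists Q; rewrite subn0 mul1r; split=> //=; rewrite muln0 addn0.
have [||Q1 [Q1E Q1l Q1s]] := IHsl.
- by move=> t t_sl; apply: slN; rewrite inE t_sl orbT.
- by apply: le_trans szN; rewrite ler_nat leq_add2l leq_mul2l leqnSn orbT.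
have sN : s%:R <= N by apply: slN; rewrite mem_head.
have N0 : 0 <= N by apply: le_trans sN.
have Q1_0 : 0 <= l1 x Q1 := l1_ge0 x0 _.
have Q1N : (size Q1)%:R <= N.
  by apply: le_trans szN; rewrite ler_nat (leq_trans Q1s) // leq_add2l leq_mul2l leqnSn orbT.
have D1 : l1 x (Q1^`() * 'X - s%:R *: Q1) <= 2 * N * l1 x Q1.
  rewrite (le_trans (l1D x0 _ _)) // l1N // l1Z // nm_nat.
  have -> : 2 * N * l1 x Q1 = N * l1 x Q1 + N * l1 x Q1 by ring.
  by rewrite lerD ?ler_wpM2r // (le_trans (l1_deriv x0 _)) // ler_wpM2r.
have szXp (T : {poly C}) : (size (T^`() * 'X)%R <= size T)%N.
  have [-> | nzp] := eqVneq T 0; first by rewrite deriv0 mul0r.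
  apply: leq_trans (size_polyMleq _ _) _; rewrite size_polyX addn2.
  exact: lt_size_deriv.
have szD : (size (Q1^`() * 'X - s%:R *: Q1)%R <= size Q1)%N.
  rewrite (leq_trans (size_polyD _ _)) // geq_max szXp size_polyN.
  exact: size_scale_leq.
have bound_final (Q' : {poly C}) : l1 x Q' <= G * N * l1 x Q1 ->
    l1 x Q' <= (G * N) ^+ (size sl).+1 * l1 x Q.
  move=> /le_trans; apply; rewrite exprS -[leRHS]mulrA ler_wpM2l //.
  by rewrite mulr_ge0 // !addr_ge0 ?mulr_ge0 ?addr_ge0.
rewrite /= Q1E; case: (posnP (m - size sl)) => [m0|m0].
  exists (Q1^`() * 'X - s%:R *: Q1); split.
  - by rewrite m0 subnS m0 !mul1r.
  - apply: bound_final; rewrite (le_trans D1) // ler_wpM2r // ler_wpM2r //.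
    by rewrite /G; lra.
  - by rewrite (leq_trans szD) // (leq_trans Q1s) // leq_add2l leq_mul2l leqnSn orbT.
set m1 := (m - size sl)%N in m0 *.
have m1N : m1%:R <= N by apply: le_trans mN; rewrite ler_nat leq_subr.
exists (m1%:R *: (P^`() * 'X * Q1) + P * (Q1^`() * 'X - s%:R *: Q1)); split.
- rewrite subnS -/m1 -{1 2}(prednK m0) derivM deriv_exp -mulr_natl /= exprS (prednK m0).
  rewrite -!mul_polyC rmorph_nat; ring.
- apply: bound_final; rewrite (le_trans (l1D x0 _ _)) // l1Z // nm_nat.
  have e1 : m1%:R * l1 x (P^`() * 'X * Q1) <= l1 x (P^`() * 'X) * N * l1 x Q1.
    have -> : l1 x (P^`() * 'X) * N * l1 x Q1 = N * (l1 x (P^`() * 'X) * l1 x Q1) by ring.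
    by apply: ler_pM => //; [exact: l1_ge0|exact: l1M].
  have e2 : l1 x (P * (Q1^`() * 'X - s%:R *: Q1)) <= 2 * l1 x P * N * l1 x Q1.
    rewrite (le_trans (l1M x0 _ _)) //.
    have -> : 2 * l1 x P * N * l1 x Q1 = l1 x P * (2 * N * l1 x Q1) by ring.
    by rewrite ler_wpM2l.
  have : 0 <= N * l1 x Q1 by rewrite mulr_ge0.
  have -> : G * N * l1 x Q1 = l1 x (P^`() * 'X) * N * l1 x Q1 + 2 * l1 x P * N * l1 x Q1 + 2 * (N * l1 x Q1).
    by rewrite /G; ring.
  by move: e1 e2; lra.
rewrite (leq_trans (size_polyD _ _)) // geq_max; apply/andP; split.
  rewrite (leq_trans (size_scale_leq _ _)) // (leq_trans (size_polyMleq _ _)) //.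
  by rewrite (leq_trans (leq_pred _)) // mulnS addnCA leq_add ?szXp.
rewrite (leq_trans (size_polyMleq _ _)) //.
by rewrite (leq_trans (leq_pred _)) // mulnS addnCA leq_add // (leq_trans szD).
Qed.

End EulerTwist.

(** * Vanishing of the twisted minors *)

Section Determinants.
Variable R : realType.
Notation C := R[i].

Lemma nm_det_le n (A : 'M[C]_n) (y : 'I_n -> R) : (forall i j, nm (A i j) <= y j) ->
  nm (\det A) <= n`!%:R * \prod_j y j.
Proof.
move=> Ay; rewrite /determinant (le_trans (nm_sum _ _ _)) //.
apply: (@le_trans _ _ (\sum_(s : 'S_n) \prod_j y j)).
  apply: ler_sum => s _; rewrite nmM nmX nmN nm1 expr1n mul1r nm_prod.
  rewrite [leRHS](reindex_inj (@perm_inj _ s)); apply: ler_prod => i _.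
  by rewrite nm_ge0 Ay.
by rewrite sumr_const card_Sn -[leLHS]mulr_natl.
Qed.

(** The columns are changed by a unitriangular matrix of coefficients. *)
Lemma det_monic_columns n (A : 'M[C]_n) (p : nat -> {poly C}) :
    (forall j, p j \is monic) -> (forall j, size (p j) = j.+1) ->
  \det A = \det (\matrix_(i, j) \sum_(l < n) A i l * (p j)`_l).
Proof.
move=> p_monic p_size; pose T : 'M[C]_n := \matrix_(l, j) (p j)`_l.
have detT : \det T = 1.
  rewrite -det_tr det_trig; last first.
    by apply/is_trig_mxP => i j ij; rewrite !mxE nth_default // p_size.
  by rewrite big1 // => i _; rewrite !mxE; have := monicP (p_monic i); rewrite lead_coefE p_size.
rewrite -[LHS]mulr1 -detT -det_mulmx; congr (\det _); apply/matrixP => i j.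
by rewrite !mxE; apply: eq_bigr => l _; rewrite !mxE.
Qed.

Lemma pairingE (c : nat -> C) (p : {poly C}) N : (size p <= N)%N ->
  pairing c p = \sum_(j < N) p`_j * c j.
Proof.
move=> szp; rewrite /pairing (big_ord_widen N (fun j => p`_j * c j)) //.
rewrite big_mkcond /=; apply: eq_bigr => j _; case: ltnP => // le_j.
by rewrite nth_default // mul0r.
Qed.

(** The sum is about [n^2 / (2 d)]. It is the total exponent of [P] over the columns, hence the
    quadratic exponent of [theta]. *)
Lemma sum_divn_lower n d : (0 < d)%N ->
  (n * n <= 2 * d * (\sum_(j < n) j %/ d) + (2 * d + 1) * n)%N.
Proof.
move=> d0; elim: n => [|n IHn]; first by rewrite !muln0.
rewrite big_ord_recr /=.
have := divn_eq n d; have := ltn_pmod n d0; set q := (n %/ d)%N; set t := (n %% d)%N.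
move: IHn; set s := (\sum_(i < n) _)%N => IHn td nE.
have : (2 * d * (s + q) = 2 * d * s + 2 * (q * d))%N by rewrite mulnDr; congr addn; ring.
lia.
Qed.

End Determinants.

(** [E - M >= E / 2] makes the window size at least about [E / 14]; the constant [28] absorbs the
    rounding. *)
Lemma window_size_bounds k M E : (28 * (4 * k + 4) <= E)%N -> (2 * M <= E)%N ->
  [/\ (E <= 28 * window_size M E)%N, (window_size M E <= E)%N,
      (4 * k + 2 < window_size M E)%N & (0 < E)%N].
Proof. by rewrite /window_size => ? ?; split; lia. Qed.

Lemma expr_shuffle (R : comNzRingType) (x b y t : R) n :
  (x * (b * y)) ^+ n * t = x ^+ n * (b ^+ n * (t * y ^+ n)).
Proof. by rewrite !exprMn; ring. Qed.

Lemma sizes_shuffle (R : comNzRingType) (D x B u v s c : R) n :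
  D * (x * (B * (s ^+ 2 * (u * v)))) * (x * (D * (s * (c * v)))) ^+ n =
  D * (x * ((B * u) * s ^+ 2)) * (x * (D * (s * c))) ^+ n * v ^+ n.+1.
Proof.
have -> : x * (D * (s * (c * v))) = x * (D * (s * c)) * v by ring.
rewrite exprMn [v ^+ n.+1]exprS; move: ((x * (D * (s * c))) ^+ n) (v ^+ n) => y z; ring.
Qed.

(** The logarithm of the bound for the product of the conjugates. The gain [kap Sg] is at least
    [56 ep (n^2 - (2 d + 1) n)], the loss at most [28 ep n^2]; [n > 4 d + 2] decides. *)
Lemma exponent_negative (R : realType) (d ep E n Sg kap : R) : 0 < d -> 0 < ep -> E <= 28 * n ->
  4 * d + 2 < n -> n * n <= 2 * d * Sg + (2 * d + 1) * n -> kap = 112 * d * ep ->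
  0 <= ep * E * n + (- kap) * Sg -> False.
Proof.
move=> d0 ep0 En dn sg -> pos.
have n0 : 0 < n by lra.
have h1 : ep * E * n <= ep * (28 * n) * n by rewrite ler_wpM2r ?(ltW n0) // ler_wpM2l // ltW.
have h2 : ep * (n * n) <= ep * (2 * d * Sg + (2 * d + 1) * n) by rewrite ler_wpM2l // ltW.
have h3 : ep * n * (4 * d + 2) < ep * n * n by rewrite ltr_pM2l // mulr_gt0.
lra.
Qed.

(** * Smallness of the minors against integrality *)

Section WindowRelation.
Variables (R : realType) (K : fieldExtType rat) (iota : {rmorphism K -> R[i]}).
Notation C := R[i].
Variables (S : pred nat) (a : nat -> K).
Hypothesis a_growth : growth R a.
Hypothesis a_den : subexp (fun n => (lcm_den S a n)%:R : R).
Hypothesis S_log : subexp (fun n => n%:R ^+ scount S n : R).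

Variables (P : {poly C}) (d : nat) (theta : R).
Hypothesis P_monic : P \is monic.
Hypothesis szP : size P = d.+1.
Hypothesis d0 : (0 < d)%N.
Hypothesis theta01 : 0 < theta < 1.
Hypothesis functional_bound : forall x : R, 1 < x -> exists2 B, 0 <= B & forall (p : {poly C}) X, 0 <= X ->
  (forall w, nm w <= x -> nm P.[w] <= theta -> nm p.[w] <= X) ->
  nm (pairing (iota \o a) p) <= B * X.

Let F M E : {poly K} := sieve K S M E.
Let sl M E := [seq s <- index_iota M E | S s].

Let sieve_horner M E k : (F M E).[k%:R] = \prod_(s <- sl M E) (k%:R - s%:R).
Proof.
rewrite /F /sieve horner_prod big_filter; apply: eq_bigr => s _.
by rewrite hornerXsubC.
Qed.

Let size_sl M E : (size (sl M E) <= scount S E)%N.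
Proof.
rewrite size_filter /scount; have [ME|EM] := leqP M E; last by rewrite /index_iota (_ : E - M = 0)%N //; apply/eqP; rewrite subn_eq0 ltnW.
rewrite -sum1_count big_mkcond /= (@big_cat_nat _ _ _ M 0 E) //=.
by apply: leq_trans (leq_addl _ _); apply: leq_sum => i _; case: (S i).
Qed.

Let sl_lt M E s : s \in sl M E -> (s < E)%N.
Proof. by rewrite mem_filter mem_index_iota => /and3P[]. Qed.

Definition window_mx M E : 'M[K]_(6 * window_size M E, window_size M E) :=
  \matrix_(i, j) ((F M E).[(M + i + j)%:R] * a (M + i + j)%N).

Let index_lt M E (i : 'I_(6 * window_size M E)) (j : 'I_(window_size M E)) : (M + i + j < E)%N.
Proof.
have := ltn_ord i; have := ltn_ord j; rewrite /window_size => hj hi.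
by move: (nat_of_ord i) (nat_of_ord j) hi hj => {}i {}j; lia.
Qed.

(** At [k] in [S] the sieve vanishes, so no denominator from [S] enters; elsewhere [lcm_den] clears
    it. *)
Let entry_integral M E (i : 'I_(6 * window_size M E)) j :
  algebraic_integer ((lcm_den S a E)%:R * window_mx M E i j).
Proof.
rewrite mxE; set k := (M + i + j)%N; have kE : (k < E)%N := index_lt i j.
have [Sk|nSk] := boolP (S k).
  rewrite (sieve_eq0 _ Sk) ?mul0r ?mulr0; first exact: (algint_nat K 0).
  by rewrite kE andbT /k -addnA leq_addr.
rewrite mulrCA; apply: algint_mul; last by apply: algint_den_dvd; apply: den_dvd_lcm => //; apply: ltnW.
rewrite sieve_horner; apply: algint_prod => s _.
by apply: algint_add; [exact: algint_nat|apply: algint_opp; exact: algint_nat].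
Qed.

Let nm_sieve (sigma : {rmorphism K -> C}) M E k : (0 < E)%N -> (k < E)%N ->
  nm (sigma (F M E).[k%:R]) <= E%:R ^+ scount S E.
Proof.
move=> E0 kE; rewrite sieve_horner rmorph_prod nm_prod.
apply: (@le_trans _ _ (E%:R ^+ size (sl M E))); last first.
  by rewrite ler_weXn2l ?ler1n // size_sl.
have : forall s, s \in sl M E -> nm (sigma (k%:R - s%:R)) <= E%:R.
  move=> s /sl_lt sE; rewrite rmorphB !rmorph_nat.
  have [ks|sk] := leqP k s.
    by rewrite nm_dist -natrB // nm_nat ler_nat (leq_trans (leq_subr _ _)) // ltnW.
  by rewrite -natrB 1?ltnW // nm_nat ler_nat (leq_trans (leq_subr _ _)) // ltnW.
elim: (sl M E) => [|s t IHt] tE; first by rewrite big_nil.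
rewrite big_cons exprS ler_pM ?nm_ge0 ?prodr_ge0 //.
- by move=> i _; apply: nm_ge0.
- by apply: tE; rewrite mem_head.
- by apply: IHt => s' s't; apply: tE; rewrite inE s't orbT.
Qed.

Let x_entry (sigma : {rmorphism K -> C}) M E (e c : R) : (0 < E)%N -> 0 <= c -> 0 < e ->
    (forall (tau : {rmorphism K -> C}) k, nm (tau (a k)) <= c * expR (e * k%:R)) ->
  forall i j, nm (sigma (window_mx M E i j)) <= E%:R ^+ scount S E * (c * expR (e * E%:R)).
Proof.
move=> E0 c0 e0 cP i j; have kE := index_lt i j.
rewrite mxE rmorphM nmM ler_pM ?nm_ge0 ?nm_sieve //.
rewrite (le_trans (cP sigma _)) // ler_wpM2l // ler_expR ler_wpM2l ?(ltW e0) //.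
by rewrite ler_nat ltnW.
Qed.

Let p_ j : {poly C} := P ^+ (j %/ d) * 'X^(j %% d).

Let p_monic j : p_ j \is monic.
Proof. by apply: rpredM; [apply: rpredX|apply: monicXn]. Qed.

Let p_size j : size (p_ j) = j.+1.
Proof.
have nzP : P != 0 := monic_neq0 P_monic.
rewrite /p_ (size_Mmonic (expf_neq0 _ nzP) (monicXn _ _)) size_polyXn.
have := size_exp P (j %/ d); rewrite szP /= => h.
have : (0 < size (P ^+ (j %/ d))%R)%N by rewrite size_poly_gt0 expf_neq0.
rewrite addnS /= => h0; rewrite -(prednK h0) h addSn; congr _.+1.
by rewrite mulnC addnC addnC -divn_eq.
Qed.

(** The sieve moves from the coefficients to the polynomial ['X^(M + i) p_j]. The row contributes
    only a power of [w] of exponent below [E], harmless for [x] close to 1; the column contributes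
    [theta ^ (j / d)], up to one lost power for each point of [S]. *)
Let twisted_entry M E (x G : R) : 1 < x -> (0 < E)%N -> (window_size M E <= E)%N ->
  G = l1 x (P^`() * 'X) + 2 * (l1 x P + 1) ->
  forall (i : 'I_(6 * window_size M E)) (j : 'I_(window_size M E)),
  exists2 tw : {poly C},
    \sum_(l < window_size M E) iota (window_mx M E i l) * (p_ j)`_l = pairing (iota \o a) tw &
    forall w, nm w <= x -> nm P.[w] <= theta ->
      nm tw.[w] <= theta ^+ (j %/ d - size (sl M E)) *
        ((G * ((2 * d + 4) * E)%:R) ^+ size (sl M E) * x ^+ (E + d)).
Proof.
move=> x1 E0 nE GE i j; set n := window_size M E in i j nE *.
have x0 : 0 <= x by rewrite ltW // (lt_trans ltr01).
set k := (M + i)%N; have kE : (k < E)%N.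
  by have := index_lt i j; apply: leq_ltn_trans; rewrite leq_addr.
pose N : R := ((2 * d + 4) * E)%:R; pose Q : {poly C} := 'X^(k + j %% d).
have jd : (j %% d < d)%N by rewrite ltn_pmod.
have slE : (size (sl M E) <= E)%N.
  by rewrite (leq_trans (size_sl M E)) // /scount -[leqRHS]subn0 -[leqRHS]muln1 -sum_nat_const_nat leq_sum // => s _; case: (S s).
have [|||Q' [tE Q'l _]] := @euler_twist_power R x x0 P N (sl M E) (j %/ d) Q.
- move=> s /sl_lt sE; rewrite ler_nat (leq_trans (ltnW sE)) // leq_pmull //; lia.
- rewrite ler_nat (leq_trans (leq_div _ _)) // (leq_trans (ltnW (ltn_ord j))) //.
  by rewrite (leq_trans nE) // leq_pmull //; lia.
- rewrite ler_nat size_polyXn szP; move: slE kE jd E0; clear.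
  by move: (size _) => s; move: (j %% d)%N => t; nia.
exists (euler_twist (sl M E) ('X^k * p_ j)).
  rewrite (@pairingE _ _ _ (k + n)); last first.
    apply/leq_sizeP => l kl; rewrite coef_euler_twist coefXnM.
    case: ltnP => [lk|_]; first by rewrite mulr0.
    by rewrite nth_default ?mulr0 // p_size (leq_trans (ltn_ord j)) // leq_subRL // (leq_trans _ kl) // leq_addr.
  rewrite big_split_ord /= [X in _ = X + _]big1 ?add0r => [|l _]; last first.
    by rewrite coef_euler_twist coefXnM ltn_ord mulr0 mul0r.
  apply: eq_bigr => l _; rewrite mxE coef_euler_twist coefXnM ltnNge leq_addr /= addKn.
  rewrite rmorphM sieve_horner rmorph_prod -/k.
  under eq_bigr => s _ do rewrite rmorphB !rmorph_nat.
  by rewrite mulrAC.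
move=> w wx wP.
have -> : 'X^k * p_ j = P ^+ (j %/ d) * Q by rewrite /p_ /Q exprD mulrCA.
rewrite tE hornerM horner_exp nmM nmX; apply: ler_pM; rewrite ?exprn_ge0 ?nm_ge0 //.
  by rewrite lerXn2r ?nnegrE ?nm_ge0 // ltW; case/andP: theta01.
apply: (le_trans (nm_horner_l1 _ wx)); apply: (le_trans Q'l); rewrite -GE.
have G0 : 0 <= G * N.
  by rewrite GE mulr_ge0 // !addr_ge0 ?mulr_ge0 ?addr_ge0 ?l1_ge0.
rewrite ler_wpM2l ?exprn_ge0 // l1Xn // ler_weXn2l ?(ltW x1) //.
by rewrite leq_add // ltnW.
Qed.

Let algint_det n (A : 'M[K]_n) : (forall i j, algebraic_integer (A i j)) -> algebraic_integer (\det A).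
Proof.
move=> A_int; apply: algint_sum => s _; apply: algint_mul.
  rewrite -signr_odd; case: (odd _); rewrite ?expr1 ?expr0.
    by apply: algint_opp; exact: (algint_nat K 1).
  exact: (algint_nat K 1).
exact: algint_prod.
Qed.

Let fact_le_exp n N : (n <= N)%N -> (n`! <= N ^ n)%N.
Proof.
elim: n => [|n IHn] // nN; rewrite factS expnS leq_mul // IHn //.
exact: ltnW.
Qed.

(** A nonzero minor, scaled to be integral, would contradict Liouville's inequality: the column
    operations gain [theta ^ Sg] at [iota], and all other factors in the bound amount to at most
    [exp (ep E n)]. *)
Let minor_vanish : exists E0, forall M E, (E0 <= E)%N -> (2 * M <= E)%N ->
  forall f : 'I_(window_size M E) -> 'I_(6 * window_size M E),
  \det (rowsub f (window_mx M E)) = 0.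
Proof.
have /andP[th0 th1] := theta01; have dR : 0 < d%:R :> R by rewrite ltr0n.
pose m := dim K; have m0 : (0 < m)%N := dim_field_gt0 K.
have mR : 0 < m%:R :> R by rewrite ltr0n.
pose kap := - ln theta; have kap0 : 0 < kap.
  by rewrite oppr_gt0 ln_lt0 // th0.
have thE : theta = expR (- kap) by rewrite opprK lnK.
(* The budget is [exp (ep E)] per column: half of it for the subexponential factors collected in
   [U], half for [m] factors [exp (e E)], one from each conjugate. *)
pose ep := kap / (112 * d%:R); have ep0 : 0 < ep by rewrite divr_gt0 // mulr_gt0.
pose e := ep / (2 * m%:R); have e0 : 0 < e by rewrite divr_gt0 // mulr_gt0.
have x1 : 1 < expR e by rewrite expR_gt1.
have [B B0 BP] := functional_bound x1.
have [c1 c1P] := a_growth e0; pose c := `|c1|.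
have c0 : 0 <= c by apply: normr_ge0.
have cP (tau : {rmorphism K -> C}) k : nm (tau (a k)) <= c * expR (e * k%:R).
  by rewrite (le_trans (c1P tau k)) // ler_wpM2r ?expR_ge0 ?ler_norm.
pose G := l1 (expR e) (P^`() * 'X) + 2 * (l1 (expR e) P + 1).
have xe0 : 0 <= expR e := expR_ge0 e.
have G2 : 2 <= G.
  have := l1_ge0 xe0 (P^`() * 'X); have := l1_ge0 xe0 P; rewrite /G; lra.
(* Each point of [S] costs at most [g0 E]: the factor [G (2 d + 4) E] from [euler_twist_power] and
   one lost power of [theta]. For [E >= g0] this is at most [E^2], whence the exponent 2 on [sc]. *)
pose g0 := G * (2 * d + 4)%:R / theta.
have g01 : 1 <= g0.
  rewrite /g0 ler_pdivlMr // mul1r (le_trans (ltW th1)) // mulr_ege1 ?ler1n ?addn4 //.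
  by apply: le_trans G2; rewrite ler1n.
pose D E : R := (lcm_den S a E)%:R.
pose sc E : R := E%:R ^+ scount S E.
have D0 E : 0 <= D E by [].
have sc0 E : 0 <= sc E by rewrite exprn_ge0.
pose U E := D E * (E%:R * ((B * expR (e * d%:R)) * sc E ^+ 2)) * (E%:R * (D E * (sc E * c))) ^+ m.-1.
have subU : subexp U.
  have Bx0 : 0 <= B * expR (e * d%:R) by rewrite mulr_ge0 ?expR_ge0.
  rewrite /U; apply: subexpM => [E|E||].
  - by rewrite !mulr_ge0 ?exprn_ge0.
  - by rewrite exprn_ge0 // !mulr_ge0.
  - apply: subexpM => // [E|]; first by rewrite !mulr_ge0 ?exprn_ge0.
    apply: subexpM => // [E||]; [by rewrite mulr_ge0 ?exprn_ge0|exact: subexp_id|].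
    apply: subexpM => // [E||]; [by rewrite exprn_ge0|exact: subexp_cst|exact: subexpX].
  - apply: subexpX => [E|]; first by rewrite !mulr_ge0.
    apply: subexpM => // [E||]; [by rewrite !mulr_ge0|exact: subexp_id|].
    apply: subexpM => // [E|]; first by rewrite mulr_ge0.
    by apply: subexpM => //; exact: subexp_cst.
have [n1 n1P] := subU (ep / 2) (divr_gt0 ep0 (ltr0n _ 2)).
exists (n1 + Num.bound g0 + 28 * (4 * d + 4))%N => M E EE ME f.
have EU : U E <= expR (ep / 2 * E%:R).
  by apply: n1P; rewrite (leq_trans _ EE) // -addnA leq_addr.
have Eg : g0 <= E%:R.
  rewrite (le_trans (ltW (archi_boundP _))) ?(le_trans ler01) // ler_nat.
  by rewrite (leq_trans _ EE) // addnAC leq_addl.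
set n := window_size M E in f *.
have [nE n0 n4 E0] := window_size_bounds (leq_trans (leq_addl _ _) EE) ME.
rewrite -/n in nE n0 n4.
have ER : 1 <= E%:R :> R by rewrite ler1n.
apply/eqP/negPn/negP => nz_det.
pose DK : K := (lcm_den S a E)%:R.
pose A := DK *: rowsub f (window_mx M E).
have detA : \det A = DK ^+ n * \det (rowsub f (window_mx M E)) by rewrite detZ.
have A_int : algebraic_integer (\det A).
  by apply: algint_det => i j; rewrite !mxE; have := entry_integral (f i) j; rewrite mxE.
have nzA : \det A != 0.
  by rewrite detA mulf_neq0 // expf_neq0 // numfield_natr_neq0 // lcm_den_gt0.
pose y := D E * (sc E * (c * expR (e * E%:R))).
have y0 : 0 <= y by rewrite !mulr_ge0 ?expR_ge0.
have tauA (tau : {rmorphism K -> C}) : `|tau (\det A)| <= ((E%:R * y) ^+ n)%:C%C.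
  rewrite nm_le -det_map_mx (le_trans (@nm_det_le _ _ _ (fun=> y) _)) //.
    move=> i j; rewrite !mxE rmorphM rmorph_nat nmM nm_nat /y ler_wpM2l //.
    by have := x_entry tau E0 c0 e0 cP (f i) j; rewrite mxE.
  rewrite prodr_const card_ord [leRHS]exprMn ler_wpM2r ?exprn_ge0 // -natrX ler_nat.
  exact: fact_le_exp.
pose X (j : 'I_n) := theta ^+ (j %/ d - size (sl M E)) *
        ((G * ((2 * d + 4) * E)%:R) ^+ size (sl M E) * expR e ^+ (E + d)).
pose X' := (sc E) ^+ 2 * (expR (e * d%:R) * expR (e * E%:R)).
have XX' j : X j <= theta ^+ (j %/ d) * X'.
  rewrite /X /X'; set s := size (sl M E).
  have -> : expR e ^+ (E + d) = expR (e * d%:R) * expR (e * E%:R).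
    by rewrite -expRM_natr -expRD natrD; congr expR; ring.
  rewrite !mulrA ler_wpM2r ?expR_ge0 // ler_wpM2r ?expR_ge0 //.
  have thjs : theta ^+ (j %/ d - s) <= theta ^+ (j %/ d) * theta^-1 ^+ s.
    have [sj|js] := leqP s (j %/ d).
      rewrite -{2}(subnK sj) exprD -mulrA -exprMn divff ?gt_eqF // expr1n mulr1 //.
    rewrite (_ : j %/ d - s = 0)%N; last by apply/eqP; rewrite subn_eq0 ltnW.
    rewrite expr0 exprVn ler_pdivlMr ?exprn_gt0 // mul1r ler_wiXn2l ?(ltW th0) ?(ltW th1) //.
    exact: ltnW.
  apply: (@le_trans _ _ (theta ^+ (j %/ d) * theta^-1 ^+ s * (G * ((2 * d + 4) * E)%:R) ^+ s)).
    by rewrite ler_wpM2r // exprn_ge0 // mulr_ge0 // (le_trans _ G2).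
  rewrite -[leLHS]mulrA -[leRHS]mulrA -expr2 ler_wpM2l ?exprn_ge0 ?(ltW th0) // -exprMn.
  have -> : theta^-1 * (G * ((2 * d + 4) * E)%:R) = g0 * E%:R.
    by rewrite /g0 natrM; ring.
  have gE1 : 1 <= g0 * E%:R by rewrite mulr_ege1.
  apply: (@le_trans _ _ ((g0 * E%:R) ^+ scount S E)).
    by rewrite ler_weXn2l // size_sl.
  rewrite /sc -exprM mulnC exprM lerXn2r ?nnegrE ?exprn_ge0 ?(le_trans ler01 gE1) //.
  by rewrite expr2 ler_wpM2r.
have X'0 : 0 <= X' by rewrite !mulr_ge0 ?expR_ge0 ?exprn_ge0.
pose Sg := (\sum_(j < n) j %/ d)%N.
have iotaA : nm (iota (\det A)) <= (D E * (E%:R * (B * X'))) ^+ n * theta ^+ Sg.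
  rewrite detA rmorphM rmorphXn rmorph_nat nmM nmX nm_nat -/(D E).
  rewrite -det_map_mx (det_monic_columns _ p_monic p_size).
  have entry (i j : 'I_n) : nm (\sum_(l < n) map_mx iota (rowsub f (window_mx M E)) i l * (p_ j)`_l)
      <= B * (theta ^+ (j %/ d) * X').
    have [tw twE tw_bd] := twisted_entry x1 E0 n0 (erefl G) (f i) j.
    have -> : \sum_(l < n) map_mx iota (rowsub f (window_mx M E)) i l * (p_ j)`_l = pairing (iota \o a) tw.
      by rewrite -twE; apply: eq_bigr => l _; rewrite !mxE.
    apply: (@le_trans _ _ (B * X j)); last by rewrite ler_wpM2l ?XX'.
    apply: BP => [|w wx wP]; last exact: tw_bd.
    by rewrite !mulr_ge0 ?exprn_ge0 ?(ltW th0) // mulr_ge0 // (le_trans _ G2).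
  rewrite exprMn -mulrA ler_wpM2l ?exprn_ge0 //.
  apply: (le_trans (@nm_det_le _ _ _ (fun j : 'I_n => B * (theta ^+ (j %/ d) * X')) _)).
    by move=> i j; rewrite mxE entry.
  rewrite big_split prodr_const card_ord big_split prodr_const card_ord /= prodrXr -/Sg.
  rewrite expr_shuffle ler_wpM2r ?mulr_ge0 ?exprn_ge0 ?(ltW th0) //.
  by rewrite -natrX ler_nat fact_le_exp.
have lower : 1 <= nm (iota (\det A)) * ((E%:R * y) ^+ n) ^+ m.-1.
  have := embedding_norm_lower_bound iota A_int nzA tauA.
  by rewrite nmE -rmorphXn -rmorphM -[1]/(1%:C%C) lecR.
have Zle : D E * (E%:R * (B * X')) * (E%:R * y) ^+ m.-1 <= expR (ep * E%:R).
  have -> : D E * (E%:R * (B * X')) * (E%:R * y) ^+ m.-1 = U E * expR (e * E%:R) ^+ m.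
    rewrite [X in _ = _ * X](_ : _ = expR (e * E%:R) ^+ m.-1.+1); last by rewrite prednK.
    exact: sizes_shuffle.
  have -> : ep * E%:R = ep / 2 * E%:R + e * E%:R * m%:R.
    by rewrite /e; field; rewrite gt_eqF.
  by rewrite expRD [X in _ <= _ * X]expRM_natr ler_wpM2r // exprn_ge0 ?expR_ge0.
have : 1 <= expR (ep * E%:R) ^+ n * theta ^+ Sg.
  apply: le_trans lower _.
  apply: (@le_trans _ _ ((D E * (E%:R * (B * X'))) ^+ n * theta ^+ Sg * ((E%:R * y) ^+ n) ^+ m.-1)).
    by rewrite ler_wpM2r // exprn_ge0 // exprn_ge0 // mulr_ge0.
  rewrite mulrAC ler_wpM2r ?exprn_ge0 ?(ltW th0) // -exprM mulnC exprM -exprMn.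
  rewrite lerXn2r ?nnegrE ?expR_ge0 //.
  by rewrite !mulr_ge0 ?exprn_ge0 // mulr_ge0.
rewrite thE -!expRM_natr -expRD -[leLHS]expR0 ler_expR.
have sg := sum_divn_lower n d0; rewrite -/Sg in sg.
have sgR : n%:R * n%:R <= 2 * d%:R * Sg%:R + (2 * d%:R + 1) * n%:R :> R.
  by move: sg; rewrite -(ler_nat R) !(natrD, natrM).
have nER : E%:R <= 28 * n%:R :> R by rewrite -natrM ler_nat.
have n4R : 4 * d%:R + 2 < n%:R :> R by rewrite -natrM -natrD ltr_nat.
have kapE : kap = 112 * d%:R * ep by rewrite /ep; field; rewrite gt_eqF.
exact: exponent_negative dR ep0 nER n4R sgR kapE.
Qed.

(** All maximal minors vanish, so the rank is less than [n]; the coordinates of a relation among the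
    columns are the coefficients of [Q]. *)
Theorem window_relation_ub : exists E0, forall M E, (E0 <= E)%N -> (2 * M <= E)%N ->
  window_relation S a M E.
Proof.
have [E0 E0P] := minor_vanish; exists E0 => M E EE ME.
set n := window_size M E.
have [full|] := boolP (row_full (window_mx M E)).
  have := fullrowsub_unit full; rewrite unitmxE unitfE.
  by rewrite (E0P M E EE ME (fullrankfun full)) eqxx.
rewrite -col_leq_rank -ltnNge -mxrank_tr => rk.
have : kermx (window_mx M E)^T != 0 by rewrite kermx_eq0 /row_free ltn_eqF.
case/rowV0Pn => v /sub_kermxP vW nzv.
exists (\poly_(j < n) (if insub j is Some j' then v 0 j' else 0)).
have vE (j : 'I_n) : (\poly_(j < n) (if insub j is Some j' then v 0 j' else 0))`_j = v 0 j.
  by rewrite coef_poly ltn_ord valK.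
split; [|exact: size_poly|move=> k /andP[Mk kM]].
  by apply: contraNneq nzv => p0; apply/eqP/rowP => j; rewrite -vE p0 coef0 mxE.
have ki : (k - M < 6 * window_size M E)%N by rewrite ltn_subLR.
rewrite (@actE _ n) ?size_poly //.
have := congr1 (fun A : 'rV_ _ => A 0 (Ordinal ki)) vW; rewrite !mxE => v0; rewrite -[RHS]v0.
by apply: eq_bigr => j _; rewrite vE !mxE /= subnKC.
Qed.

End WindowRelation.

(** * Analytic input *)

Section Convergence.
Variable C : numClosedFieldType.
Implicit Types (u : nat -> C) (l z : C).

Lemma cvgnP u l : (u @ \oo --> l)%classic <->
  forall e : C, 0 < e -> exists N, forall n, (N <= n)%N -> `|l - u n| <= e.
Proof.
split=> [/cvgrPdist_le ul e e0|ul].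
  by have [N _ NP] := ul e e0; exists N => n Nn; apply: NP.
by apply/cvgrPdist_le => e e0; have [N NP] := ul e e0; exists N.
Qed.

Lemma power_series_at_bound c z0 g : power_series_at c z0 g <->
  exists2 d : C, 0 < d & forall z, `|z - z0| < d -> forall e : C, 0 < e ->
    exists N, forall n, (N <= n)%N -> `|g z - cpseries c (z - z0) n| <= e.
Proof.
split=> [/nbhs_ballP[d /= d0 dP]|[d d0 dP]].
  exists d => // z zd; apply/cvgnP; apply: dP.
  by rewrite -ball_normE /= distrC.
apply/nbhs_ballP; exists d => // z; rewrite -ball_normE /= distrC => zd.
exact/cvgnP/dP.
Qed.

Lemma cpsum_bound c z : cvgn (cpseries c z) -> forall e : C, 0 < e ->
  exists N, forall n, (N <= n)%N -> `|cpsum c z - cpseries c z n| <= e.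
Proof. by move=> cz; apply/cvgnP. Qed.

Lemma continues_at_bound c zeta : continues_at c zeta -> exists (g : C -> C) t (d : C),
  [/\ 0 < d, power_series_at t zeta g &
   forall z, `|z - zeta| < d -> `|z| < 1 -> g z = cpsum c z].
Proof.
move=> [U [g [[oU Uz] gU gc]]]; have [t tP] := gU _ Uz.
have /nbhs_ballP[d /= d0 dP] : nbhs zeta U by apply: open_nbhs_nbhs.
exists g, t, d; split=> // z zd z1; apply: gc => //; apply: dP.
by rewrite -ball_normE /= distrC.
Qed.

End Convergence.

Section Bridge.
Variable R : realType.
Notation C := R[i].
Implicit Types (u c : nat -> C) (l z : C).

Definition tends u l := forall e : R, 0 < e ->
  exists N, forall n, (N <= n)%N -> nm (l - u n) <= e.

Lemma pos_real (e : C) : 0 < e -> exists2 x : R, 0 < x & e = x%:C%C.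
Proof.
move=> e0; have er : e \is Num.real by rewrite gtr0_real.
by exists (complex.Re e); rewrite ?RRe_real // -ltcR RRe_real.
Qed.

Definition psum c z n := \sum_(k < n) c k * z ^+ k.

Lemma cpseriesE c z n : cpseries c z n = psum c z n.
Proof. by rewrite /cpseries /series /= big_mkord. Qed.

Lemma tendsP c z l : (forall e : C, 0 < e -> exists N, forall n, (N <= n)%N ->
    `|l - cpseries c z n| <= e) <-> tends (psum c z) l.
Proof.
split=> [ul e e0|ul _ /pos_real[e e0 ->]].
  have /ul[N NP] : 0 < e%:C%C by rewrite ltcR.
  by exists N => n /NP; rewrite cpseriesE nm_le.
have [N NP] := ul e e0.
by exists N => n /NP; rewrite cpseriesE nm_le.
Qed.

Lemma cpsum_tends c z : cvgn (cpseries c z) -> tends (psum c z) (cpsum c z).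
Proof. by move=> cz; apply/tendsP; apply: cpsum_bound. Qed.

Lemma power_series_atP c z0 g : power_series_at c z0 g <->
  exists2 d : R, 0 < d & forall z, nm (z - z0) < d -> tends (psum c (z - z0)) (g z).
Proof.
split=> [/power_series_at_bound[_ /pos_real[d d0 ->] dP]|[d d0 dP]].
  by exists d => // z; rewrite -nm_lt => /dP /tendsP.
apply/power_series_at_bound; exists d%:C%C; rewrite ?ltcR // => z; rewrite nm_lt => /dP.
by move/tendsP.
Qed.

Lemma tends_terms_bounded c z l : tends (psum c z) l ->
  exists2 B : R, 0 <= B & forall k, nm (c k * z ^+ k) <= B.
Proof.
move=> /(_ 1 ltr01)[N NP].
pose B0 : R := \sum_(k < N) nm (c k * z ^+ k).
have B00 : 0 <= B0 by rewrite sumr_ge0 // => k _; apply: nm_ge0.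
exists (B0 + 2) => [|k]; first by rewrite addr_ge0.
have [kN|Nk] := ltnP k N.
  rewrite /B0 (bigD1 (Ordinal kN)) //= -addrA lerDl addr_ge0 // sumr_ge0 // => j _; exact: nm_ge0.
have := NP _ (leqW Nk); have := NP _ Nk; rewrite /psum big_ord_recr /=.
set s := \sum_(_ < k) _; set t := c k * _ => h1 h2.
have -> : t = (l - s) - (l - (s + t)) by ring.
rewrite (le_trans (nmB _ _)) //; lra.
Qed.

(** The terms of the convergent series at [z = exp (- e)] are bounded. *)
Lemma disc_growth c : converges_on_unit_disc (c : nat -> (C : numClosedFieldType)) ->
  forall e : R, 0 < e -> exists B, forall k, nm (c k) <= B * expR (e * k%:R).
Proof.
move=> cvg_c e e0; pose z : C := (expR (- e))%:C%C.
have nz : nm z = expR (- e) by rewrite nm_real ger0_norm ?expR_ge0.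
have z1 : `|z| < 1 by rewrite -[1]/(1%:C%C) nm_lt nz expR_lt1 oppr_lt0.
have [B B0 BP] := tends_terms_bounded (cpsum_tends (cvg_c z z1)).
exists B => k; have := BP k; rewrite nmM nmX nz -expRM_natr mulNr expRN.
by rewrite ler_pdivrMr ?expR_gt0.
Qed.

End Bridge.

Lemma disc_growth_embeddings (R : realType) (K : fieldExtType rat)
    (iota : {rmorphism K -> R[i]}) (a : nat -> K) :
  (forall sigma : {rmorphism K -> R[i]}, converges_on_unit_disc (sigma \o a)) -> growth R a.
Proof.
by move=> a_cvg; apply: (uniform_growth iota) => sigma e e0; exact: (disc_growth (a_cvg sigma) e0).
Qed.

(** * The hypotheses on the exceptional set and the denominators *)

Section ExceptionalSet.
Variables (R : realType) (S : set nat).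
Hypothesis S_pos : forall n, S n -> (0 < n)%N.
Hypothesis S_sparse : ((fun n : nat => (\sum_(1 <= k < n.+1 | k \in S) 1)%N%:R : R)
        =o_\oo (fun n : nat => n%:R / ln (n%:R : R)))%classic.

Definition in_S : pred nat := fun k => k \in S.

Lemma scount_small (e : R) : 0 < e -> exists n0, forall n, (n0 <= n)%N ->
  (scount in_S n)%:R * ln n%:R <= e * n%:R.
Proof.
move=> e0; have /eqoP/(_ e e0)[N _ NP] := S_sparse.
exists (maxn N 2) => n; rewrite geq_max => /andP[Nn n2].
have ln0 : 0 < ln n%:R :> R by rewrite ln_gt0 // ltr1n.
have := NP n Nn; rewrite /= ger0_norm // ger0_norm; last by rewrite divr_ge0 // ltW.
rewrite mulrA ler_pdivlMr // => h; apply: le_trans h; rewrite ler_wpM2r ?(ltW ln0) // ler_nat.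
rewrite /scount (@big_cat_nat _ _ _ 1) //=; last exact: ltnW.
rewrite big_nat1 [X in (X + _)%N](_ : _ = 0%N); last first.
  by rewrite /in_S; case: (boolP (0%N \in S)) => //; rewrite inE => /S_pos.
rewrite add0n [leqRHS]big_mkcond big_nat_recr ?(ltnW n2) //=; apply: leq_trans (leq_addr _ _).
by apply: leq_sum => k _; rewrite /in_S; case: ifP.
Qed.

Lemma in_S_sparse : sparse R in_S.
Proof.
move=> e e0; have [n0 n0P] := scount_small e0; exists (maxn n0 (Num.bound (expR 1 : R))) => n.
rewrite geq_max => /andP[/n0P h n3]; apply: le_trans h; rewrite ler_peMr //.
have n1 : expR 1 <= n%:R :> R.
  by rewrite (le_trans (ltW (archi_boundP _))) ?expR_ge0 // ler_nat.
by rewrite -[leLHS](@expRK R) ler_ln // posrE ?expR_gt0 // (lt_le_trans (expR_gt0 _) n1).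
Qed.

(** [n ^ |S cap [0, n)|] is the exponential of [|S cap [0, n)| log n]: here [o(n / log n)] enters
    with its logarithm. *)
Lemma in_S_log : subexp (fun n => n%:R ^+ scount in_S n : R).
Proof.
move=> e e0; have [n0 n0P] := scount_small e0; exists (maxn n0 1) => n.
rewrite geq_max => /andP[/n0P h n1].
have nR : 0 < n%:R :> R by rewrite ltr0n.
by rewrite -{1}(lnK nR) -expRM_natr ler_expR mulrC.
Qed.

Lemma lcm_den_subexp (K : fieldExtType rat) (a : nat -> K) :
  (forall beta : R, 1 < beta -> \forall n \near \oo,
    (\big[lcmn/1%N]_(0 <= k < n.+1 | k \notin S) den (a k))%:R < beta ^+ n)%classic ->
  subexp (fun n => (lcm_den in_S a n)%:R : R).
Proof.
move=> a_den e e0; have [|N _ NP] := a_den (expR e); first by rewrite expR_gt1.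
exists N => n /NP /= h; rewrite ltW // mulrC expRM_natl.
exact: h.
Qed.

End ExceptionalSet.

(** * Generating functions of recurrent sequences *)

Section Rational.
Variable R : realType.
Notation C := R[i].
Variables (Q : {poly C}) (u : nat -> C) (N : nat).
Hypothesis nzQ : Q != 0.
Hypothesis Qu : forall k, (N <= k)%N -> act Q u k = 0.
Hypothesis Q_roots : forall x, root Q x -> exists2 m, (0 < m)%N & x ^+ m = 1.

Let r := (size Q).-1.
Let szQ : size Q = r.+1. Proof. by rewrite prednK // size_poly_gt0. Qed.
Let lead0 : Q`_r != 0. Proof. by rewrite -[Q`_r]/(lead_coef Q) lead_coef_eq0. Qed.

Let recurrence k : (N + r <= k)%N -> u k = - \sum_(j < r) Q`_j / Q`_r * u (k - r + j)%N.
Proof.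
move=> Nk; have rk : (r <= k)%N by apply: leq_trans Nk; apply: leq_addl.
have := @Qu (k - r) _; rewrite leq_subRL // addnC => /(_ Nk).
rewrite (@actE _ r.+1) ?szQ // big_ord_recr /= subnK // => /eqP.
rewrite addrC addr_eq0 => /eqP h.
rewrite -[u k](mulKf lead0) h mulrN mulr_sumr; congr (- _).
by apply: eq_bigr => j _; rewrite mulrA [_^-1 * _]mulrC.
Qed.

Lemma recurrence_growth : exists2 B : R, 0 <= B & exists2 beta : R, 1 <= beta &
  forall k, nm (u k) <= B * beta ^+ k.
Proof.
pose A : R := \sum_(j < r) nm (Q`_j / Q`_r).
have A0 : 0 <= A by rewrite sumr_ge0 // => j _; apply: nm_ge0.
pose B : R := \sum_(k < N + r) nm (u k).
have B0 : 0 <= B by rewrite sumr_ge0 // => j _; apply: nm_ge0.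
have b1 : 1 <= 1 + A by rewrite lerDl.
exists B => //; exists (1 + A) => //; elim/ltn_ind => k IHk.
have [kN|Nk] := ltnP k (N + r).
  apply: (@le_trans _ _ B); last by rewrite ler_peMr // exprn_ege1.
  rewrite /B (bigD1 (Ordinal kN)) //= lerDl sumr_ge0 // => j _; exact: nm_ge0.
rewrite recurrence // nmN (le_trans (nm_sum _ _ _)) //.
have rk : (r <= k)%N by apply: leq_trans Nk; apply: leq_addl.
apply: (@le_trans _ _ (\sum_(j < r) nm (Q`_j / Q`_r) * (B * (1 + A) ^+ k.-1))).
  apply: ler_sum => j _; rewrite nmM ler_wpM2l ?nm_ge0 //.
  have jk : (k - r + j < k)%N by rewrite -[ltnRHS](subnK rk) ltn_add2l.
  rewrite (le_trans (IHk _ jk)) // ler_wpM2l // ler_weXn2l //.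
  by rewrite -ltnS prednK // (leq_ltn_trans _ jk).
rewrite -mulr_suml mulrCA ler_wpM2l //.
case: k {IHk Nk} rk => [|k] rk; last by rewrite exprS /= ler_wpM2r ?exprn_ge0 ?(le_trans ler01) // lerDr.
rewrite /A; move: rk; rewrite leqn0 => /eqP ->.
by rewrite big_ord0 mul0r expr0.
Qed.

(** Reciprocal polynomial of [Q], the denominator of the generating function; its roots are inverses
    of roots of [Q]. *)
Let Qs : {poly C} := \poly_(i < r.+1) Q`_(r - i).

Let Qs_coef i : (i <= r)%N -> Qs`_i = Q`_(r - i).
Proof. by rewrite coef_poly ltnS => ->. Qed.

Let Qs_root y : root Qs y -> exists2 m, (0 < m)%N & y ^+ m = 1.
Proof.
move=> rt; have nzy : y != 0.
  apply: contraNneq lead0 => y0; move: rt; rewrite y0 rootE horner_coef0.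
  by rewrite Qs_coef // subn0.
have [|m m0 ym] := @Q_roots y^-1; last first.
  by exists m => //; apply: invr_inj; rewrite -exprVn ym invr1.
move: rt; rewrite /root horner_poly => /eqP yQ.
rewrite horner_coef szQ; apply/eqP; apply: (mulfI (expf_neq0 r nzy)); rewrite mulr0 mulr_sumr.
rewrite -[RHS]yQ (reindex_inj rev_ord_inj) /=; apply: eq_bigr => i _; rewrite subSS.
have ir : (i <= r)%N by rewrite -ltnS.
rewrite mulrCA; congr (_ * _); rewrite -{1}(subnK ir) [(_ - _ + _)%N]addnC exprD exprVn mulfK //.
exact: expf_neq0.
Qed.

Let nm_root_unity (y : C) m : (0 < m)%N -> y ^+ m = 1 -> nm y = 1.
Proof.
move=> m0 ym; have : nm y ^+ m = 1 by rewrite -nmX ym nm1.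
by move/eqP; rewrite pexpr_eq1 ?nm_ge0 // => /eqP.
Qed.

Let Qs_neq0 z : nm z < 1 -> Qs.[z] != 0.
Proof.
move=> z1; apply: contraTneq z1 => /eqP/Qs_root[m m0 /nm_root_unity ->] //.
by rewrite ltxx.
Qed.

(** Coefficients of the product of [Qs] with the generating function. From [N + r] on they are
    values of [act Q u] and vanish, which leaves the polynomial numerator [Ps]. *)
Let pc k := \sum_(i < r.+1 | (i <= k)%N) Qs`_i * u (k - i)%N.
Let Ps : {poly C} := \poly_(k < N + r) pc k.
Let U n : {poly C} := \poly_(k < n) u k.

Let pc0 k : (N + r <= k)%N -> pc k = 0.
Proof.
move=> Nk; have rk : (r <= k)%N by apply: leq_trans Nk; apply: leq_addl.
rewrite -[RHS](@Qu (k - r)); last by rewrite leq_subRL // addnC.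
rewrite /pc (@actE _ r.+1) ?szQ // [LHS](reindex_inj rev_ord_inj) /=.
apply: eq_big => [i|i _]; rewrite subSS.
  by rewrite (leq_trans _ rk) // leq_subr.
have ir : (i <= r)%N by rewrite -ltnS.
by rewrite Qs_coef ?leq_subr // subKn // subnA.
Qed.

Let prod_coef n k : (U n * Qs)`_k = \sum_(i < r.+1 | (i <= k)%N && (k - i < n)%N) Qs`_i * u (k - i)%N.
Proof.
rewrite mulrC coefM.
rewrite (@big_ord_widen _ _ _ k.+1 (maxn k.+1 r.+1) (fun i => Qs`_i * (U n)`_(k - i))) ?leq_maxl //.
rewrite (@big_ord_widen_cond _ _ _ r.+1 (maxn k.+1 r.+1) (fun i => (i <= k)%N && (k - i < n)%N)
  (fun i => Qs`_i * u (k - i)%N)) ?leq_maxr //.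
rewrite big_mkcond [RHS]big_mkcond; apply: eq_bigr => i _ /=; rewrite ltnS.
rewrite !coef_poly ltnS.
by case: (leqP i k) => ik; case: (leqP i r) => ir; case: (ltnP (k - i) n) => kn; rewrite /= ?mulr0 ?mul0r.
Qed.

(** [U n * Qs] and [Ps] agree below degree [n]; the difference lives in degrees [[n, n + r)], and
    the crude growth rate [beta] makes it small near 0. *)
Lemma tail_bound : exists2 B : R, 0 <= B & exists2 beta : R, 1 <= beta &
  forall n z, (N + r <= n)%N -> nm z <= beta^-1 ->
  nm ((U n).[z] * Qs.[z] - Ps.[z]) <= B * (beta * nm z) ^+ n.
Proof.
have [B B0 [beta b1 uB]] := recurrence_growth.
have b0 : 0 < beta by apply: lt_le_trans b1.
pose A : R := \sum_(i < r.+1) nm Qs`_i.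
have A0 : 0 <= A by rewrite sumr_ge0 // => j _; apply: nm_ge0.
exists (r%:R * (A * B)); first by rewrite !mulr_ge0.
exists beta => // n z Nn zb; rewrite -hornerM -hornerN -hornerD.
have x01 : 0 <= beta * nm z <= 1.
  by rewrite mulr_ge0 ?nm_ge0 ?(ltW b0) //= -ler_pdivlMl // mulr1.
have low k : (k < n)%N -> (U n * Qs - Ps)`_k = 0.
  move=> kn; rewrite coefB prod_coef coef_poly.
  have -> : \sum_(i < r.+1 | (i <= k)%N && (k - i < n)%N) Qs`_i * u (k - i)%N = pc k.
    by apply: eq_bigl => i; rewrite (leq_ltn_trans (leq_subr _ _) kn) andbT.
  by case: ltnP => [_|/pc0 ->]; rewrite subrr.
have high k : (n <= k)%N -> nm (U n * Qs - Ps)`_k <= A * B * beta ^+ k.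
  move=> nk; rewrite coefB [Ps`_k]coef_poly ltnNge (leq_trans Nn nk) subr0 prod_coef.
  rewrite (le_trans (nm_sum _ _ _)) // -mulrA mulr_suml big_mkcond /=.
  apply: ler_sum => i _; case: ifP => _; last by rewrite !mulr_ge0 ?nm_ge0 ?exprn_ge0 ?(ltW b0).
  rewrite nmM ler_wpM2l ?nm_ge0 // (le_trans (uB _)) // ler_wpM2l // ler_weXn2l //.
  exact: leq_subr.
have sz : (size (U n * Qs - Ps)%R <= n + r)%N.
  rewrite (leq_trans (size_polyD _ _)) // size_polyN geq_max; apply/andP; split.
    rewrite (leq_trans (size_polyMleq _ _)) //.
    have := size_poly n u; have := size_poly r.+1 (fun i => Q`_(r - i)); rewrite -/Qs -/(U n).
    by case: (size Qs) => [|s]; case: (size (U n)) => [|t] //=; lia.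
  by rewrite (leq_trans (size_poly _ _)) // (leq_trans Nn) // leq_addr.
rewrite (horner_coef_wide _ sz) big_split_ord /= [X in nm (X + _)]big1 ?add0r; last first.
  by move=> i _; rewrite low ?mul0r.
rewrite (le_trans (nm_sum _ _ _)) //.
have -> : r%:R * (A * B) * (beta * nm z) ^+ n = \sum_(i < r) (A * B * (beta * nm z) ^+ n).
  by rewrite sumr_const card_ord -mulrA mulr_natl.
apply: ler_sum => i _; rewrite nmM nmX.
apply: (@le_trans _ _ (A * B * beta ^+ (n + i) * nm z ^+ (n + i))).
  by rewrite ler_wpM2r ?exprn_ge0 ?nm_ge0 // high // leq_addr.
rewrite -mulrA -exprMn ler_wpM2l ?mulr_ge0 //; case/andP: x01 => x0 x1.
by rewrite ler_wiXn2l // leq_addr.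
Qed.

Lemma rational_of_recurrence : rational_with_root_of_unity_poles (u : nat -> (C : numClosedFieldType)).
Proof.
have nzQs : Qs != 0.
  apply: contraNneq lead0 => Q0; have := Qs_coef (leq0n r).
  by rewrite subn0 Q0 coef0 => <-.
pose G := gcdp Ps Qs.
have GP : Ps = Ps %/ G * G by rewrite divpK // dvdp_gcdl.
have GQ : Qs = Qs %/ G * G by rewrite divpK // dvdp_gcdr.
exists (Ps %/ G), (Qs %/ G); split.
- by rewrite coprimep_div_gcd // nzQs orbT.
- move=> x rx; have [|m m0 xm] := @Qs_root x; first by rewrite GQ rootM rx.
  by exists m => //; rewrite unity_rootE xm.
have [B B0 [beta b1 tail]] := tail_bound.
have b0 : 0 < beta by apply: lt_le_trans b1.
apply/power_series_atP; exists (beta^-1 / 2) => [|z]; first by rewrite divr_gt0 // invr_gt0.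
rewrite subr0 => zb.
have zb' : nm z <= beta^-1.
  by rewrite (le_trans (ltW zb)) // ler_pdivrMr // ler_peMr ?invr_ge0 ?(ltW b0) // ler1n.
have z1 : nm z < 1.
  rewrite (lt_le_trans zb) // ler_pdivrMr // (@le_trans _ _ 1) ?mul1r ?ler1n //.
  by rewrite invf_le1.
have Qz := Qs_neq0 z1; pose q := nm Qs.[z].
have q0 : 0 < q by rewrite lt_neqAle nm_ge0 andbT eq_sym nm_eq0.
have -> : (Ps %/ G).[z] / (Qs %/ G).[z] = Ps.[z] / Qs.[z].
  have hP : Ps.[z] = (Ps %/ G).[z] * G.[z] by rewrite -hornerM -GP.
  have hQ : Qs.[z] = (Qs %/ G).[z] * G.[z] by rewrite -hornerM -GQ.
  move: Qz; rewrite hP hQ mulf_eq0 negb_or => /andP[h1 h2].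
  by field; rewrite h2 h1.
move=> e e0.
have [n nP] : exists n, (beta * nm z) ^+ n <= e * q / (B + 1).
  apply: exists_expr_le; last by rewrite !divr_gt0 ?mulr_gt0 // ltr_wpDl.
  rewrite mulr_ge0 ?nm_ge0 ?(ltW b0) //= -ltr_pdivlMl // mulr1 (lt_le_trans zb) //.
  by rewrite ler_pdivrMr // ler_peMr ?invr_ge0 ?(ltW b0) // ler1n.
exists (maxn n (N + r)) => k; rewrite geq_max => /andP[nk Nk].
have -> : psum u z k = (U k).[z] by rewrite horner_poly.
have -> : Ps.[z] / Qs.[z] - (U k).[z] = - (((U k).[z] * Qs.[z] - Ps.[z]) / Qs.[z]).
  by field.
rewrite nmN nmM nmV -/q ler_pdivrMr // (le_trans (tail k z Nk zb')) //.
have kP : (beta * nm z) ^+ k <= e * q / (B + 1).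
  apply: le_trans nP; apply: ler_wiXn2l => //; first by rewrite mulr_ge0 ?nm_ge0 // ltW.
  by rewrite -ler_pdivlMl // mulr1.
apply: (@le_trans _ _ (B * (e * q / (B + 1)))); first by rewrite ler_wpM2l.
rewrite mulrCA ler_piMr ?mulr_ge0 ?(ltW e0) ?(ltW q0) //.
by rewrite ler_pdivrMr ?ltr_wpDl // mul1r lerDl.
Qed.

End Rational.

(** * From a continuation to the functional bound *)

Section GeometricTail.
Variable R : realType.
Notation C := R[i].

Lemma tends_tail (t : nat -> C) w l (B q : R) n : 0 <= B -> 0 <= q < 1 ->
    (forall k, nm (t k * w ^+ k) <= B * q ^+ k) -> tends (psum t w) l ->
  nm (l - psum t w n) <= B * q ^+ n / (1 - q).
Proof.
move=> B0 /andP[q0 q1] tB tl; have q1' : 0 < 1 - q by rewrite subr_gt0.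
have tail m : nm (psum t w (n + m) - psum t w n) <= B * q ^+ n / (1 - q) * (1 - q ^+ m).
  elim: m => [|m IHm]; first by rewrite addn0 subrr nm0 expr0 subrr mulr0.
  rewrite addnS {1}/psum big_ord_recr /= -/(psum t w _) addrAC (le_trans (nmD _ _)) //.
  rewrite (le_trans (lerD IHm (tB _))) // exprD exprS le_eqVlt; apply/orP; left; apply/eqP.
  by move: (q ^+ n) (q ^+ m) => x y; field; rewrite gt_eqF.
apply/ler_addgt0Pr => e e0; have [N NP] := tl e e0.
have h := NP _ (leq_addl n N); rewrite -(subrKA (psum t w (n + N))).
rewrite (le_trans (nmD _ _)) // [leRHS]addrC lerD // (le_trans (tail N)) // ler_piMr //.
  by rewrite divr_ge0 ?mulr_ge0 ?exprn_ge0 // ltW.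
by rewrite lerBlDr lerDl exprn_ge0.
Qed.

Lemma exists_small_tail (B q e : R) : 0 <= B -> 0 <= q < 1 -> 0 < e ->
  exists n, forall m, (n <= m)%N -> B * q ^+ m / (1 - q) <= e.
Proof.
move=> B0 q01 e0; have /andP[q0 q1] := q01; have q1' : 0 < 1 - q by rewrite subr_gt0.
have [|n nP] := @exists_expr_le _ q (e * (1 - q) / (B + 1)) q01.
  by rewrite divr_gt0 ?mulr_gt0 // ltr_wpDl.
exists n => m nm; have : q ^+ m <= e * (1 - q) / (B + 1).
  by apply: le_trans nP; apply: ler_wiXn2l => //; apply: ltW.
rewrite ler_pdivrMr // ler_pdivlMr ?ltr_wpDl // => h.
by apply: le_trans h; rewrite mulrC ler_wpM2l ?exprn_ge0 // lerDl.
Qed.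

End GeometricTail.

Section Rotation.
Variable R : realType.
Notation C := R[i].

Definition rotate (x : C) (p : {poly C}) : {poly C} := \poly_(j < size p) (p`_j * x ^+ j).

Lemma horner_rotate x p w : (rotate x p).[w] = p.[x * w].
Proof.
rewrite horner_poly horner_coef; apply: eq_bigr => j _.
by rewrite exprMn mulrA.
Qed.

Lemma pairing_rotate (c : nat -> C) x p : x != 0 ->
  pairing (fun k => c k * x ^+ k) (rotate x^-1 p) = pairing c p.
Proof.
move=> nzx; rewrite (@pairingE _ _ _ (size p)) ?size_poly //; apply: eq_bigr => j _.
by rewrite coef_poly ltn_ord exprVn mulrACA mulVf ?expf_neq0 // mulr1.
Qed.

End Rotation.

Section FunctionalBound.
Variable R : realType.
Notation C := R[i].

Lemma exists_gamma (rho : R) : 0 < rho -> rho <= 1 / 2 -> exists m,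
  [/\ (8 <= m)%N, ~~ odd m, 1 - rho ^+ 2 / 8 <= cos (pi *+ 2 / m%:R) &
      -1 <= cos (pi *+ 2 / m%:R : R) < 1].
Proof.
move=> rho0 rho2; pose m := (2 * (Num.bound (4 * pi / rho) + 4))%N.
have m8 : (8 <= m)%N by rewrite /m mulnDr leq_addl.
have mR : 0 < m%:R :> R by rewrite ltr0n (leq_trans _ m8).
set t : R := pi *+ 2 / m%:R; have p0 := pi_gt0 R.
have t0 : 0 < t by rewrite divr_gt0 // pmulrn_lgt0.
have t2 : t <= rho / 2.
  rewrite ler_pdivrMr // mulrC -ler_pdivrMr ?divr_gt0 //.
  have -> : pi *+ 2 / (rho / 2) = 4 * pi / rho by rewrite -mulr_natl; field; rewrite gt_eqF.
  rewrite (le_trans (ltW (archi_boundP _))) ?divr_ge0 ?mulr_ge0 ?(ltW p0) ?(ltW rho0) // ler_nat /m.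
  by rewrite mulnDr (leq_trans _ (leq_addr _ _)) // leq_pmull.
exists m; split => //; first by rewrite oddM.
  have t01 : 0 <= t <= 1 by rewrite (ltW t0) /=; lra.
  apply: le_trans (cos_lower t01); rewrite lerD2l lerN2.
  have : t ^+ 2 <= (rho / 2) ^+ 2 by rewrite lerXn2r ?nnegrE ?(ltW t0) // divr_ge0 // ltW.
  by rewrite exprMn; lra.
have := one_sub_cos t; rewrite -/t; have st : 0 < sin (t / 2).
  apply: sin_gt0_pi; rewrite divr_gt0 //=; have := pi_ge2 R.
  by move: t2 rho2; clear; lra.
have : 0 < sin (t / 2) ^+ 2 by rewrite exprn_gt0.
rewrite cos_geN1 /=; lra.
Qed.

(** [|z - 1|^2 = (1 - |z|)^2 + 2 (|z| - Re z)], which is at most [rho^2 / 4 + rho^2 / 2]. *)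
Lemma near_one (rho gam r r' : R) (z : C) : 0 < rho -> 1 - rho ^+ 2 / 8 <= gam ->
    1 - rho / 2 <= r -> r' <= 1 + rho / 2 -> r' <= 2 ->
  r <= nm z <= r' -> gam * nm z <= complex.Re z -> disc1 rho z.
Proof.
move=> rho0 gam1 r1 r'1 r'2 /andP[rz zr'] zRe; apply: nm_le_sqr; first exact: ltW.
have sz := nm_sqr z; set s := nm z in sz rz zr' zRe *.
have -> : complex.Re (z - 1) ^+ 2 + complex.Im (z - 1) ^+ 2 = s ^+ 2 - 2 * complex.Re z + 1.
  by rewrite sz raddfB /= raddfB /=; ring.
have s0 : 0 <= s := nm_ge0 z.
have h1 : (1 - s) ^+ 2 <= (rho / 2) ^+ 2.
  by rewrite -[(1 - s) ^+ 2]real_normK ?num_real // lerXn2r ?nnegrE ?normr_ge0 ?divr_ge0 ?(ltW rho0) // ler_norml; lra.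
have h2 : (1 - gam) * s <= rho ^+ 2 / 8 * 2.
  apply: (@le_trans _ _ (rho ^+ 2 / 8 * s)); first by rewrite ler_wpM2r //; lra.
  by rewrite ler_wpM2l ?divr_ge0 ?exprn_ge0 ?(ltW rho0) //; lra.
have -> : s ^+ 2 - 2 * complex.Re z + 1 = (1 - s) ^+ 2 + 2 * (s - complex.Re z) by ring.
have h3 : s - complex.Re z <= (1 - gam) * s by rewrite mulrBl mul1r lerB.
move: h1; rewrite exprMn; have : 0 <= rho ^+ 2 by rewrite exprn_ge0 ?ltW.
lra.
Qed.

Lemma dented_circle_ge (gam r r' : R) (z : C) : r <= r' -> dented_circle gam r r' z -> r <= nm z.
Proof. by move=> rr' [[-> _]|[/andP[]]|->]. Qed.

(** [P] and [theta] are fixed before [x]. The test set, a lemniscate of [P] cut by the disc of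
    radius [x], contains every [1/z] with [z] on a dented circle whose inner radius is close enough
    to 1. *)
Definition functional_bounded (c : nat -> C) (P : {poly C}) (theta : R) :=
  forall x : R, 1 < x -> exists2 B, 0 <= B & forall (p : {poly C}) X, 0 <= X ->
  (forall w, nm w <= x -> nm P.[w] <= theta -> nm p.[w] <= X) ->
  nm (pairing c p) <= B * X.

Lemma functional_bound_at1 (c t : nat -> C) (f g : C -> C) (d0 : R) : 0 < d0 ->
    (forall e : R, 0 < e -> exists B, forall k, nm (c k) <= B * expR (e * k%:R)) ->
    (forall z, nm z < 1 -> tends (psum c z) (f z)) ->
    (forall z, nm (z - 1) < d0 -> tends (psum t (z - 1)) (g z)) ->
    (forall z, nm (z - 1) < d0 -> nm z < 1 -> g z = f z) ->
  exists (P : {poly C}) d (theta : R),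
    [/\ P \is monic, size P = d.+1, (0 < d)%N, 0 < theta < 1 & functional_bounded c P theta].
Proof.
move=> d00 c_growth c_f t_g gf.
pose del := d0 / 2; have del0 : 0 < del by rewrite divr_gt0.
have deld : del < d0 by rewrite ltr_pdivrMr // ltr_pMr // ltr1n.
have [Bt Bt0 tB] : exists2 B : R, 0 <= B & forall k, nm (t k) * del ^+ k <= B.
  have del1 : nm (1 + del%:C%C - 1) < d0 by rewrite addrC addKr nm_real gtr0_norm.
  have [B B0 BP] := tends_terms_bounded (t_g _ del1); exists B => // k.
  by have := BP k; rewrite addrC addKr nmM nmX nm_real gtr0_norm.
(* [rho <= del / 2] makes the expansion of [g] at 1 geometric of ratio [1 / 2] on the disc;
   [rho <= 1 / 2] serves the approximation of [1/z]. *)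
pose rho := Num.min (1 / 2) (del / 2).
have rho0 : 0 < rho by rewrite lt_min !divr_gt0.
have rho12 : rho <= 1 / 2 by rewrite ge_min lexx.
have rhodel : rho <= del / 2 by rewrite ge_min lexx orbT.
have half01 : 0 <= (1 / 2 : R) < 1 by lra.
have g_approx : papprox (disc1 rho) g.
  move=> e e0; have [n /(_ n (leqnn n)) nP] := exists_small_tail Bt0 half01 e0.
  exists ((\poly_(k < n) t k) \Po ('X - 1%:P)) => z zrho.
  rewrite horner_comp hornerXsubC horner_poly -/(psum t (z - 1) n).
  apply: le_trans nP; apply: tends_tail => //; last first.
    by apply: t_g; rewrite (le_lt_trans zrho) // (le_lt_trans rhodel) // ltr_pdivrMr //; lra.
  move=> k; rewrite nmM nmX (le_trans _ (ler_wpM2r _ (tB k))) ?exprn_ge0 //.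
  rewrite -mulrA ler_wpM2l ?nm_ge0 // -exprMn lerXn2r ?nnegrE ?nm_ge0 //.
    by rewrite mulr_ge0 // ltW.
  by rewrite (le_trans zrho) // mulrA mulr1.
have f_approx r : 0 < r < 1 -> forall e : R, 0 < e -> exists T0, forall T, (T0 <= T)%N ->
    forall z, nm z = r -> nm (f z - \sum_(k < T) c k * z ^+ k) <= e.
  (* With this rate [exp(b) r] is the square root of [r], less than 1. *)
  move=> /andP[r0 r1] e e0; pose b := - ln r / 2.
  have b0 : 0 < b by rewrite divr_gt0 // oppr_gt0 ln_lt0 // r0.
  have [B BP] := c_growth b b0.
  have q01 : 0 <= expR b * r < 1.
    rewrite mulr_ge0 ?expR_ge0 ?(ltW r0) //= -[X in _ * X](lnK r0) -expRD expR_lt1 /b.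
    by move: b0; rewrite /b; lra.
  have [n nP] := exists_small_tail (normr_ge0 B) q01 e0.
  exists n => T nT z zr; rewrite -/(psum c z T); apply: le_trans (nP T nT).
  apply: tends_tail => //; last by apply: c_f; rewrite zr.
  move=> k; rewrite nmM nmX zr exprMn mulrA ler_wpM2r ?exprn_ge0 ?(ltW r0) //.
  by rewrite -expRM_natr (le_trans (BP k)) // ler_wpM2r ?expR_ge0 // ler_norm.
have [m [m8 m_even gam1 gam11]] := exists_gamma rho0 rho12.
set gam : R := cos _ in gam1 gam11.
have [P [d [r' [r0 [theta [Pm szP d1 [r'12 r'rho r01 th01] dent]]]]]] := dent_polynomial gam11 (divr_gt0 rho0 (ltr0n _ 2)).
exists P, d, theta; split=> // x x1; have /andP[r'1 r'2] := r'12; have /andP[r00 r0lt1] := r01.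
(* [r >= x^-1] puts [1/z] in the disc of radius [x]; the two other bounds are those of
   [dent_polynomial] and [near_one]. *)
pose r := Num.max r0 (Num.max x^-1 (1 - rho / 2)).
have r0r : r0 <= r by rewrite le_max lexx.
have xr : x^-1 <= r by rewrite !le_max lexx orbT.
have rhor : 1 - rho / 2 <= r by rewrite !le_max lexx !orbT.
have r1 : r < 1.
  by rewrite !gt_max r0lt1 invf_lt1 ?(lt_trans ltr01 x1) // x1 /=; move: rho0; clear; lra.
have rgt0 : 0 < r by apply: lt_le_trans r0r.
have r_01 : 0 < r < 1 by rewrite rgt0.
have rho_02 : 0 <= rho <= 1 / 2 by rewrite ltW.
have fg z : disc1 rho z -> nm z = r -> f z = g z.
  move=> zrho zr; rewrite gf ?zr // (le_lt_trans zrho) // (le_lt_trans rhodel) //.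
  by rewrite ltr_pdivrMr // ; move: del0 deld; clear; lra.
have near1 z : r <= nm z <= r' -> gam * nm z <= complex.Re z -> disc1 rho z.
  exact: near_one.
have [B B0 BP] := contour_functional_bound m8 m_even r_01 r'12 rho_02 (f_approx r r_01) g_approx fg near1.
exists B => // p X X0 pX; apply: BP => // z zd.
have rz : r <= nm z by apply: dented_circle_ge zd; rewrite (le_trans (ltW r1)) // ltW.
apply: pX; last by apply: dent zd; rewrite r0r.
rewrite nmV invf_ple ?posrE ?(lt_trans ltr01 x1) ?(lt_le_trans rgt0 rz) //.
exact: le_trans xr rz.
Qed.

(** Rotation to [zeta = 1]: [c_k zeta^k] replaces [c_k], and the polynomial [P] found there is
    turned back into the monic [zeta^-d P(zeta X)]. *)
Lemma functional_bound_of_continuation (c t : nat -> C) (f g : C -> C) zeta (d0 : R) :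
    nm zeta = 1 -> 0 < d0 ->
    (forall e : R, 0 < e -> exists B, forall k, nm (c k) <= B * expR (e * k%:R)) ->
    (forall z, nm z < 1 -> tends (psum c z) (f z)) ->
    (forall z, nm (z - zeta) < d0 -> tends (psum t (z - zeta)) (g z)) ->
    (forall z, nm (z - zeta) < d0 -> nm z < 1 -> g z = f z) ->
  exists (P : {poly C}) d (theta : R),
    [/\ P \is monic, size P = d.+1, (0 < d)%N, 0 < theta < 1 & functional_bounded c P theta].
Proof.
move=> z1 d00 c_growth c_f t_g gf.
have nz : zeta != 0 by rewrite -nm_eq0 z1 oner_eq0.
have psum_rot u z n : psum (fun k => u k * zeta ^+ k) z n = psum u (zeta * z) n.
  by apply: eq_bigr => k _; rewrite exprMn mulrA.
have dist z : nm (zeta * z - zeta) = nm (z - 1).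
  by rewrite -{2}[zeta]mulr1 -mulrBr nmM z1 mul1r.
have [||||P [d [theta [Pm szP d1 th01 Pc]]]] := @functional_bound_at1 (fun k => c k * zeta ^+ k)
    (fun k => t k * zeta ^+ k) (fun z => f (zeta * z)) (fun z => g (zeta * z)) d0 d00.
- move=> e /c_growth[B BP]; exists B => k; by rewrite nmM nmX z1 expr1n mulr1.
- move=> z zz e e0; have [|N NP] := c_f (zeta * z) _ e e0; first by rewrite nmM z1 mul1r.
  by exists N => n /NP; rewrite psum_rot.
- move=> z zz e e0; have [|N NP] := t_g (zeta * z) _ e e0; first by rewrite dist.
  by exists N => n /NP; rewrite psum_rot mulrBr mulr1.
- by move=> z zz zlt; apply: gf; rewrite ?dist // nmM z1 mul1r.
have Pd : P`_d = 1 by have := monicP Pm; rewrite lead_coefE szP.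
have sz : size (zeta ^- d *: rotate zeta P) = d.+1.
  rewrite size_scale ?invr_eq0 ?expf_neq0 // size_poly_eq ?szP //= Pd mul1r.
  exact: expf_neq0.
exists (zeta ^- d *: rotate zeta P), d, theta; split=> //.
  rewrite monicE lead_coefE sz coefZ coef_poly szP ltnSn Pd mul1r mulVf //.
  exact: expf_neq0.
move=> x x1; have [B B0 BP] := Pc x x1; exists B => // p X X0 pX.
rewrite -(pairing_rotate _ _ nz); apply: BP => // w wx wP.
rewrite horner_rotate; apply: pX; first by rewrite nmM nmV z1 invr1 mul1r.
by rewrite hornerZ horner_rotate nmM nmV nmX z1 expr1n invr1 mul1r mulrA divff // mul1r.
Qed.

End FunctionalBound.

(** * The dichotomy between natural boundary and rationality *)

Local Open Scope classical_set_scope.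
Local Open Scope ring_scope.

Theorem theorem1p2 (R : realType) (S : set nat)
    (S_pos : forall n, S n -> (0 < n)%N)
    (S_sparse : (fun n : nat => (\sum_(1 <= k < n.+1 | k \in S) 1)%N%:R : R)
        =o_\oo (fun n : nat => n%:R / ln (n%:R : R)))
    (K : fieldExtType rat) (iota : {rmorphism K -> R[i]}) (a : nat -> K)
    (a_cvg : forall sigma : {rmorphism K -> R[i]},
        converges_on_unit_disc (sigma \o a))
    (a_den : forall beta : R, 1 < beta -> \forall n \near \oo,
        (\big[lcmn/1%N]_(0 <= k < n.+1 | k \notin S) den (a k))%:R < beta ^+ n) :
  natural_boundary (iota \o a) \/
  exists b : nat -> K,
    rational_with_root_of_unity_poles (iota \o b) /\
    forall n, (0 < n)%N -> ~ S n -> a n = b n.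
Proof.
have lt1 (z : R[i]) : nm z < 1 -> `|z| < 1 by rewrite -nm_lt.
have [|/existsNP[zeta /not_implyP[zeta1 /contrapT cont]]] := pselect (natural_boundary (iota \o a)).
  by left.
right.
have a_growth := disc_growth_embeddings iota a_cvg.
have S_log := in_S_log S_pos S_sparse.
have den_subexp := lcm_den_subexp a_den.
have [P [d [theta [P_monic szP d0 th01 P_bound]]]] :
  exists (P : {poly R[i]}) d (theta : R), [/\ P \is monic, size P = d.+1, (0 < d)%N,
    0 < theta < 1 & functional_bounded (iota \o a) P theta].
  have [g [t [_ [/pos_real[d1 d10 ->] /power_series_atP[d2 d20 tP] gP]]]] := continues_at_bound cont.
  apply: (@functional_bound_of_continuation R (iota \o a) t (fun z => cpsum (iota \o a) z) g zeta (Num.min d1 d2)).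
  - by apply: complexI; rewrite -nmE zeta1.
  - by rewrite lt_min d10.
  - by apply: disc_growth; apply: a_cvg.
  - move=> z z1; apply: cpsum_tends; exact: (a_cvg iota z (lt1 z z1)).
  - by move=> z; rewrite lt_min => /andP[_ /tP].
  - move=> z; rewrite lt_min => /andP[zd _] z1; apply: gP; last exact: lt1.
    by rewrite nm_lt.
have [E0 E0P] := window_relation_ub a_growth den_subexp S_log P_monic szP d0 th01 P_bound.
have [b [k0 [b_rec ba]]] := window_relation_recurrence (numfield_pchar K) E0P.
have [Q [N [nzQ Qb Q0 Qmin]]] := minimal_annihilator b_rec.
exists b; split; last first.
  by move=> n _ nSn; rewrite ba //; apply/negP => /set_mem.
have Q_roots (l : R[i]) (rt : root (map_poly iota Q) l) :=
  annihilator_roots_of_unity (in_S_sparse S_pos S_sparse) ba a_growth den_subexp nzQ Qb Q0 Qmin rt.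
apply: (@rational_of_recurrence R (map_poly iota Q) (iota \o b) N).
- by rewrite map_poly_eq0.
- by move=> k Nk; rewrite act_map Qb // rmorph0.
- exact: Q_roots.
Qed.
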